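(* Let $\psi_1$ be the function on $\mathbb{D}=\mathbb{C}\setminus(-\infty,0]$ defined below. Then for every complex $y$ with $\operatorname{Re}(y)>0$, \begin{align*} \sum_{n=1}^{\infty}\frac{\log(n) }{e^{ny}-1}&=-\frac{1}{4}\log(2\pi)+\frac{1}{2y}\log^{2}(y)-\frac{\gamma^2}{2y}+\frac{\pi^2}{12y}\\ &\quad-\frac{2}{y}(\gamma+\log(y))\sum_{n=1}^{\infty}\left\{\log\left(\frac{2\pi n}{y}\right)-\frac{1}{2}\left(\psi\left(\frac{2\pi in}{y}\right)+\psi\left(-\frac{2\pi in}{y}\right)\right)\right\}\\ &\quad+\frac{1}{y}\sum_{n=1}^{\infty}\left\{\psi_1\left(\frac{2\pi in}{y}\right)+\psi_1\left(-\frac{2\pi in}{y}\right)-\frac{1}{2}\left(\log^{2}\left(\frac{2\pi in}{y}\right)+\log^{2}\left(-\frac{2\pi in}{y}\right)\right)+\frac{y}{4n}\right\}. \end{align*} Equivalently, for $\operatorname{Re}(y)>0$, \begin{align*} &y\sum_{n=1}^{\infty}\frac{\gamma+\log(ny) }{e^{ny}-1}-\frac{1}{4}y\log(y)+y\left(\frac{1}{4}\log(2\pi)-\frac{\gamma}{4}\right)+\frac{1}{2}\log^2 (y)-\frac{\gamma^2}{2}-\frac{\pi^2}{12}\\ &=\sum_{n=1}^{\infty}\left\{\psi_1\left(\frac{2\pi in}{y}\right)+\psi_1\left(-\frac{2\pi in}{y}\right)-\frac{1}{2}\left(\log^{2}\left(\frac{2\pi in}{y}\right)+\log^{2}\left(-\frac{2\pi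 in}{y}\right)\right)+\frac{y}{4n}\right\}. \end{align*}
   Context: $\log$ denotes the principal branch of the logarithm, $\gamma$ is Euler's constant, and $\psi(z)=\Gamma'(z)/\Gamma(z)$ is the digamma function. $\gamma_1$ is the first Stieltjes constant, $\gamma_1=\lim_{n\to\infty}\left(\sum_{j=1}^{n}\frac{\log(j)}{j}-\frac{\log^{2}(n)}{2}\right)$. For $z\in\mathbb{D}=\mathbb{C}\setminus\{x\in\mathbb{R}: x\le 0\}$, $\psi_1(z)=-\gamma_1-\frac{\log(z)}{z}-\sum_{n=1}^{\infty}\left(\frac{\log(n+z)}{n+z}-\frac{\log(n)}{n}\right)$ (this is one half of the derivative of Deninger's function $R(z)$). *)

(* Defs.v *)
From Stdlib Require Import Reals Factorial.
From Coquelicot Require Import Coquelicot.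
Open Scope C_scope.

Definition Cexp (z : C) : C :=
  (exp (Re z) * cos (Im z), exp (Re z) * sin (Im z))%R.

(* Principal argument: for [z <> 0] it lies in (-PI, PI]. *)
Definition Carg (z : C) : R :=
  if Rle_dec 0 (Im z) then acos (Re z / Cmod z)
  else (- acos (Re z / Cmod z))%R.

Definition Clog (z : C) : C := (ln (Cmod z), Carg z).

(* [Lim_seq] and [Series] are real-valued in Coquelicot; these are the
   componentwise versions on [C].  As there, the value is only meaningful when
   the limit (resp. the sum) exists. *)
Definition CLim_seq (u : nat -> C) : C :=
  (real (Lim_seq (fun n => Re (u n))), real (Lim_seq (fun n => Im (u n)))).

Definition CSeries (a : nat -> C) : C :=
  (Series (fun n => Re (a n)), Series (fun n => Im (a n))).

(* Series over n >= 1: the term [a 0] is dropped. *)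
Definition ex_series1 (a : nat -> C) : Prop :=
  @ex_series C_AbsRing C_NormedModule (fun k => a (S k)).

Definition CSeries1 (a : nat -> C) : C := CSeries (fun k => a (S k)).

Definition euler_gamma : R :=
  real (Lim_seq (fun n => sum_n_m (fun j => / INR j) 1 n - ln (INR n))%R).

Definition stieltjes1 : R :=
  real (Lim_seq (fun n =>
    sum_n_m (fun j => ln (INR j) / INR j) 1 n - (ln (INR n)) ^ 2 / 2)%R).

Fixpoint Crising (z : C) (n : nat) : C :=
  match n with
  | O => 1
  | S m => Crising z m * (z + INR m)
  end.

(* The Euler-Gauss limit n! n^z / (z (z + 1) ... (z + n)), which gives the Gamma
   function on all of C minus {0, -1, -2, ...} at once. *)
Definition CGamma (z : C) : C :=
  CLim_seq (fun n =>
    INR (fact n) * Cexp (z * ln (INR n)) / Crising z (S n)).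

(* [C_derive] is the complex derivative wherever the function is complex
   differentiable ([is_C_derive_unique]), as Gamma is off 0, -1, -2, ... *)
Definition digamma (z : C) : C := C_derive CGamma z / CGamma z.

(* Half the derivative of Deninger's function R; not the trigamma function. *)
Definition psi1 (z : C) : C :=
  - stieltjes1 - Clog z / z
  - CSeries1 (fun n =>
      Clog (INR n + z) / (INR n + z) - Clog (INR n) / INR n).

Definition lambert_log (y : C) (n : nat) : C :=
  Clog (INR n) / (Cexp (INR n * y) - 1).

Definition lambert_gamma_log (y : C) (n : nat) : C :=
  (euler_gamma + Clog (INR n * y)) / (Cexp (INR n * y) - 1).

Definition digamma_term (y : C) (n : nat) : C :=
  Clog (2 * PI * INR n / y)
  - 1 / 2 * (digamma (2 * PI * Ci * INR n / y)
             + digamma (- (2 * PI * Ci * INR n / y))).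

Definition psi1_term (y : C) (n : nat) : C :=
  psi1 (2 * PI * Ci * INR n / y) + psi1 (- (2 * PI * Ci * INR n / y))
  - 1 / 2 * (Clog (2 * PI * Ci * INR n / y) ^ 2
             + Clog (- (2 * PI * Ci * INR n / y)) ^ 2)
  + y / (4 * INR n).

(* Main.v *)
(** Put [a = 2 pi i / y] and [l w = (al + be * log w) / w], with primitive [A].
    The terms of both series on the right are sums over [n >= 0] of the defects
    of the trapezoidal rule for [l] on [[n + z, n + 1 + z]], taken at [z = k a] and
    [z = - k a]; [(al, be)] is [(1, 0)] for the digamma and [(0, 1)] for the [psi1]
    series.  These defects are [O (|n + z| ^ (- 5 / 2))], so the sums over [k] and [n]
    can be exchanged.  For fixed [n] the sum over all integers [k] comes from a
    Lipschitz formula: [sum_k (l (x + k a) - l (x' + k a))] equals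
    [y * sum_m rho_m (exp (- m x y) - exp (- m x' y))] with
    [rho_m = al - be (log y + gamma + log m)].  That formula is the limit, over
    [N]-th roots of unity with [N = 2 r + 1], of the identity
    [sum_j H_j q ^ j = - log (1 - q) / (1 - q)], since [H_(N m) - log N] tends to
    [gamma + log m].  Summing over [n] leaves the Lambert series and the behaviour
    of [sum_m rho_m exp (- m x y)] as [x -> 0], again read off from generating
    functions of harmonic numbers; there the values of [sum 1 / n ^ 2] and of
    Stirling's constant enter. *)

Require Import Defs.
From Stdlib Require Import Reals Factorial Lra Lia Psatz.
From Coquelicot Require Import Coquelicot.
Open Scope C_scope.

(** Since [log (k a) - log (- k a) = i pi], the values of [log w / w] at [x + k a] and [x - k a] add
    up to about [i pi / (k a)], so their sum over [k] diverges. Hence the Lipschitz formula compares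
    two abscissas: in its discrete form the divergence sits in the term of exponent 0, with
    coefficient [al + be * log N], which cancels in the difference. A trapezoidal defect is an
    average of such differences. The same [i pi], in the part [- log z / (2 z)] of [psi1], produces
    the summand [y / (4 n)].

    The exponent [5 / 2] comes from bounding a logarithm by a multiple of [|w| ^ (1 / 2)]; split as
    [5 / 4 + 5 / 4], it leaves a product of two convergent majorants.

    For [Re y > 0] and [x > 0], multiplication by [y] moves [x + k a] to the right half-plane, where
    [log (y w) = log y + log w] has no branch jump.

    For [n = 0] and [k = 0] the interval would start at the singularity of [l], so row 0 is a limit
    from the right. There [gamma + log m] is traded for a harmonic number; the errors sum to
    constants in closed form, and what remains is explicit in [log (1 - exp (- x y))]. *)

(** * Real and imaginary parts, modulus *)

Lemma Re_plus (a b : C) : Re (a + b) = (Re a + Re b)%R. Proof. reflexivity. Qed.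
Lemma Im_plus (a b : C) : Im (a + b) = (Im a + Im b)%R. Proof. reflexivity. Qed.
Lemma Re_opp (a : C) : Re (- a) = (- Re a)%R. Proof. reflexivity. Qed.
Lemma Im_opp (a : C) : Im (- a) = (- Im a)%R. Proof. reflexivity. Qed.
Lemma Re_mult (a b : C) : Re (a * b) = (Re a * Re b - Im a * Im b)%R. Proof. reflexivity. Qed.
Lemma Im_mult (a b : C) : Im (a * b) = (Re a * Im b + Im a * Re b)%R. Proof. reflexivity. Qed.
Lemma Re_minus (a b : C) : Re (a - b) = (Re a - Re b)%R. Proof. reflexivity. Qed.
Lemma Im_minus (a b : C) : Im (a - b) = (Im a - Im b)%R. Proof. reflexivity. Qed.
Lemma Re_R (x : R) : Re (RtoC x) = x. Proof. reflexivity. Qed.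
Lemma Im_R (x : R) : Im (RtoC x) = 0%R. Proof. reflexivity. Qed.
Lemma Re_pair (x y : R) : Re (x, y) = x. Proof. reflexivity. Qed.
Lemma Im_pair (x y : R) : Im (x, y) = y. Proof. reflexivity. Qed.
Lemma Re_Ci : Re Ci = 0%R. Proof. reflexivity. Qed.
Lemma Im_Ci : Im Ci = 1%R. Proof. reflexivity. Qed.

Ltac creim := repeat progress (rewrite ?Re_plus, ?Im_plus, ?Re_minus, ?Im_minus, ?Re_opp, ?Im_opp,
  ?Re_mult, ?Im_mult, ?Re_R, ?Im_R, ?Re_Ci, ?Im_Ci, ?Re_pair, ?Im_pair in * ).

Lemma C_eq (a b : C) : Re a = Re b -> Im a = Im b -> a = b.
Proof. destruct a, b; simpl; intros; subst; reflexivity. Qed.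

Lemma Cmod_minus_sym (a b : C) : Cmod (a - b) = Cmod (b - a).
Proof. rewrite <- (Cmod_opp (b - a)). f_equal. ring. Qed.

Lemma Cmod_triangle_minus (a b : C) : (Cmod (a - b) <= Cmod a + Cmod b)%R.
Proof. unfold Cminus. eapply Rle_trans. apply Cmod_triangle. rewrite Cmod_opp. lra. Qed.

Lemma Cmod_triangle_rev (a b : C) : (Cmod a - Cmod b <= Cmod (a - b))%R.
Proof.
  assert (H := Cmod_triangle (a - b) b). replace (a - b + b) with a in H by ring. lra.
Qed.

Lemma im_le_Cmod (c : C) : (Rabs (Im c) <= Cmod c)%R.
Proof.
  eapply Rle_trans. 2: apply Rmax_Cmod. apply Rmax_r.
Qed.

Lemma Cmod_le_Re_Im (c : C) : (Cmod c <= Rabs (Re c) + Rabs (Im c))%R.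
Proof.
  replace c with (RtoC (Re c) + Ci * RtoC (Im c)) at 1.
  - eapply Rle_trans. apply Cmod_triangle. rewrite Cmod_mult, Cmod_Ci, !Cmod_R. lra.
  - apply C_eq; creim; ring.
Qed.

Lemma Cmod_sqr (c : C) : (Cmod c * Cmod c = Re c * Re c + Im c * Im c)%R.
Proof. assert (H := Cmod2_alt c). simpl in H. nra. Qed.

Lemma Cmod_pos (c : C) : c <> 0 -> (0 < Cmod c)%R.
Proof. apply Cmod_gt_0. Qed.

Lemma Cmod_neq_0 (c : C) : (0 < Cmod c)%R -> c <> 0.
Proof. apply Cmod_gt_0. Qed.

(** * Limits of complex sequences *)

(** Stated through the modulus of the difference, so that limit arguments reduce to squeezes of real
    sequences. *)
Definition Clim (u : nat -> C) (l : C) : Prop := is_lim_seq (fun n => Cmod (u n - l)) 0%R.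

Lemma Clim_eps (u : nat -> C) (l : C) :
  (forall eps : R, (0 < eps)%R -> exists N, forall n, (N <= n)%nat -> (Cmod (u n - l) < eps)%R) ->
  Clim u l.
Proof.
  intros H. apply is_lim_seq_spec. intros eps. destruct (H eps (cond_pos eps)) as [N HN].
  exists N. intros n Hn. rewrite Rminus_0_r, Rabs_pos_eq by apply Cmod_ge_0. now apply HN.
Qed.

Lemma Clim_eps_inv (u : nat -> C) (l : C) : Clim u l ->
  forall eps : R, (0 < eps)%R -> exists N, forall n, (N <= n)%nat -> (Cmod (u n - l) < eps)%R.
Proof.
  intros H eps He. apply is_lim_seq_spec in H. destruct (H (mkposreal eps He)) as [N HN].
  exists N. intros n Hn. specialize (HN n Hn). simpl in HN.
  rewrite Rminus_0_r, Rabs_pos_eq in HN by apply Cmod_ge_0. exact HN.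
Qed.

Lemma lim0_eps (u : nat -> R) : is_lim_seq u 0%R ->
  forall eps : R, (0 < eps)%R -> exists N, forall n, (N <= n)%nat -> (Rabs (u n) < eps)%R.
Proof.
  intros H eps He. apply is_lim_seq_spec in H. destruct (H (mkposreal eps He)) as [N HN].
  exists N. intros n Hn. specialize (HN n Hn). simpl in HN. now rewrite Rminus_0_r in HN.
Qed.

Lemma Clim_squeeze (u : nat -> C) (l : C) (b : nat -> R) (N : nat) :
  (forall n, (N <= n)%nat -> (Cmod (u n - l) <= b n)%R) -> is_lim_seq b 0%R -> Clim u l.
Proof.
  intros H Hb. apply is_lim_seq_le_le_loc with (fun _ => 0%R) b; auto using is_lim_seq_const.
  exists N. intros n Hn. split; auto. apply Cmod_ge_0.
Qed.

Lemma Clim_ext_loc (u v : nat -> C) (l : C) (N : nat) :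
  (forall n, (N <= n)%nat -> u n = v n) -> Clim u l -> Clim v l.
Proof.
  intros H Hu. apply is_lim_seq_ext_loc with (2 := Hu). exists N. intros n Hn. now rewrite H.
Qed.

Lemma Clim_ext (u v : nat -> C) (l : C) : (forall n, u n = v n) -> Clim u l -> Clim v l.
Proof. intros H. apply Clim_ext_loc with O; auto. Qed.

Lemma Clim_const (l : C) : Clim (fun _ => l) l.
Proof.
  apply Clim_squeeze with (fun _ => 0%R) O; auto using is_lim_seq_const.
  intros. replace (l - l) with (RtoC 0) by ring. rewrite Cmod_0. lra.
Qed.

Lemma is_lim_seq_0_plus (u v : nat -> R) :
  is_lim_seq u 0%R -> is_lim_seq v 0%R -> is_lim_seq (fun n => u n + v n)%R 0%R.
Proof.
  intros. replace (Finite 0%R) with (Finite (0 + 0)%R) by (f_equal; ring).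
  now apply is_lim_seq_plus'.
Qed.

Lemma is_lim_seq_0_scal (c : R) (u : nat -> R) :
  is_lim_seq u 0%R -> is_lim_seq (fun n => c * u n)%R 0%R.
Proof.
  intros. replace (Finite 0%R) with (Finite (c * 0)%R) by (f_equal; ring).
  apply is_lim_seq_mult'; auto using is_lim_seq_const.
Qed.

Lemma Clim_plus (u v : nat -> C) (l m : C) :
  Clim u l -> Clim v m -> Clim (fun n => u n + v n) (l + m).
Proof.
  intros Hu Hv. apply Clim_squeeze with (fun n => Cmod (u n - l) + Cmod (v n - m))%R O.
  - intros n _. replace (u n + v n - (l + m)) with ((u n - l) + (v n - m)) by ring.
    apply Cmod_triangle.
  - now apply is_lim_seq_0_plus.
Qed.

Lemma Clim_scal (c : C) (u : nat -> C) (l : C) : Clim u l -> Clim (fun n => c * u n) (c * l).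
Proof.
  intros Hu. apply Clim_squeeze with (fun n => Cmod c * Cmod (u n - l))%R O.
  - intros n _. replace (c * u n - c * l) with (c * (u n - l)) by ring.
    rewrite Cmod_mult. lra.
  - now apply is_lim_seq_0_scal.
Qed.

Lemma Clim_opp (u : nat -> C) (l : C) : Clim u l -> Clim (fun n => - u n) (- l).
Proof.
  intros Hu. apply Clim_ext with (fun n => (-1) * u n). intros; ring.
  replace (- l) with ((-1) * l) by ring. now apply Clim_scal.
Qed.

Lemma Clim_minus (u v : nat -> C) (l m : C) :
  Clim u l -> Clim v m -> Clim (fun n => u n - v n) (l - m).
Proof. intros. apply Clim_plus; auto using Clim_opp. Qed.

Lemma Clim_Cmod (u : nat -> C) (l : C) : Clim u l -> is_lim_seq (fun n => Cmod (u n)) (Cmod l).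
Proof.
  intros Hu. apply is_lim_seq_ext with (fun n => (Cmod (u n) - Cmod l) + Cmod l)%R.
  intros; ring.
  replace (Finite (Cmod l)) with (Finite (0 + Cmod l)%R) by (f_equal; ring).
  apply is_lim_seq_plus'. 2: apply is_lim_seq_const.
  apply is_lim_seq_abs_0. 
  apply is_lim_seq_le_le with (fun _ => 0%R) (fun n => Cmod (u n - l)); auto using is_lim_seq_const.
  intros n. split. apply Rabs_pos. apply Rabs_le.
  assert (H1 := Cmod_triangle_rev (u n) l). assert (H2 := Cmod_triangle_rev l (u n)).
  rewrite (Cmod_minus_sym l) in H2. lra.
Qed.

Lemma Clim_mult (u v : nat -> C) (l m : C) :
  Clim u l -> Clim v m -> Clim (fun n => u n * v n) (l * m).
Proof.
  intros Hu Hv.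
  apply Clim_squeeze with (fun n => Cmod (u n) * Cmod (v n - m) + Cmod m * Cmod (u n - l))%R O.
  - intros n _. replace (u n * v n - l * m) with (u n * (v n - m) + m * (u n - l)) by ring.
    eapply Rle_trans. apply Cmod_triangle. rewrite !Cmod_mult. lra.
  - apply is_lim_seq_0_plus.
    + replace (Finite 0%R) with (Finite (Cmod l * 0)%R) by (f_equal; ring).
      apply is_lim_seq_mult'; auto. now apply Clim_Cmod.
    + now apply is_lim_seq_0_scal.
Qed.

Lemma Clim_inv (u : nat -> C) (l : C) : l <> 0 -> Clim u l -> Clim (fun n => / u n) (/ l).
Proof.
  intros Hl Hu. assert (Hp := Cmod_pos l Hl).
  destruct (Clim_eps_inv u l Hu (Cmod l / 2)) as [N HN]. lra.
  apply Clim_squeeze with (fun n => (2 / (Cmod l * Cmod l)) * Cmod (u n - l))%R N.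
  - intros n Hn. specialize (HN n Hn).
    assert (H1 : (Cmod l / 2 < Cmod (u n))%R).
    { assert (H := Cmod_triangle_rev l (u n)). rewrite Cmod_minus_sym in H. lra. }
    assert (Hu0 : u n <> 0) by (apply Cmod_neq_0; lra).
    replace (/ u n - / l) with ((l - u n) / (u n * l)) by (field; auto).
    rewrite Cmod_div, Cmod_mult, Cmod_minus_sym by (now apply Cmult_neq_0).
    unfold Rdiv at 1 2. rewrite (Rmult_comm (Cmod _) (/ _)).
    apply Rmult_le_compat_r. apply Cmod_ge_0.
    replace (2 * / (Cmod l * Cmod l))%R with (/ (Cmod l / 2 * Cmod l))%R by (field; lra).
    apply Rinv_le_contravar; nra.
  - now apply is_lim_seq_0_scal.
Qed.

Lemma Clim_unique (u : nat -> C) (l m : C) : Clim u l -> Clim u m -> l = m.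
Proof.
  intros Hl Hm.
  assert (H := Clim_minus _ _ _ _ Hl Hm).
  assert (H0 : Clim (fun _ => 0) (l - m)) by (revert H; apply Clim_ext; intros; ring).
  assert (H1 := Clim_Cmod _ _ H0).
  assert (H2 : Finite (Cmod (RtoC 0)) = Finite (Cmod (l - m))).
  { rewrite <- (is_lim_seq_unique _ _ H1), Lim_seq_const. reflexivity. }
  injection H2 as H3. rewrite Cmod_0 in H3. symmetry in H3. apply Cmod_eq_0 in H3.
  replace l with (l - m + m) by ring. rewrite H3. ring.
Qed.

Lemma Clim_incr_n (u : nat -> C) (l : C) (N : nat) : Clim (fun n => u (n + N)%nat) l <-> Clim u l.
Proof.
  unfold Clim. split; intros H.
  - now apply is_lim_seq_incr_n with N.
  - now apply (is_lim_seq_incr_n (fun n => Cmod (u n - l)) N).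
Qed.

Lemma Clim_incr_1 (u : nat -> C) (l : C) : Clim (fun n => u (S n)) l <-> Clim u l.
Proof.
  rewrite <- (Clim_incr_n u l 1). split; apply Clim_ext; intros n; f_equal; lia.
Qed.

Lemma Clim_Re (u : nat -> C) (l : C) : Clim u l -> is_lim_seq (fun n => Re (u n)) (Re l).
Proof.
  intros H. apply is_lim_seq_ext with (fun n => Re (u n - l) + Re l)%R.
  intros; creim; ring.
  replace (Finite (Re l)) with (Finite (0 + Re l)%R) by (f_equal; ring).
  apply is_lim_seq_plus'. 2: apply is_lim_seq_const.
  apply is_lim_seq_abs_0.
  apply is_lim_seq_le_le with (fun _ => 0%R) (fun n => Cmod (u n - l)); auto using is_lim_seq_const.
  intros n. split. apply Rabs_pos. apply re_le_Cmod.
Qed.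

Lemma Clim_Im (u : nat -> C) (l : C) : Clim u l -> is_lim_seq (fun n => Im (u n)) (Im l).
Proof.
  intros H. apply is_lim_seq_ext with (fun n => Im (u n - l) + Im l)%R.
  intros; creim; ring.
  replace (Finite (Im l)) with (Finite (0 + Im l)%R) by (f_equal; ring).
  apply is_lim_seq_plus'. 2: apply is_lim_seq_const.
  apply is_lim_seq_abs_0.
  apply is_lim_seq_le_le with (fun _ => 0%R) (fun n => Cmod (u n - l)); auto using is_lim_seq_const.
  intros n. split. apply Rabs_pos. apply im_le_Cmod.
Qed.

Lemma Clim_of_Re_Im (u : nat -> C) (l : C) :
  is_lim_seq (fun n => Re (u n)) (Re l) -> is_lim_seq (fun n => Im (u n)) (Im l) -> Clim u l.
Proof.
  intros H1 H2.
  apply Clim_squeeze with (fun n => Rabs (Re (u n) - Re l) + Rabs (Im (u n) - Im l))%R O.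
  - intros n _. apply Cmod_le_Re_Im.
  - apply is_lim_seq_0_plus; apply -> is_lim_seq_abs_0.
    + replace (Finite 0%R) with (Finite (Re l - Re l)%R) by (f_equal; ring).
      apply is_lim_seq_minus'; auto using is_lim_seq_const.
    + replace (Finite 0%R) with (Finite (Im l - Im l)%R) by (f_equal; ring).
      apply is_lim_seq_minus'; auto using is_lim_seq_const.
Qed.

Lemma Clim_RtoC (u : nat -> R) (l : R) : is_lim_seq u l -> Clim (fun n => RtoC (u n)) (RtoC l).
Proof.
  intros H. apply Clim_of_Re_Im. apply H. apply is_lim_seq_const.
Qed.

Lemma Clim_le (u : nat -> C) (l : C) (B : R) (N : nat) :
  (forall n, (N <= n)%nat -> (Cmod (u n) <= B)%R) -> Clim u l -> (Cmod l <= B)%R.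
Proof.
  intros H Hu. apply Clim_Cmod in Hu.
  assert (K : Rbar_le (Cmod l) B).
  { eapply is_lim_seq_le_loc. 2: exact Hu. 2: apply is_lim_seq_const. exists N. exact H. }
  exact K.
Qed.

Lemma CLim_seq_correct (u : nat -> C) (l : C) : Clim u l -> CLim_seq u = l.
Proof.
  intros H. unfold CLim_seq.
  rewrite (is_lim_seq_unique _ _ (Clim_Re _ _ H)), (is_lim_seq_unique _ _ (Clim_Im _ _ H)).
  now destruct l.
Qed.

(** * Finite sums, with [n] terms *)

(** The upper bound is exclusive, unlike that of [sum_n]: the empty sum exists, so telescoping and
    splitting need no separate first term. *)
Fixpoint csum (f : nat -> C) (n : nat) : C :=
  match n with O => 0 | S m => csum f m + f m end.

Fixpoint rsum (f : nat -> R) (n : nat) : R :=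
  match n with O => 0%R | S m => (rsum f m + f m)%R end.

Lemma csum_S (f : nat -> C) (n : nat) : csum f (S n) = csum f n + f n.
Proof. reflexivity. Qed.

Lemma csum_ext (f g : nat -> C) (n : nat) :
  (forall k, (k < n)%nat -> f k = g k) -> csum f n = csum g n.
Proof. induction n; simpl; intros; auto. rewrite IHn, H; auto. Qed.

Lemma csum_plus (f g : nat -> C) (n : nat) : csum (fun k => f k + g k) n = csum f n + csum g n.
Proof. induction n; simpl. ring. rewrite IHn. ring. Qed.

Lemma csum_minus (f g : nat -> C) (n : nat) : csum (fun k => f k - g k) n = csum f n - csum g n.
Proof. induction n; simpl. ring. rewrite IHn. ring. Qed.

Lemma csum_scal (c : C) (f : nat -> C) (n : nat) : csum (fun k => c * f k) n = c * csum f n.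
Proof. induction n; simpl. ring. rewrite IHn. ring. Qed.

Lemma csum_const (c : C) (n : nat) : csum (fun _ => c) n = INR n * c.
Proof.
  induction n. simpl; ring. simpl csum. rewrite IHn, S_INR, RtoC_plus. ring.
Qed.

Lemma rsum_scal (c : R) (f : nat -> R) (n : nat) : rsum (fun k => c * f k)%R n = (c * rsum f n)%R.
Proof. induction n; simpl. ring. rewrite IHn. ring. Qed.

Lemma csum_first (f : nat -> C) (n : nat) : csum f (S n) = f O + csum (fun k => f (S k)) n.
Proof. induction n. simpl. ring. simpl csum at 1. simpl in IHn. rewrite IHn. simpl. ring. Qed.

Lemma csum_split (f : nat -> C) (n m : nat) :
  csum f (n + m) = csum f n + csum (fun k => f (n + k)%nat) m.
Proof.
  induction m. simpl. rewrite Nat.add_0_r. ring.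
  rewrite Nat.add_succ_r. simpl. rewrite IHm. ring.
Qed.

Lemma csum_telescope (f : nat -> C) (n : nat) : csum (fun k => f (S k) - f k) n = f n - f O.
Proof. induction n; simpl. ring. rewrite IHn. ring. Qed.

Lemma csum_swap (f : nat -> nat -> C) (n m : nat) :
  csum (fun i => csum (f i) m) n = csum (fun j => csum (fun i => f i j) n) m.
Proof.
  induction n; simpl. induction m; simpl; auto. rewrite <- IHm. ring.
  rewrite IHn, csum_plus. reflexivity.
Qed.

Lemma csum_RtoC (f : nat -> R) (n : nat) : csum (fun k => RtoC (f k)) n = RtoC (rsum f n).
Proof. induction n; simpl; auto. rewrite IHn, RtoC_plus. reflexivity. Qed.

Lemma csum_Re (f : nat -> C) (n : nat) : Re (csum f n) = rsum (fun k => Re (f k)) n.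
Proof. induction n; simpl; auto. rewrite <- IHn. reflexivity. Qed.

Lemma csum_Im (f : nat -> C) (n : nat) : Im (csum f n) = rsum (fun k => Im (f k)) n.
Proof. induction n; simpl; auto. rewrite <- IHn. reflexivity. Qed.

Lemma csum_Cmod_le (f : nat -> C) (b : nat -> R) (n : nat) :
  (forall k, (k < n)%nat -> (Cmod (f k) <= b k)%R) -> (Cmod (csum f n) <= rsum b n)%R.
Proof.
  induction n; simpl; intros H. rewrite Cmod_0; lra.
  eapply Rle_trans. apply Cmod_triangle. apply Rplus_le_compat; auto.
Qed.

Lemma csum_diff_le (f : nat -> C) (b : nat -> R) (K n : nat) : (K <= n)%nat ->
  (forall k, (K <= k < n)%nat -> (Cmod (f k) <= b k)%R) ->
  (Cmod (csum f n - csum f K) <= rsum b n - rsum b K)%R.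
Proof.
  induction 1; intros Hb.
  - replace (csum f K - csum f K) with (RtoC 0) by ring. rewrite Cmod_0; lra.
  - simpl. replace (csum f m + f m - csum f K) with (csum f m - csum f K + f m) by ring.
    eapply Rle_trans. apply Cmod_triangle.
    assert (Cmod (f m) <= b m)%R by (apply Hb; lia).
    assert (Cmod (csum f m - csum f K) <= rsum b m - rsum b K)%R. { apply IHle. intros. apply Hb. lia. }
    lra.
Qed.

Lemma rsum_le (f g : nat -> R) (n : nat) :
  (forall k, (k < n)%nat -> (f k <= g k)%R) -> (rsum f n <= rsum g n)%R.
Proof. induction n; simpl; intros; try lra. apply Rplus_le_compat; auto. Qed.

Lemma rsum_incr (b : nat -> R) (n m : nat) :
  (forall k, (0 <= b k)%R) -> (n <= m)%nat -> (rsum b n <= rsum b m)%R.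
Proof. intros Hb. induction 1; simpl. lra. specialize (Hb m). lra. Qed.

(** * Absolutely convergent series *)

Definition summable (b : nat -> R) : Prop :=
  (forall n, (0 <= b n)%R) /\ exists B, forall n, (rsum b n <= B)%R.

Definition cser (f : nat -> C) (l : C) : Prop := Clim (csum f) l.

(** The tails are packaged as one null sequence that bounds every later block; the Cauchy criterion
    and dominated convergence both use them in this form. *)
Lemma summable_tail (b : nat -> R) : summable b ->
  exists t : nat -> R, is_lim_seq t 0%R /\ (forall K, (0 <= t K)%R) /\
    forall K n, (K <= n)%nat -> (rsum b n - rsum b K <= t K)%R.
Proof.
  intros [Hb [B HB]].
  destruct (ex_finite_lim_seq_incr (rsum b) B) as [s Hs]; auto.
  { intros n. simpl. specialize (Hb n). lra. }
  assert (Hle : forall n, (rsum b n <= s)%R).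
  { intros n. assert (K : Rbar_le (rsum b n) s).
    { eapply is_lim_seq_le_loc. 2: apply is_lim_seq_const. 2: exact Hs.
      exists n. intros m Hm. now apply rsum_incr. }
    exact K. }
  exists (fun K => s - rsum b K)%R. repeat split.
  - replace (Finite 0%R) with (Finite (s - s)%R) by (f_equal; ring).
    apply is_lim_seq_minus'; auto using is_lim_seq_const.
  - intros K. specialize (Hle K). lra.
  - intros K n _. specialize (Hle n). lra.
Qed.

Lemma summable_le (b c : nat -> R) :
  (forall n, (0 <= c n <= b n)%R) -> summable b -> summable c.
Proof.
  intros H [Hb [B HB]]. split. intros; apply H.
  exists B. intros n. eapply Rle_trans. 2: apply HB. apply rsum_le. intros; apply H.
Qed.

Lemma summable_scal (c : R) (b : nat -> R) :
  (0 <= c)%R -> summable b -> summable (fun n => c * b n)%R.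
Proof.
  intros Hc [Hb [B HB]]. split. intros; apply Rmult_le_pos; auto.
  exists (c * B)%R. intros n. rewrite rsum_scal. apply Rmult_le_compat_l; auto.
Qed.

Lemma Clim_cauchy (u : nat -> C) (t : nat -> R) : is_lim_seq t 0%R ->
  (forall K n, (K <= n)%nat -> (Cmod (u n - u K) <= t K)%R) -> exists l, Clim u l.
Proof.
  intros Ht H.
  (* One argument for both components: a map [p] that does not increase distances gives a real
     Cauchy sequence. It is used with [Re] and [Im]. *)
  assert (HC : forall p : C -> R, (forall a b, (Rabs (p a - p b) <= Cmod (a - b))%R) ->
     ex_finite_lim_seq (fun n => p (u n))).
  { intros p Hp. apply ex_lim_seq_cauchy_corr. intros eps.
    destruct (lim0_eps t Ht (eps / 2)) as [N HN]. { destruct eps; simpl; lra. }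
    exists N. intros n m Hn Hm.
    specialize (HN N (le_n _)). apply Rabs_lt_between in HN.
    assert (H1 := H N n Hn). assert (H2 := H N m Hm).
    eapply Rle_lt_trans. apply Hp.
    replace (u n - u m) with ((u n - u N) - (u m - u N)) by ring.
    eapply Rle_lt_trans. apply Cmod_triangle_minus. lra. }
  destruct (HC Re) as [a Ha]. { intros x y. apply (re_le_Cmod (x - y)). }
  destruct (HC Im) as [b Hb]. { intros x y. apply (im_le_Cmod (x - y)). }
  exists (a, b). now apply Clim_of_Re_Im.
Qed.

Lemma cser_abs (f : nat -> C) (b : nat -> R) :
  (forall k, (Cmod (f k) <= b k)%R) -> summable b -> exists l, cser f l.
Proof.
  intros H Hb. destruct (summable_tail b Hb) as [t [Ht [_ H1]]].
  apply Clim_cauchy with t; auto. intros K n HK.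
  eapply Rle_trans. apply csum_diff_le with (b := b); auto. auto.
Qed.

Lemma cser_unique (f : nat -> C) (l m : C) : cser f l -> cser f m -> l = m.
Proof. apply Clim_unique. Qed.

Lemma cser_ext (f g : nat -> C) (l : C) : (forall n, f n = g n) -> cser f l -> cser g l.
Proof. intros H. apply Clim_ext. intros. apply csum_ext. auto. Qed.

Lemma cser_plus (f g : nat -> C) (l m : C) :
  cser f l -> cser g m -> cser (fun n => f n + g n) (l + m).
Proof.
  intros Hf Hg. eapply Clim_ext. intros; symmetry; apply csum_plus. now apply Clim_plus.
Qed.

Lemma cser_minus (f g : nat -> C) (l m : C) :
  cser f l -> cser g m -> cser (fun n => f n - g n) (l - m).
Proof.
  intros Hf Hg. eapply Clim_ext. intros; symmetry; apply csum_minus. now apply Clim_minus.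
Qed.

Lemma cser_scal (c : C) (f : nat -> C) (l : C) : cser f l -> cser (fun n => c * f n) (c * l).
Proof.
  intros Hf. eapply Clim_ext. intros; symmetry; apply csum_scal. now apply Clim_scal.
Qed.

Lemma cser_first (f : nat -> C) (l : C) : cser f l <-> cser (fun k => f (S k)) (l - f O).
Proof.
  split; intros H.
  - apply Clim_ext with (fun n => csum f (S n) - f O).
    { intros. rewrite csum_first. ring. }
    apply Clim_minus. now apply Clim_incr_1. apply Clim_const.
  - apply Clim_incr_1. replace l with (f O + (l - f O)) by ring.
    apply Clim_ext with (fun n => f O + csum (fun k => f (S k)) n).
    { intros. now rewrite csum_first. }
    apply Clim_plus; auto using Clim_const.
Qed.

Lemma cser_tail_le (f : nat -> C) (l : C) (b : nat -> R) (B : R) (K : nat) :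
  (forall k, (K <= k)%nat -> (Cmod (f k) <= b k)%R) -> cser f l ->
  (forall n, (K <= n)%nat -> (rsum b n - rsum b K <= B)%R) -> (Cmod (l - csum f K) <= B)%R.
Proof.
  intros Hf Hl HB. eapply (Clim_le (fun n => csum f n - csum f K)) with (N := K).
  - intros n Hn. eapply Rle_trans. apply csum_diff_le with (b := b); auto. intros. apply Hf. lia. auto.
  - apply Clim_minus; auto. apply Clim_const.
Qed.

Lemma csum_lim (f : nat -> nat -> C) (g : nat -> C) (K : nat) :
  (forall k, (k < K)%nat -> Clim (fun j => f j k) (g k)) -> Clim (fun j => csum (f j) K) (csum g K).
Proof.
  induction K; simpl; intros H. apply Clim_const. apply Clim_plus; auto.
Qed.

(* Dominated convergence: the partial sums [F j] may run over a range growing with [j]. *)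
Lemma tannery (f : nat -> nat -> C) (F : nat -> C) (g : nat -> C) (b : nat -> R) :
  summable b ->
  (forall K (B : R), (forall n, (K <= n)%nat -> (rsum b n - rsum b K <= B)%R) ->
     exists J, forall j, (J <= j)%nat -> (Cmod (F j - csum (f j) K) <= B)%R) ->
  (forall k, exists J, forall j, (J <= j)%nat -> (Cmod (f j k) <= b k)%R) ->
  (forall k, Clim (fun j => f j k) (g k)) ->
  exists G, cser g G /\ Clim F G.
Proof.
  intros Hb HF Hf Hg.
  assert (Hgb : forall k, (Cmod (g k) <= b k)%R).
  { intros k. destruct (Hf k) as [J HJ]. eapply Clim_le. 2: apply Hg. exact HJ. }
  destruct (cser_abs g b Hgb Hb) as [G HG]. exists G. split; auto.
  destruct (summable_tail b Hb) as [t [Ht [Htp H1]]].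
  apply Clim_eps. intros eps He.
  destruct (lim0_eps t Ht (eps / 3)) as [K HK]. lra.
  specialize (HK K (le_n _)). apply Rabs_lt_between in HK.
  destruct (HF K (t K)) as [J HJ]. { intros n Hn. now apply H1. }
  destruct (Clim_eps_inv _ _ (csum_lim f g K (fun k _ => Hg k)) (eps / 3)) as [J2 HJ2]. lra.
  exists (Nat.max J J2). intros j Hj.
  assert (A1 : (Cmod (F j - csum (f j) K) <= t K)%R) by (apply HJ; lia).
  assert (A2 : (Cmod (csum (f j) K - csum g K) < eps / 3)%R) by (apply HJ2; lia).
  assert (A3 : (Cmod (G - csum g K) <= t K)%R).
  { apply cser_tail_le with b; auto. }
  replace (F j - G) with ((F j - csum (f j) K) + (csum (f j) K - csum g K) - (G - csum g K)) by ring.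
  eapply Rle_lt_trans. apply Cmod_triangle_minus.
  assert (A4 := Cmod_triangle (F j - csum (f j) K) (csum (f j) K - csum g K)). lra.
Qed.

Lemma tannery_series (f : nat -> nat -> C) (F : nat -> C) (g : nat -> C) (b : nat -> R) :
  summable b -> (forall j, cser (f j) (F j)) ->
  (forall j k, (Cmod (f j k) <= b k)%R) ->
  (forall k, Clim (fun j => f j k) (g k)) ->
  exists G, cser g G /\ Clim F G.
Proof.
  intros Hb HF Hf Hg. apply tannery with f b; auto.
  - intros K B HB. exists O. intros j _. apply cser_tail_le with b; auto.
  - intros k. exists O. auto.
Qed.

(** The variant for sums over roots of unity, where the range [- r <= k <= r] grows with the number
    of roots. *)
Lemma tannery_sums (f : nat -> nat -> C) (n : nat -> nat) (g : nat -> C) (b : nat -> R) :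
  summable b -> (forall K, exists J, forall j, (J <= j)%nat -> (K <= n j)%nat) ->
  (exists J, forall j k, (J <= j)%nat -> (k < n j)%nat -> (Cmod (f j k) <= b k)%R) ->
  (forall k, Clim (fun j => f j k) (g k)) ->
  exists G, cser g G /\ Clim (fun j => csum (f j) (n j)) G.
Proof.
  intros Hb Hn [J HJ] Hg. apply tannery with f b; auto.
  - intros K B HB. destruct (Hn K) as [J' HJ']. exists (Nat.max J J'). intros j Hj.
    eapply Rle_trans. apply csum_diff_le with (b := b). apply HJ'; lia.
    intros. apply HJ; lia. apply HB. apply HJ'; lia.
  - intros k. destruct (Hn (S k)) as [J' HJ']. exists (Nat.max J J'). intros j Hj.
    apply HJ. lia. assert (S k <= n j)%nat by (apply HJ'; lia). lia.
Qed.

(** Dominated convergence in the number [K] of columns kept: row [n] cut after [K] columns is at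
    most [p n] times a bound of the partial sums of [q]. The product form of the majorant makes this
    bound independent of [K]. *)
Lemma cser_fubini (f : nat -> nat -> C) (p q : nat -> R) (Rw Cl : nat -> C) :
  summable p -> summable q -> (forall n k, (Cmod (f n k) <= p n * q k)%R) ->
  (forall n, cser (f n) (Rw n)) -> (forall k, cser (fun n => f n k) (Cl k)) ->
  exists S, cser Rw S /\ cser Cl S.
Proof.
  intros Hp Hq Hf HR HC.
  destruct Hq as [Hq0 [B HB]].
  destruct (tannery_series (fun K n => csum (f n) K) (csum Cl) Rw (fun n => p n * B)%R)
    as [G [H1 H2]].
  - apply summable_le with (fun n => B * p n)%R.
    { intros n. assert (0 <= B)%R by exact (HB O). assert (Hpn := proj1 Hp n). nra. }
    apply summable_scal; auto. exact (HB O).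
  - intros K. induction K; simpl.
    + apply Clim_ext with (fun _ => 0). induction n; simpl; auto. rewrite <- IHn. ring.
      apply Clim_const.
    + apply cser_plus; auto.
  - intros K n. eapply Rle_trans. apply csum_Cmod_le with (b := fun k => (p n * q k)%R). auto.
    rewrite rsum_scal. apply Rmult_le_compat_l; auto. apply Hp.
  - intros n. apply HR.
  - exists G. auto.
Qed.

Lemma is_series_cser (f : nat -> C) (l : C) :
  cser f l -> @is_series C_AbsRing C_NormedModule f l.
Proof.
  intros H. assert (E : forall n, sum_n f n = csum f (S n)).
  { induction n. rewrite sum_O. simpl. ring. rewrite sum_Sn, IHn. reflexivity. }
  intros P HP. apply locally_norm_le_locally in HP. destruct HP as [eps HP].
  destruct (Clim_eps_inv _ _ H eps (cond_pos eps)) as [N HN]. exists N. intros n Hn.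
  apply HP. rewrite E. change (Cmod (csum f (S n) - l) < eps)%R. apply HN. lia.
Qed.

Lemma sum_n_rsum (f : nat -> R) (n : nat) : sum_n f n = rsum f (S n).
Proof. induction n. rewrite sum_O. simpl. ring. rewrite sum_Sn, IHn. reflexivity. Qed.

Lemma CSeries_cser (f : nat -> C) (l : C) : cser f l -> CSeries f = l.
Proof.
  intros H. unfold CSeries, Series.
  rewrite (is_lim_seq_unique _ (Re l)), (is_lim_seq_unique _ (Im l)).
  - now destruct l.
  - apply is_lim_seq_ext with (fun n => Im (csum f (S n))).
    intros. now rewrite csum_Im, sum_n_rsum. apply (Clim_Im (fun n => csum f (S n))).
    now apply Clim_incr_1.
  - apply is_lim_seq_ext with (fun n => Re (csum f (S n))).
    intros. now rewrite csum_Re, sum_n_rsum. apply (Clim_Re (fun n => csum f (S n))).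
    now apply Clim_incr_1.
Qed.

(** * Derivative of a complex function of a real variable *)

(** All estimates run along real segments in [C], so a derivative in one real parameter, taken
    componentwise, replaces complex differentiability. *)
Definition Dc (f : R -> C) (t : R) (l : C) : Prop :=
  is_derive (fun u => Re (f u)) t (Re l) /\ is_derive (fun u => Im (f u)) t (Im l).

Lemma Dc_eq (f : R -> C) (t : R) (l m : C) : Dc f t l -> l = m -> Dc f t m.
Proof. intros H E. now rewrite <- E. Qed.

Lemma Dc_ext (f g : R -> C) (t : R) (l : C) : (forall u, f u = g u) -> Dc f t l -> Dc g t l.
Proof.
  intros H [H1 H2]. split.
  - eapply is_derive_ext. 2: exact H1. intros; simpl; now rewrite H.
  - eapply is_derive_ext. 2: exact H2. intros; simpl; now rewrite H.
Qed.

Lemma Dc_const (c : C) (t : R) : Dc (fun _ => c) t 0.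
Proof. split; apply (is_derive_const (V := R_NormedModule)). Qed.

Lemma Dc_id (t : R) : Dc (fun u => RtoC u) t 1.
Proof.
  split. exact (is_derive_id (K := R_AbsRing) t). exact (is_derive_const (V := R_NormedModule) 0%R t).
Qed.

Lemma Dc_plus (f g : R -> C) (t : R) (l m : C) :
  Dc f t l -> Dc g t m -> Dc (fun u => f u + g u) t (l + m).
Proof.
  intros [H1 H2] [H3 H4]. split.
  - apply (is_derive_plus (fun u => Re (f u)) (fun u => Re (g u))); auto.
  - apply (is_derive_plus (fun u => Im (f u)) (fun u => Im (g u))); auto.
Qed.

Lemma Dc_minus (f g : R -> C) (t : R) (l m : C) :
  Dc f t l -> Dc g t m -> Dc (fun u => f u - g u) t (l - m).
Proof.
  intros [H1 H2] [H3 H4]. split.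
  - apply (is_derive_minus (fun u => Re (f u)) (fun u => Re (g u))); auto.
  - apply (is_derive_minus (fun u => Im (f u)) (fun u => Im (g u))); auto.
Qed.

Lemma is_derive_R_eq (f : R -> R) (t l m : R) : is_derive f t l -> l = m -> is_derive f t m.
Proof. intros H E. now rewrite <- E. Qed.

Lemma is_derive_Rmult (f g : R -> R) (t a b : R) :
  is_derive f t a -> is_derive g t b ->
  is_derive (fun u => f u * g u)%R t (a * g t + f t * b)%R.
Proof. intros. apply (is_derive_mult f g); auto. intros; apply Rmult_comm. Qed.

Lemma is_derive_Rplus (f g : R -> R) (t a b : R) :
  is_derive f t a -> is_derive g t b -> is_derive (fun u => f u + g u)%R t (a + b)%R.
Proof. intros. apply (is_derive_plus f g); auto. Qed.

Lemma is_derive_Rminus (f g : R -> R) (t a b : R) :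
  is_derive f t a -> is_derive g t b -> is_derive (fun u => f u - g u)%R t (a - b)%R.
Proof. intros. apply (is_derive_minus f g); auto. Qed.

Lemma is_derive_Rcomp (f g : R -> R) (t a b : R) :
  is_derive g t b -> is_derive f (g t) a -> is_derive (fun u => f (g u)) t (a * b)%R.
Proof. intros. rewrite Rmult_comm. apply (is_derive_comp f g); auto. Qed.

Lemma Dc_mult (f g : R -> C) (t : R) (l m : C) :
  Dc f t l -> Dc g t m -> Dc (fun u => f u * g u) t (l * g t + f t * m).
Proof.
  intros [H1 H2] [H3 H4]. split.
  - eapply is_derive_R_eq.
    apply (is_derive_Rminus _ _ _ _ _ (is_derive_Rmult _ _ _ _ _ H1 H3) (is_derive_Rmult _ _ _ _ _ H2 H4)).
    creim. ring.
  - eapply is_derive_R_eq.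
    apply (is_derive_Rplus _ _ _ _ _ (is_derive_Rmult _ _ _ _ _ H1 H4) (is_derive_Rmult _ _ _ _ _ H2 H3)).
    creim. ring.
Qed.

Lemma Dc_scal (c : C) (f : R -> C) (t : R) (l : C) : Dc f t l -> Dc (fun u => c * f u) t (c * l).
Proof.
  intros H. eapply Dc_eq. apply Dc_mult. apply Dc_const. exact H. cbv beta. ring.
Qed.

Lemma Cmod_sqr_pos (z : C) : z <> 0 -> (0 < Re z * Re z + Im z * Im z)%R.
Proof. intros H. apply Cmod_pos in H. rewrite <- Cmod_sqr. nra. Qed.

Lemma RtoC_sqr_conj (z : C) : RtoC (Re z * Re z + Im z * Im z) = z * Cconj z.
Proof. destruct z. apply C_eq; unfold Cconj; simpl; ring. Qed.

Lemma Re_conj (z : C) : Re (Cconj z) = Re z. Proof. reflexivity. Qed.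
Lemma Im_conj (z : C) : Im (Cconj z) = (- Im z)%R. Proof. reflexivity. Qed.

Lemma Dc_inv (f : R -> C) (t : R) (l : C) :
  f t <> 0 -> Dc f t l -> Dc (fun u => / f u) t (- l / (f t * f t)).
Proof.
  intros H0 [H1 H2]. assert (Hp := Cmod_sqr_pos _ H0).
  assert (HN : is_derive (fun u => Re (f u) * Re (f u) + Im (f u) * Im (f u))%R t
     (2 * (Re (f t) * Re l + Im (f t) * Im l))%R).
  { eapply is_derive_R_eq.
    apply (is_derive_Rplus _ _ _ _ _ (is_derive_Rmult _ _ _ _ _ H1 H1) (is_derive_Rmult _ _ _ _ _ H2 H2)).
    ring. }
  assert (HI : is_derive (fun u => / (Re (f u) * Re (f u) + Im (f u) * Im (f u)))%R t
     (- (2 * (Re (f t) * Re l + Im (f t) * Im l)) / (Re (f t) * Re (f t) + Im (f t) * Im (f t)) ^ 2)%R).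
  { apply (is_derive_inv (fun u => Re (f u) * Re (f u) + Im (f u) * Im (f u))%R); auto. lra. }
  (* Writing the value with conjugates gives its components the real denominator [|f t| ^ 4] that
     the real rules produce. *)
  assert (E : - l / (f t * f t) = (- l) * ((Cconj (f t) * Cconj (f t)) *
     RtoC (/ (Re (f t) * Re (f t) + Im (f t) * Im (f t)) ^ 2))).
  { assert (En : RtoC (Re (f t) * Re (f t) + Im (f t) * Im (f t)) = f t * Cconj (f t)).
    { apply RtoC_sqr_conj. }
    assert (Hn : RtoC (Re (f t) * Re (f t) + Im (f t) * Im (f t)) <> 0).
    { intros K. apply RtoC_inj in K. lra. }
    assert (Hc : Cconj (f t) <> 0). { intros K. rewrite K in En. rewrite En in Hn. apply Hn. ring. }
    rewrite RtoC_inv by (apply pow_nonzero; lra). rewrite RtoC_pow, En. field. auto. }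
  rewrite E. split.
  - eapply is_derive_R_eq.
    eapply is_derive_ext; [| apply (is_derive_Rmult _ _ _ _ _ H1 HI)].
    { intros u. simpl. unfold Rdiv. now rewrite !Rmult_1_r. }
    rewrite ?Re_mult, ?Im_mult, ?Re_opp, ?Im_opp, ?Re_mult, ?Im_mult, ?Re_conj, ?Im_conj, ?Re_R, ?Im_R. field. lra.
  - eapply is_derive_R_eq.
    eapply is_derive_ext; [| apply (is_derive_Rmult (fun u => - Im (f u))%R _ _ _ _ (is_derive_opp _ _ _ H2) HI)].
    { intros u. simpl. unfold Rdiv. now rewrite !Rmult_1_r. }
    rewrite ?Re_mult, ?Im_mult, ?Re_opp, ?Im_opp, ?Re_mult, ?Im_mult, ?Re_conj, ?Im_conj, ?Re_R, ?Im_R.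
    change (opp (Im l)) with (- Im l)%R. field. lra.
Qed.

Lemma Dc_div (f g : R -> C) (t : R) (l m : C) :
  g t <> 0 -> Dc f t l -> Dc g t m ->
  Dc (fun u => f u / g u) t ((l * g t - f t * m) / (g t * g t)).
Proof.
  intros H0 Hf Hg. eapply Dc_eq. unfold Cdiv. apply Dc_mult. exact Hf.
  apply Dc_inv; eassumption. cbv beta. field. auto.
Qed.

(** With [d = f b - f a], the real theorem is applied to [Re (conj d * f t)], whose increment is
    [|d| ^ 2]; Cauchy-Schwarz then gives the inequality, although the equality fails for complex
    values. *)
Lemma mean_value (f f' : R -> C) (a b M : R) : (a <= b)%R ->
  (forall t, (a <= t <= b)%R -> Dc f t (f' t)) ->
  (forall t, (a <= t <= b)%R -> (Cmod (f' t) <= M)%R) ->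
  (Cmod (f b - f a) <= M * (b - a))%R.
Proof.
  intros Hab Hf HM. set (d := f b - f a).
  set (g := fun t => (Re d * Re (f t) + Im d * Im (f t))%R).
  destruct (MVT_gen g a b (fun t => Re d * Re (f' t) + Im d * Im (f' t))%R) as [c [Hc Hg]].
  - intros x Hx. rewrite Rmin_left, Rmax_right in Hx by lra.
    destruct (Hf x) as [H1 H2]. lra. unfold g.
    apply (is_derive_Rplus (fun t => Re d * Re (f t))%R (fun t => Im d * Im (f t))%R);
    apply is_derive_scal; auto.
  - intros x Hx. rewrite Rmin_left, Rmax_right in Hx by lra.
    destruct (Hf x) as [H1 H2]. lra.
    apply derivable_continuous_pt. exists (Re d * Re (f' x) + Im d * Im (f' x))%R.
    apply is_derive_Reals. unfold g.
    apply (is_derive_Rplus (fun t => Re d * Re (f t))%R (fun t => Im d * Im (f t))%R);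
    apply is_derive_scal; auto.
  - rewrite Rmin_left, Rmax_right in Hc by lra. specialize (HM c Hc).
    assert (E : (g b - g a = Cmod d * Cmod d)%R). { rewrite Cmod_sqr. unfold g, d. creim. ring. }
    assert (Hd := Cmod_ge_0 d).
    assert (E2 : (Re d * Re (f' c) + Im d * Im (f' c) <= Cmod d * Cmod (f' c))%R).
    { replace (Re d * Re (f' c) + Im d * Im (f' c))%R with (Re (Cconj d * f' c)).
      2: creim; rewrite Re_conj, Im_conj; ring.
      eapply Rle_trans. apply Rle_abs. eapply Rle_trans. apply re_le_Cmod.
      rewrite Cmod_mult, Cmod_conj. lra. }
    rewrite E in Hg. destruct (Req_dec (Cmod d) 0) as [Z|Z].
    + rewrite Z. assert (0 <= Cmod (f' c))%R by apply Cmod_ge_0. nra.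
    + assert (0 < Cmod d)%R by lra. apply Rmult_le_reg_l with (Cmod d); auto.
      rewrite Hg.
      eapply Rle_trans. apply Rmult_le_compat_r. lra. exact E2.
      rewrite Rmult_assoc. apply Rmult_le_compat_l; auto. apply Rmult_le_compat_r; lra.
Qed.

(** * Exponential and logarithm *)

Lemma Cexp_plus (a b : C) : Cexp (a + b) = Cexp a * Cexp b.
Proof.
  unfold Cexp. apply C_eq; creim; rewrite ?exp_plus, ?cos_plus, ?sin_plus; ring.
Qed.

Lemma Cexp_0 : Cexp 0 = 1.
Proof. unfold Cexp. apply C_eq; creim; rewrite ?exp_0, ?cos_0, ?sin_0; ring. Qed.

Lemma Cmod_Cexp (z : C) : Cmod (Cexp z) = exp (Re z).
Proof.
  apply Rsqr_inj. apply Cmod_ge_0. left; apply exp_pos.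
  unfold Rsqr. rewrite Cmod_sqr. unfold Cexp. creim.
  assert (H := sin2_cos2 (Im z)). unfold Rsqr in H.
  replace (_ + _)%R with (exp (Re z) * exp (Re z) * (sin (Im z) * sin (Im z) + cos (Im z) * cos (Im z)))%R by ring.
  rewrite H. ring.
Qed.

Lemma Cexp_neq_0 (z : C) : Cexp z <> 0.
Proof. apply Cmod_neq_0. rewrite Cmod_Cexp. apply exp_pos. Qed.

Lemma Cexp_opp (z : C) : Cexp (- z) = / Cexp z.
Proof.
  assert (H := Cexp_plus z (- z)). replace (z + - z) with (RtoC 0) in H by ring.
  rewrite Cexp_0 in H. assert (H0 := Cexp_neq_0 z).
  replace (Cexp (- z)) with (Cexp z * Cexp (- z) / Cexp z) by (field; auto).
  rewrite <- H. field. auto.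
Qed.

Lemma Cexp_minus (a b : C) : Cexp (a - b) = Cexp a / Cexp b.
Proof. unfold Cminus. now rewrite Cexp_plus, Cexp_opp. Qed.

Lemma Cexp_R (x : R) : Cexp x = RtoC (exp x).
Proof. unfold Cexp. apply C_eq; creim; rewrite ?cos_0, ?sin_0; ring. Qed.

Lemma Cexp_pow (z : C) (n : nat) : Cexp (INR n * z) = (Cexp z ^ n)%C.
Proof.
  induction n. simpl Cpow. replace (INR 0 * z) with (RtoC 0). apply Cexp_0. simpl; ring.
  simpl Cpow. rewrite S_INR, RtoC_plus, <- IHn, <- Cexp_plus. f_equal. ring.
Qed.

Lemma Dc_Cexp (f : R -> C) (t : R) (l : C) : Dc f t l -> Dc (fun u => Cexp (f u)) t (l * Cexp (f t)).
Proof.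
  intros [H1 H2].
  assert (He := is_derive_Rcomp exp _ _ _ _ H1 (is_derive_exp _)).
  assert (Hc := is_derive_Rcomp cos _ _ _ _ H2 (is_derive_cos _)).
  assert (Hs := is_derive_Rcomp sin _ _ _ _ H2 (is_derive_sin _)).
  split; [eapply is_derive_R_eq; [exact (is_derive_Rmult _ _ _ _ _ He Hc)|]
    |eapply is_derive_R_eq; [exact (is_derive_Rmult _ _ _ _ _ He Hs)|]];
  unfold Cexp; creim; ring.
Qed.

Lemma Clog_Cexp (w : C) : (- PI < Im w <= PI)%R -> Clog (Cexp w) = w.
Proof.
  intros H. unfold Clog. rewrite Cmod_Cexp, ln_exp.
  apply C_eq; creim; auto. unfold Carg. rewrite Cmod_Cexp. unfold Cexp; creim.
  assert (Hp := exp_pos (Re w)).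
  replace (exp (Re w) * cos (Im w) / exp (Re w))%R with (cos (Im w)) by (field; lra).
  destruct (Rle_dec 0 (exp (Re w) * sin (Im w))) as [Hs|Hs].
  - apply acos_cos. split; [|lra]. destruct (Rle_dec 0 (Im w)) as [|Hn]; auto. exfalso.
    assert (0 < sin (- Im w))%R by (apply sin_gt_0; lra). rewrite sin_neg in *. nra.
  - rewrite <- cos_neg, acos_cos. ring.
    destruct (Rle_dec 0 (Im w)) as [Hn|Hn]; [|lra].
    assert (0 <= sin (Im w))%R by (apply sin_ge_0; lra). exfalso. apply Hs. nra.
Qed.

Definition slit (z : C) : Prop := (0 < Re z)%R \/ Im z <> 0%R.

Lemma slit_neq_0 (z : C) : slit z -> z <> 0.
Proof. intros [H|H] E; rewrite E in H; simpl in H; lra. Qed.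

(** This quantity is the denominator in the half-angle formula for the argument,
    [2 atan (Im z / (|z| + Re z))]. *)
Lemma slit_Cmod_Re (z : C) : slit z -> (0 < Cmod z + Re z)%R.
Proof.
  intros H. assert (Hz := Cmod_pos _ (slit_neq_0 _ H)).
  assert (E := Cmod_sqr z). destruct H as [H|H]. lra.
  assert (0 < Im z * Im z)%R by nra.
  destruct (Rlt_dec 0 (Cmod z + Re z)); auto. nra.
Qed.

Lemma cos_2atan (t : R) : cos (2 * atan t) = ((1 - t * t) / (1 + t * t))%R.
Proof.
  rewrite cos_2a_cos, cos_atan.
  assert (H : (0 < 1 + t²)%R) by (assert (h := Rle_0_sqr t); lra).
  replace (2 * (1 / sqrt (1 + t²)) * (1 / sqrt (1 + t²)) - 1)%R
    with (2 / (sqrt (1 + t²) * sqrt (1 + t²)) - 1)%R.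
  2: { field. assert (h := sqrt_lt_R0 _ H). lra. }
  rewrite sqrt_sqrt by lra. unfold Rsqr in *. field. lra.
Qed.

Lemma sin_2atan (t : R) : sin (2 * atan t) = (2 * t / (1 + t * t))%R.
Proof.
  rewrite sin_2a, cos_atan, sin_atan.
  assert (H : (0 < 1 + t²)%R) by (assert (h := Rle_0_sqr t); lra).
  replace (2 * (t / sqrt (1 + t²)) * (1 / sqrt (1 + t²)))%R
    with (2 * t / (sqrt (1 + t²) * sqrt (1 + t²)))%R.
  2: { field. assert (h := sqrt_lt_R0 _ H). lra. }
  rewrite sqrt_sqrt by lra. unfold Rsqr in *. field. lra.
Qed.

(* On the slit plane the principal argument is given by a single smooth formula. *)
Definition slog (z : C) : C := (ln (Cmod z), 2 * atan (Im z / (Cmod z + Re z)))%R.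

Lemma Cexp_slog (z : C) : slit z -> Cexp (slog z) = z.
Proof.
  intros H. assert (Hz := Cmod_pos _ (slit_neq_0 _ H)). assert (Hr := slit_Cmod_Re z H).
  assert (E := Cmod_sqr z). unfold Cexp, slog. creim. rewrite exp_ln by auto.
  rewrite cos_2atan, sin_2atan.
  assert (E2 : (1 + Im z / (Cmod z + Re z) * (Im z / (Cmod z + Re z)) = 2 * Cmod z / (Cmod z + Re z))%R).
  { apply Rmult_eq_reg_r with ((Cmod z + Re z) * (Cmod z + Re z))%R. 2: nra.
    field_simplify; [|lra|lra]. nra. }
  rewrite E2. apply C_eq; creim.
  - field_simplify; [|lra]. replace (Im z ^ 2)%R with (Cmod z * Cmod z - Re z * Re z)%R by (rewrite E; ring).
    field. lra.
  - field. lra.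
Qed.

Lemma slog_Im (z : C) : (- PI < Im (slog z) < PI)%R.
Proof. unfold slog. creim. assert (H := atan_bound (Im z / (Cmod z + Re z))). lra. Qed.

Lemma Clog_slog (z : C) : slit z -> Clog z = slog z.
Proof.
  intros H. rewrite <- (Cexp_slog z H) at 1. apply Clog_Cexp.
  assert (K := slog_Im z). lra.
Qed.

Lemma Cexp_Clog (z : C) : slit z -> Cexp (Clog z) = z.
Proof. intros H. rewrite Clog_slog by auto. now apply Cexp_slog. Qed.

Lemma Clog_Im (z : C) : slit z -> (- PI < Im (Clog z) < PI)%R.
Proof. intros H. rewrite Clog_slog by auto. apply slog_Im. Qed.

Lemma Clog_Re (z : C) : Re (Clog z) = ln (Cmod z).
Proof. reflexivity. Qed.

Lemma Clog_Im_right (z : C) : (0 < Re z)%R -> (- (PI / 2) < Im (Clog z) < PI / 2)%R.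
Proof.
  intros H. rewrite Clog_slog by (now left). unfold slog; creim.
  assert (Hz := Cmod_ge_0 z). assert (Hi := im_le_Cmod z). apply Rabs_le_between in Hi.
  assert (A1 : (Im z / (Cmod z + Re z) < 1)%R).
  { apply Rmult_lt_reg_r with (Cmod z + Re z)%R. lra. unfold Rdiv. rewrite Rmult_assoc, Rinv_l; lra. }
  assert (A2 : (-1 < Im z / (Cmod z + Re z))%R).
  { apply Rmult_lt_reg_r with (Cmod z + Re z)%R. lra. unfold Rdiv. rewrite Rmult_assoc, Rinv_l; lra. }
  apply atan_increasing in A1. apply atan_increasing in A2.
  replace (-1)%R with (- (1))%R in A2 by ring. rewrite atan_opp, atan_1 in A2. rewrite atan_1 in A1. lra.
Qed.

Lemma Clog_Im_upper (z : C) : (0 < Im z)%R -> (0 < Im (Clog z) < PI)%R.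
Proof.
  intros H. assert (S : slit z) by (right; lra). split. 2: apply Clog_Im; auto.
  rewrite Clog_slog by auto. unfold slog; creim. assert (H1 := slit_Cmod_Re z S).
  assert (0 < Im z / (Cmod z + Re z))%R by (apply Rdiv_lt_0_compat; auto).
  assert (K := atan_increasing 0 _ H0). rewrite atan_0 in K. lra.
Qed.

Lemma Clog_R (x : R) : (0 < x)%R -> Clog x = RtoC (ln x).
Proof.
  intros H. rewrite <- (Clog_Cexp (RtoC (ln x))). rewrite Cexp_R, exp_ln; auto.
  creim. assert (P := PI_RGT_0). lra.
Qed.

Lemma Clog_unique (z w : C) : Cexp w = z -> (- PI < Im w <= PI)%R -> Clog z = w.
Proof. intros <-. apply Clog_Cexp. Qed.

Lemma Clog_mult (a b : C) : slit a -> slit b -> (- PI < Im (Clog a) + Im (Clog b) <= PI)%R ->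
  Clog (a * b) = Clog a + Clog b.
Proof.
  intros Ha Hb H. apply Clog_unique. rewrite Cexp_plus, !Cexp_Clog; auto. now creim.
Qed.

Lemma slit_R (x : R) : (0 < x)%R -> slit x.
Proof. intros; now left. Qed.

Lemma Clog_scal (x : R) (z : C) : (0 < x)%R -> slit z -> Clog (x * z) = RtoC (ln x) + Clog z.
Proof.
  intros Hx Hz. rewrite Clog_mult; auto using slit_R. now rewrite Clog_R.
  rewrite Clog_R by auto. creim. assert (H := Clog_Im z Hz). lra.
Qed.

Lemma is_derive_Rsqrt (f : R -> R) (t l : R) : (0 < f t)%R -> is_derive f t l ->
  is_derive (fun u => sqrt (f u)) t (l / (2 * sqrt (f t)))%R.
Proof.
  intros H Hf. apply (is_derive_sqrt f t l Hf H).
Qed.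

Lemma Dc_Clog (f : R -> C) (t : R) (l : C) :
  slit (f t) -> Dc f t l -> Dc (fun u => Clog (f u)) t (l / f t).
Proof.
  intros Hs [H1 H2].
  assert (Hz := Cmod_pos _ (slit_neq_0 _ Hs)). assert (Hr := slit_Cmod_Re _ Hs).
  assert (E := Cmod_sqr (f t)).
  assert (HN : is_derive (fun u => Re (f u) * Re (f u) + Im (f u) * Im (f u))%R t
     (2 * (Re (f t) * Re l + Im (f t) * Im l))%R).
  { eapply is_derive_R_eq.
    apply (is_derive_Rplus _ _ _ _ _ (is_derive_Rmult _ _ _ _ _ H1 H1) (is_derive_Rmult _ _ _ _ _ H2 H2)).
    ring. }
  assert (HM : is_derive (fun u => Cmod (f u)) t ((Re (f t) * Re l + Im (f t) * Im l) / Cmod (f t))%R).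
  { assert (Em : forall u, sqrt (Re (f u) * Re (f u) + Im (f u) * Im (f u)) = Cmod (f u)).
    { intros u. rewrite <- Cmod_sqr. apply sqrt_square. apply Cmod_ge_0. }
    eapply is_derive_ext. intros u. apply Em.
    eapply is_derive_R_eq. apply is_derive_Rsqrt. 2: exact HN. rewrite <- E; nra.
    cbv beta. rewrite Em. field. lra. }
  assert (HL := is_derive_Rcomp ln _ _ _ _ HM (is_derive_ln _ Hz)).
  assert (HQ := is_derive_div _ _ _ _ _ H2 (is_derive_Rplus _ _ _ _ _ HM H1) (Rgt_not_eq _ _ Hr)).
  assert (HA := is_derive_Rcomp atan _ _ _ _ HQ (is_derive_atan _)).
  (* The slit plane is open, so near [t] the piecewise [Clog] may be replaced by the smooth formula
     [slog]. *)
  assert (HS : locally t (fun u => slit (f u))).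
  { destruct Hs as [Hs|Hs].
    - assert (C1 : continuous (fun u => Re (f u)) t) by (apply (ex_derive_continuous (fun u => Re (f u))); eexists; eauto).
      apply filter_imp with (fun u => (0 < Re (f u))%R). intros; now left.
      apply (C1 (fun x => (0 < x)%R)). apply (open_gt 0%R). exact Hs.
    - assert (C1 : continuous (fun u => Im (f u)) t) by (apply (ex_derive_continuous (fun u => Im (f u))); eexists; eauto).
      apply filter_imp with (fun u => Im (f u) <> 0%R). intros; now right.
      apply (C1 (fun x => x <> 0%R)). apply (open_neq 0%R). exact Hs. }
  assert (Ed : l / f t = RtoC (/ (Cmod (f t) * Cmod (f t))) * (l * Cconj (f t))).
  { rewrite E. assert (En : RtoC (Re (f t) * Re (f t) + Im (f t) * Im (f t)) = f t * Cconj (f t)).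
    { apply RtoC_sqr_conj. }
    assert (Hn : RtoC (Re (f t) * Re (f t) + Im (f t) * Im (f t)) <> 0).
    { rewrite <- E. intros K. apply RtoC_inj in K. nra. }
    assert (Hc : Cconj (f t) <> 0). { intros K. rewrite K in En. rewrite En in Hn. apply Hn. ring. }
    rewrite RtoC_inv by (rewrite <- E; nra). rewrite En. field.
    split; auto. now apply slit_neq_0. }
  rewrite Ed. split.
  - eapply is_derive_ext_loc.
    { apply filter_imp with (2 := HS). intros u Hu. rewrite Clog_slog by auto. reflexivity. }
    eapply is_derive_R_eq. exact HL. rewrite ?Re_mult, ?Im_mult, ?Re_opp, ?Im_opp, ?Re_mult, ?Im_mult, ?Re_conj, ?Im_conj, ?Re_R, ?Im_R. field. lra.
  - eapply is_derive_ext_loc.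
    { apply filter_imp with (2 := HS). intros u Hu. rewrite Clog_slog by auto. reflexivity. }
    eapply is_derive_R_eq. apply is_derive_scal. exact HA.
    rewrite ?Re_mult, ?Im_mult, ?Re_opp, ?Im_opp, ?Re_mult, ?Im_mult, ?Re_conj, ?Im_conj, ?Re_R, ?Im_R. unfold Rsqr.
    set (x := Re (f t)) in *. set (y := Im (f t)) in *. set (m := Cmod (f t)) in *.
    set (a := Re l). set (b := Im l). change (fst (f t)) with x. change (snd (f t)) with y.
    change (fst l) with a. change (snd l) with b.
    assert (Hq : (1 + (y / (m + x)) ^ 2 = 2 * m / (m + x))%R).
    { apply Rmult_eq_reg_r with ((m + x) * (m + x))%R. 2: nra. field_simplify; [|lra|lra]. nra. }
    assert (Hq' : (1 + y / (m + x) * (y / (m + x)) = 2 * m / (m + x))%R).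
    { rewrite <- Hq. ring. }
    rewrite ?Hq, ?Hq'.
    assert (Ey : (y * y = m * m - x * x)%R) by lra.
    field_simplify_eq; [|lra].
    replace (y ^ 2)%R with (m * m - x * x)%R by nra. ring.
Qed.

(** * Power majorants *)

(** The majorants [(n + 1) ^ (- s)], shifted by one so that index 0 is allowed. *)
Definition pw (s : R) (n : nat) : R := Rpower (INR n + 1) (- s).

Lemma Rpower_pos (x s : R) : (0 < Rpower x s)%R.
Proof. apply exp_pos. Qed.

Lemma pw_pos (s : R) (n : nat) : (0 < pw s n)%R.
Proof. apply Rpower_pos. Qed.

Lemma INR_ge_0 (n : nat) : (0 <= INR n)%R.
Proof. apply pos_INR. Qed.

Lemma exp_le_compat (x y : R) : (x <= y)%R -> (exp x <= exp y)%R.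
Proof. intros [H|H]. left; now apply exp_increasing. rewrite H; lra. Qed.

Lemma ln_le_minus_1 (x : R) : (0 < x)%R -> (ln x <= x - 1)%R.
Proof.
  intros H. assert (K := exp_ineq1_le (ln x)). rewrite exp_ln in K by auto. lra.
Qed.

(** A comparison with an integral without integrals: [log ((x + 1) / x) >= 1 / (x + 1)] and
    [exp u >= 1 + u]. It yields convergence of the power series of exponent above 1 and, later, the
    size of their tails. *)
Lemma pw_telescope (s : R) (n : nat) : (0 < s)%R ->
  (s * pw (1 + s) (S n) <= pw s n - pw s (S n))%R.
Proof.
  intros Hs. unfold pw. rewrite S_INR. set (x := (INR n + 1)%R).
  assert (Hx : (1 <= x)%R) by (unfold x; assert (K := INR_ge_0 n); lra).
  replace (- (1 + s))%R with (- s + - (1))%R by ring. rewrite Rpower_plus.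
  rewrite (Rpower_Ropp (x + 1) 1), Rpower_1 by lra.
  assert (Hq : Rpower x (- s) = (Rpower (x + 1) (- s) * exp (s * (ln (x + 1) - ln x)))%R).
  { unfold Rpower. rewrite <- exp_plus. f_equal. ring. }
  rewrite Hq. assert (Hp := Rpower_pos (x + 1) (- s)).
  assert (Hl : (/ (x + 1) <= ln (x + 1) - ln x)%R).
  { assert (K := ln_le_minus_1 (x / (x + 1))). unfold Rdiv in K.
    rewrite ln_mult, ln_Rinv in K; try lra. 2: apply Rinv_0_lt_compat; lra.
    assert (x * / (x + 1) = 1 - / (x + 1))%R by (field; lra).
    assert (0 < x * / (x + 1))%R by (apply Rdiv_lt_0_compat; lra). lra. }
  assert (He := exp_ineq1_le (s * (ln (x + 1) - ln x))%R).
  assert (s * / (x + 1) <= s * (ln (x + 1) - ln x))%R by (apply Rmult_le_compat_l; lra).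
  nra.
Qed.

Lemma summable_pw (s : R) : (1 < s)%R -> summable (pw s).
Proof.
  intros Hs. split. intros; left; apply pw_pos.
  exists (1 + 1 / (s - 1))%R. 
  assert (H : forall n, (rsum (pw s) (S n) <= 1 + / (s - 1) * (1 - pw (s - 1) n))%R).
  { induction n.
    - simpl. unfold pw. rewrite Rplus_0_l. simpl. rewrite !Rplus_0_l. unfold Rpower.
      rewrite ln_1, !Rmult_0_r, exp_0. lra.
    - simpl rsum in *. assert (K := pw_telescope (s - 1) n). replace (1 + (s - 1))%R with s in K by ring.
      assert (Hi : (0 < / (s - 1))%R) by (apply Rinv_0_lt_compat; lra).
      assert (K2 : (pw s (S n) <= / (s - 1) * (pw (s - 1) n - pw (s - 1) (S n)))%R).
      { apply Rmult_le_reg_l with (s - 1)%R. lra. rewrite <- Rmult_assoc, Rinv_r, Rmult_1_l by lra.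
        apply K. lra. }
      lra. }
  assert (Hi : (0 < / (s - 1))%R) by (apply Rinv_0_lt_compat; lra).
  intros [|n]. simpl. lra. eapply Rle_trans. apply H.
  assert (K := pw_pos (s - 1) n). nra.
Qed.

Lemma Rpower_le_neg (x y s : R) : (0 < x <= y)%R -> (0 <= s)%R -> (Rpower y (- s) <= Rpower x (- s))%R.
Proof.
  intros Hx Hs. rewrite !Rpower_Ropp. apply Rinv_le_contravar. apply Rpower_pos.
  apply Rle_Rpower_l; lra.
Qed.

Lemma pw_lim (s : R) : (0 < s)%R -> is_lim_seq (pw s) 0%R.
Proof.
  intros Hs.
  destruct (summable_tail (fun n => s * pw (1 + s) (S n))%R) as [t [Ht [Htp Hk]]].
  { split. intros. apply Rmult_le_pos. lra. left; apply pw_pos.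
    exists 1%R. intros n. eapply Rle_trans. apply rsum_le. intros k _. apply (pw_telescope s k Hs).
    assert (E : rsum (fun k => pw s k - pw s (S k))%R n = (pw s O - pw s n)%R).
    { induction n; simpl. ring. rewrite IHn. ring. }
    rewrite E. assert (K := pw_pos s n). unfold pw at 1. simpl. rewrite Rplus_0_l.
    unfold Rpower. rewrite ln_1, Rmult_0_r, exp_0. lra. }
  apply is_lim_seq_spec. intros eps.
  assert (He := cond_pos eps). set (e := pos eps) in *.
  (* Chosen so that [B ^ (- s) = e]: beyond [B] the terms are below [e]. *)
  set (B := Rpower e (- / s)).
  destruct (INR_unbounded B) as [N HN].
  exists N. intros n Hn. rewrite Rminus_0_r, Rabs_pos_eq by (left; apply pw_pos).
  unfold pw. apply le_INR in Hn.
  assert (HB := Rpower_pos e (- / s)). fold B in HB.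
  replace e with (Rpower B (- s)).
  - unfold Rpower at 1 2. apply exp_increasing. 
    assert (ln B < ln (INR n + 1))%R by (apply ln_increasing; lra). nra.
  - unfold B. rewrite Rpower_mult. replace (- / s * - s)%R with 1%R by (field; lra).
    apply Rpower_1. auto.
Qed.

(** * Continuity along sequences *)

Lemma Clim_Cexp (u : nat -> C) (l : C) : Clim u l -> Clim (fun n => Cexp (u n)) (Cexp l).
Proof.
  intros H. assert (H1 := Clim_Re _ _ H). assert (H2 := Clim_Im _ _ H).
  apply Clim_of_Re_Im; unfold Cexp; creim; apply is_lim_seq_mult';
  apply is_lim_seq_continuous; auto.
  - apply derivable_continuous_pt, derivable_pt_exp.
  - apply continuity_cos.
  - apply derivable_continuous_pt, derivable_pt_exp.
  - apply continuity_sin.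
Qed.

Lemma Clim_slit (u : nat -> C) (l : C) : slit l -> Clim u l ->
  exists N, forall n, (N <= n)%nat -> slit (u n).
Proof.
  intros [Hl|Hl] H.
  - destruct (Clim_eps_inv _ _ H (Re l) Hl) as [N HN]. exists N. intros n Hn. left.
    specialize (HN n Hn). assert (K := re_le_Cmod (u n - l)). creim.
    apply Rabs_le_between in K. lra.
  - destruct (Clim_eps_inv _ _ H (Rabs (Im l))) as [N HN]. { now apply Rabs_pos_lt. }
    exists N. intros n Hn. right. specialize (HN n Hn).
    assert (K := im_le_Cmod (u n - l)). creim. intros E. rewrite E in K.
    rewrite Rminus_0_l, Rabs_Ropp in K. lra.
Qed.

Lemma Clim_Clog (u : nat -> C) (l : C) : slit l -> Clim u l -> Clim (fun n => Clog (u n)) (Clog l).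
Proof.
  intros Hl H. destruct (Clim_slit u l Hl H) as [N HN].
  apply Clim_ext_loc with (fun n => slog (u n)) N. { intros n Hn. symmetry. apply Clog_slog; auto. }
  rewrite Clog_slog by auto.
  assert (H1 := Clim_Re _ _ H). assert (H2 := Clim_Im _ _ H). assert (H3 := Clim_Cmod _ _ H).
  apply Clim_of_Re_Im; unfold slog; creim.
  - apply is_lim_seq_continuous; auto. apply derivable_continuous_pt.
    exists (/ Cmod l)%R. apply derivable_pt_lim_ln. apply Cmod_pos. now apply slit_neq_0.
  - apply is_lim_seq_mult'. apply is_lim_seq_const. apply is_lim_seq_continuous.
    + apply derivable_continuous_pt. eexists. apply derivable_pt_lim_atan.
    + apply is_lim_seq_div'; auto. apply is_lim_seq_plus'; auto.
      assert (K := slit_Cmod_Re l Hl). lra.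
Qed.

(** * Estimates along segments *)

(** The remainder along the segment has derivative [- t w ^ 2 / ((c + t w) c)], so one lower bound
    [m] on the whole segment is enough. *)
Lemma Clog_taylor (c w : C) (m : R) : (0 < m)%R ->
  (forall t, (0 <= t <= 1)%R -> slit (c + t * w) /\ (m <= Cmod (c + t * w))%R) ->
  (Cmod (Clog (c + w) - Clog c - w / c) <= Cmod w * Cmod w / (m * m))%R.
Proof.
  intros Hm H.
  assert (Hc : slit c /\ (m <= Cmod c)%R).
  { replace c with (c + RtoC 0 * w) by ring. apply H. lra. }
  destruct Hc as [Hc1 Hc2]. assert (Hc0 := slit_neq_0 c Hc1).
  assert (K := mean_value (fun t => Clog (c + t * w) - t * (w / c))
     (fun t => w / (c + t * w) - w / c) 0 1 (Cmod w * Cmod w / (m * m))).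
  cbv beta in K. 
  replace (c + 1 * w) with (c + w) in K by ring.
  replace (c + 0 * w) with c in K by ring. rewrite Rminus_0_r, Rmult_1_r in K.
  replace (Clog (c + w) - 1 * (w / c) - (Clog c - 0 * (w / c))) with
    (Clog (c + w) - Clog c - w / c) in K by ring. apply K. lra.
  - intros t Ht. destruct (H t Ht) as [H1 H2]. apply Dc_minus.
    + apply Dc_Clog; auto.
      eapply Dc_eq. apply Dc_plus. apply Dc_const. apply Dc_mult. apply Dc_id. apply Dc_const.
      cbv beta. ring.
    + eapply Dc_eq. apply Dc_mult. apply Dc_id. apply Dc_const. cbv beta. ring.
  - intros t Ht. destruct (H t Ht) as [H1 H2]. assert (H3 := slit_neq_0 _ H1).
    replace (w / (c + t * w) - w / c) with (- (t * w * w) / ((c + t * w) * c)) by (field; auto).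
    rewrite Cmod_div by (now apply Cmult_neq_0). rewrite Cmod_opp, !Cmod_mult, Cmod_R.
    rewrite Rabs_pos_eq by lra.
    assert (A := Cmod_ge_0 w).
    unfold Rdiv. apply Rmult_le_compat.
    + apply Rmult_le_pos; auto. apply Rmult_le_pos; lra.
    + left. apply Rinv_0_lt_compat. nra.
    + nra.
    + apply Rinv_le_contravar; nra.
Qed.

Lemma Cexp_opp_diff_le (u : C) : (0 <= Re u)%R -> (Cmod (1 - Cexp (- u)) <= Cmod u)%R.
Proof.
  intros Hu.
  assert (K := mean_value (fun t => Cexp (t * (- u))) (fun t => - u * Cexp (t * - u)) 0 1 (Cmod u)).
  cbv beta in K. replace (1 * - u) with (- u) in K by ring.
  replace (0 * - u) with (RtoC 0) in K by ring. rewrite Rminus_0_r, Rmult_1_r, Cexp_0 in K.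
  rewrite Cmod_minus_sym. apply K. lra.
  - intros t Ht. apply Dc_Cexp. eapply Dc_eq. apply Dc_mult. apply Dc_id. apply Dc_const.
    cbv beta. ring.
  - intros t Ht. rewrite Cmod_mult, Cmod_opp, Cmod_Cexp. creim.
    assert (exp (t * - Re u - 0 * - Im u) <= 1)%R.
    { rewrite <- exp_0. apply exp_le_compat. nra. }
    assert (A := Cmod_ge_0 u). nra.
Qed.

(** The derivative of the remainder along [t u] is [u (1 - exp (- t u))], bounded by the preceding
    estimate. The bounds of higher order repeat this step; their constants are not optimal. *)
Lemma Cexp_opp_taylor (u : C) : (0 <= Re u)%R -> (Cmod (1 - Cexp (- u) - u) <= Cmod u * Cmod u)%R.
Proof.
  intros Hu.
  assert (K := mean_value (fun t => Cexp (t * (- u)) + t * u) (fun t => - u * Cexp (t * - u) + u) 0 1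
    (Cmod u * Cmod u)).
  cbv beta in K. replace (1 * - u) with (- u) in K by ring.
  replace (0 * - u) with (RtoC 0) in K by ring. rewrite Rminus_0_r, Rmult_1_r, Cexp_0 in K.
  rewrite <- Cmod_opp. replace (- (1 - Cexp (- u) - u)) with (Cexp (- u) + 1 * u - (1 + 0 * u)) by ring.
  apply K. lra.
  - intros t Ht. apply Dc_plus. apply Dc_Cexp. eapply Dc_eq. apply Dc_mult. apply Dc_id. apply Dc_const.
    cbv beta. ring. eapply Dc_eq. apply Dc_mult. apply Dc_id. apply Dc_const. cbv beta. ring.
  - intros t Ht. replace (- u * Cexp (t * - u) + u) with (u * (1 - Cexp (- (t * u)))).
    2: { replace (t * - u) with (- (t * u)) by ring. ring. }
    rewrite Cmod_mult. apply Rmult_le_compat_l. apply Cmod_ge_0.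
    eapply Rle_trans. apply Cexp_opp_diff_le. creim. nra.
    rewrite Cmod_mult, Cmod_R, Rabs_pos_eq by lra. assert (A := Cmod_ge_0 u). nra.
Qed.

(** From [sin s >= s - s ^ 3 / 6], where [s ^ 2 / 6 <= 2 / 3] on this range. *)
Lemma sin_lower (s : R) : (0 <= s <= 2)%R -> (s / 3 <= sin s)%R.
Proof.
  intros Hs. assert (Hpi := PI_4). assert (P2 := PI2_3_2).
  destruct (sin_bound s 0) as [H _]. lra. unfold PI2 in *. lra.
  unfold sin_approx, sin_term in H. simpl in H. field_simplify in H. nra.
Qed.

(** With [u = a + i b], [|1 - exp (- u)| ^ 2 = (1 - exp (- a)) ^ 2 + 4 exp (- a) sin (b / 2) ^ 2].
    The rectangle contains 0 but stays away from the zeros at [2 pi i] and [- 2 pi i]; its height 4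
    exceeds [pi], which leaves room for a bounded shift of the angles met at roots of unity. *)
Lemma Cexp_opp_diff_ge (u : C) : (0 <= Re u <= 1)%R -> (-4 <= Im u <= 4)%R ->
  (Cmod u / 6 <= Cmod (1 - Cexp (- u)))%R.
Proof.
  intros Ha Hb. set (a := Re u) in *. set (b := Im u) in *.
  assert (E : (Cmod (1 - Cexp (- u)) * Cmod (1 - Cexp (- u)) =
     (1 - exp (- a)) * (1 - exp (- a)) + 4 * exp (- a) * (sin (b / 2) * sin (b / 2)))%R).
  { rewrite Cmod_sqr. unfold Cexp. creim. fold a b. rewrite cos_neg, sin_neg.
    assert (Hc : cos b = (1 - 2 * (sin (b / 2) * sin (b / 2)))%R).
    { replace b with (2 * (b / 2))%R at 1 by field. rewrite cos_2a_sin. ring. }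
    assert (Hsc := sin2_cos2 b). unfold Rsqr in Hsc.
    replace (sin (b / 2) * sin (b / 2))%R with ((1 - cos b) / 2)%R by lra.
    nra. }
  assert (He : (/ 3 <= exp (- a))%R).
  { rewrite exp_Ropp. apply Rinv_le_contravar. apply exp_pos.
    apply Rle_trans with (exp 1). apply exp_le_compat; lra. apply exp_le_3. }
  assert (H1 : (a / 3 <= 1 - exp (- a))%R).
  { assert (K := exp_ineq1_le a). 
    assert (exp a * exp (- a) = 1)%R by (rewrite <- exp_plus, Rplus_opp_r, exp_0; auto).
    assert (0 < exp a)%R by apply exp_pos. nra. }
  assert (H2 : (b * b / 36 <= sin (b / 2) * sin (b / 2))%R).
  { destruct (Rle_dec 0 b).
    - assert (K := sin_lower (b / 2)). assert (b / 2 / 3 <= sin (b / 2))%R by (apply K; lra). nra.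
    - assert (K := sin_lower (- (b / 2))). rewrite sin_neg in K.
      assert (- (b / 2) / 3 <= - sin (b / 2))%R by (apply K; lra). nra. }
  assert (Em := Cmod_sqr u). fold a b in Em.
  assert (A := Cmod_ge_0 u). assert (B := Cmod_ge_0 (1 - Cexp (- u))).
  apply Rsqr_incr_0_var; auto. unfold Rsqr. rewrite E.
  replace (Cmod u / 6 * (Cmod u / 6))%R with ((a * a + b * b) / 36)%R by (rewrite <- Em; field).
  nra.
Qed.

(** * The functions (alpha + beta log w) / w and their primitives *)

(** [el1] and [el2] are the first and second derivatives, and [eA] is the primitive that vanishes at
    1. Two parameters make the family stable under scaling of [w]: [log y] moves into [al]. *)
Definition el (al be : C) (w : C) : C := (al + be * Clog w) / w.
Definition el1 (al be : C) (w : C) : C := (be - al - be * Clog w) / (w * w).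
Definition el2 (al be : C) (w : C) : C := (2 * al - 3 * be + 2 * be * Clog w) / (w * w * w).
Definition eA (al be : C) (w : C) : C := al * Clog w + be / 2 * (Clog w * Clog w).

Lemma Dc_eA (al be : C) (f : R -> C) (t : R) (l : C) : slit (f t) -> Dc f t l ->
  Dc (fun u => eA al be (f u)) t (l * el al be (f t)).
Proof.
  intros Hs Hf. assert (H0 := slit_neq_0 _ Hs). assert (HL := Dc_Clog f t l Hs Hf).
  eapply Dc_eq. unfold eA. apply Dc_plus. apply Dc_scal, HL. apply Dc_scal. apply Dc_mult; apply HL.
  unfold el. field. auto.
Qed.

Lemma Dc_el (al be : C) (f : R -> C) (t : R) (l : C) : slit (f t) -> Dc f t l ->
  Dc (fun u => el al be (f u)) t (l * el1 al be (f t)).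
Proof.
  intros Hs Hf. assert (H0 := slit_neq_0 _ Hs). assert (HL := Dc_Clog f t l Hs Hf).
  eapply Dc_eq. unfold el. apply Dc_div; auto. apply Dc_plus. apply Dc_const. apply Dc_scal, HL.
  exact Hf. unfold el1. field. auto.
Qed.

Lemma Dc_el1 (al be : C) (f : R -> C) (t : R) (l : C) : slit (f t) -> Dc f t l ->
  Dc (fun u => el1 al be (f u)) t (l * el2 al be (f t)).
Proof.
  intros Hs Hf. assert (H0 := slit_neq_0 _ Hs). assert (HL := Dc_Clog f t l Hs Hf).
  eapply Dc_eq. unfold el1. apply Dc_div. now apply Cmult_neq_0.
  apply Dc_minus. apply Dc_const. apply Dc_scal, HL. apply Dc_mult; exact Hf.
  unfold el2. field. auto.
Qed.

(** [ln x = 2 ln (sqrt x) <= 2 sqrt x], and the bounded part is absorbed because [sqrt x] is bounded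
    below. Giving up half a power for the logarithm leaves pure powers as majorants everywhere
    below. *)
Lemma Clog_bound (k : R) : (0 < k)%R -> exists B, (0 <= B)%R /\
  forall w, slit w -> (k <= Cmod w)%R -> (Cmod (Clog w) <= B * Rpower (Cmod w) (1 / 2))%R.
Proof.
  intros Hk. set (q := Rpower k (1 / 2)). assert (Hq : (0 < q)%R) by apply Rpower_pos.
  exists (2 + (Rabs (ln k) + PI) / q)%R. assert (HP := PI_RGT_0). assert (HA := Rabs_pos (ln k)).
  assert (Hd : (0 <= (Rabs (ln k) + PI) / q)%R) by (apply Rdiv_le_0_compat; lra).
  split. lra. intros w Hw Hkw. set (x := Cmod w) in *. set (r := Rpower x (1 / 2)).
  assert (Hr : (q <= r)%R). { apply Rle_Rpower_l; lra. }
  assert (Hl : (ln x <= 2 * r)%R).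
  { assert (K := ln_le_minus_1 r). assert (E : ln r = (1 / 2 * ln x)%R) by (unfold r, Rpower; apply ln_exp).
    assert (ln r <= r - 1)%R by (apply K; unfold r; apply Rpower_pos). lra. }
  assert (Hl2 : (ln k <= ln x)%R). { apply ln_le; auto. }
  assert (Hi := Clog_Im w Hw).
  eapply Rle_trans. apply Cmod_le_Re_Im. rewrite Clog_Re. fold x.
  assert (A1 : (Rabs (ln x) <= 2 * r + Rabs (ln k))%R).
  { unfold Rabs. destruct (Rcase_abs (ln x)), (Rcase_abs (ln k)); lra. }
  assert (A2 : (Rabs (Im (Clog w)) <= PI)%R). { apply Rabs_le. lra. }
  assert (A3 : (Rabs (ln k) + PI <= (Rabs (ln k) + PI) / q * r)%R).
  { unfold Rdiv. rewrite Rmult_assoc. rewrite <- (Rmult_1_r (Rabs (ln k) + PI)) at 1.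
    apply Rmult_le_compat_l. lra. apply Rmult_le_reg_l with q; auto.
    rewrite <- Rmult_assoc, Rinv_r; lra. }
  lra.
Qed.

Lemma log_affine_bound (k : R) (a b : C) : (0 < k)%R -> exists B, (0 <= B)%R /\
  forall w, slit w -> (k <= Cmod w)%R -> (Cmod (a + b * Clog w) <= B * Rpower (Cmod w) (1 / 2))%R.
Proof.
  intros Hk. destruct (Clog_bound k Hk) as [B [HB H]].
  set (q := Rpower k (1 / 2)). assert (Hq : (0 < q)%R) by apply Rpower_pos.
  assert (Ha := Cmod_ge_0 a). assert (Hb := Cmod_ge_0 b).
  assert (Hd : (0 <= Cmod a / q)%R) by (apply Rdiv_le_0_compat; lra).
  exists (Cmod a / q + Cmod b * B)%R. split. { assert (0 <= Cmod b * B)%R by now apply Rmult_le_pos. lra. }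
  intros w Hw Hkw. specialize (H w Hw Hkw). set (r := Rpower (Cmod w) (1 / 2)) in *.
  assert (Hr : (q <= r)%R). { apply Rle_Rpower_l; lra. }
  eapply Rle_trans. apply Cmod_triangle. rewrite Cmod_mult.
  assert (A3 : (Cmod a <= Cmod a / q * r)%R).
  { unfold Rdiv. rewrite Rmult_assoc. rewrite <- (Rmult_1_r (Cmod a)) at 1.
    apply Rmult_le_compat_l. lra. apply Rmult_le_reg_l with q; auto.
    rewrite <- Rmult_assoc, Rinv_r; lra. }
  assert (Cmod b * Cmod (Clog w) <= Cmod b * (B * r))%R by (apply Rmult_le_compat_l; auto). lra.
Qed.

Lemma el_bound (k : R) (al be : C) : (0 < k)%R -> exists B, (0 <= B)%R /\
  forall w, slit w -> (k <= Cmod w)%R -> (Cmod (el al be w) <= B * Rpower (Cmod w) (- (1 / 2)))%R.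
Proof.
  intros Hk. destruct (log_affine_bound k al be Hk) as [B [HB H]].
  exists B. split; auto. intros w Hw Hkw. specialize (H w Hw Hkw). unfold el.
  rewrite Cmod_div by (now apply slit_neq_0).
  replace (- (1 / 2))%R with (1 / 2 + - (1))%R by field.
  rewrite (Rpower_plus (1 / 2)), Rpower_Ropp, Rpower_1 by lra.
  unfold Rdiv. rewrite <- Rmult_assoc. apply Rmult_le_compat_r; auto.
  left. apply Rinv_0_lt_compat. lra.
Qed.

Lemma el1_bound (k : R) (al be : C) : (0 < k)%R -> exists B, (0 <= B)%R /\
  forall w, slit w -> (k <= Cmod w)%R -> (Cmod (el1 al be w) <= B * Rpower (Cmod w) (- (3 / 2)))%R.
Proof.
  intros Hk. destruct (log_affine_bound k (be - al) (- be) Hk) as [B [HB H]].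
  exists B. split; auto. intros w Hw Hkw. specialize (H w Hw Hkw).
  assert (H0 := slit_neq_0 _ Hw). unfold el1.
  rewrite Cmod_div by (now apply Cmult_neq_0).
  replace (be - al - be * Clog w) with (be - al + - be * Clog w) by ring. rewrite !Cmod_mult.
  replace (- (3 / 2))%R with (1 / 2 + - (1 + 1))%R by field.
  rewrite (Rpower_plus (1/2)), Rpower_Ropp, Rpower_plus, Rpower_1 by lra.
  unfold Rdiv. rewrite <- Rmult_assoc. apply Rmult_le_compat_r; auto.
  left. apply Rinv_0_lt_compat. nra.
Qed.

Lemma el2_bound (k : R) (al be : C) : (0 < k)%R -> exists B, (0 <= B)%R /\
  forall w, slit w -> (k <= Cmod w)%R -> (Cmod (el2 al be w) <= B * Rpower (Cmod w) (- (5 / 2)))%R.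
Proof.
  intros Hk. destruct (log_affine_bound k (2 * al - 3 * be) (2 * be) Hk) as [B [HB H]].
  exists B. split; auto. intros w Hw Hkw. specialize (H w Hw Hkw).
  assert (H0 := slit_neq_0 _ Hw). unfold el2.
  rewrite Cmod_div by (repeat apply Cmult_neq_0; auto). rewrite !Cmod_mult.
  replace (- (5 / 2))%R with (1 / 2 + - (1 + 1 + 1))%R by field.
  rewrite (Rpower_plus (1/2)), Rpower_Ropp, !Rpower_plus, Rpower_1 by lra.
  unfold Rdiv. rewrite <- Rmult_assoc. apply Rmult_le_compat_r; auto.
  left. apply Rinv_0_lt_compat. repeat apply Rmult_lt_0_compat; lra.
Qed.

(* The defect of the trapezoidal rule on [[w, w + 1]]. *)
Definition tau (al be : C) (w : C) : C :=
  eA al be (w + 1) - eA al be w - 1 / 2 * (el al be w + el al be (w + 1)).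

Lemma tau_bound (al be w : C) (M : R) :
  (forall u, (0 <= u <= 1)%R -> slit (w + u) /\ (Cmod (el2 al be (w + u)) <= M)%R) ->
  (Cmod (tau al be w) <= M)%R.
Proof.
  intros H.
  assert (HM : (0 <= M)%R).
  { destruct (H 0%R) as [_ H1]. lra. eapply Rle_trans. 2: exact H1. apply Cmod_ge_0. }
  assert (HD : forall u : R, Dc (fun u => w + RtoC u) u 1).
  { intros u. eapply Dc_eq. apply Dc_plus. apply Dc_const. apply Dc_id. ring. }
  (* The derivative in [u] of the defect on [[w, w + u]]. It vanishes at 0 and its own derivative is
     [- (u / 2) l'' (w + u)]. *)
  set (e1 := fun u : R => 1 / 2 * (el al be (w + u) - el al be w) - RtoC u / 2 * el1 al be (w + u)).
  assert (H1 : forall u, (0 <= u <= 1)%R -> (Cmod (e1 u) <= M)%R).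
  { intros u Hu.
    assert (K := mean_value e1 (fun v => - (RtoC v / 2) * el2 al be (w + v)) 0 u M).
    assert (E0 : e1 0%R = 0). { unfold e1. replace (w + 0) with w by ring. unfold Cdiv. ring. }
    rewrite E0 in K. replace (e1 u - 0) with (e1 u) in K by ring.
    eapply Rle_trans. apply K. lra.
    - intros v Hv. destruct (H v) as [Hs _]. lra. unfold e1. eapply Dc_eq.
      apply Dc_minus. apply Dc_scal. apply Dc_minus. apply Dc_el; eauto. apply Dc_const.
      apply Dc_mult. unfold Cdiv. apply Dc_mult. apply Dc_id. apply Dc_const. apply Dc_el1; eauto.
      cbv beta. field. 
    - intros v Hv. destruct (H v) as [_ Hb]. lra. rewrite Cmod_mult, Cmod_opp.
      unfold Cdiv. rewrite Cmod_mult, <- RtoC_inv, !Cmod_R by lra. rewrite !Rabs_pos_eq by lra.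
      assert (A := Cmod_ge_0 (el2 al be (w + v))). nra.
    - nra. }
  assert (K := mean_value (fun u => eA al be (w + u) - eA al be w - RtoC u / 2 * (el al be w + el al be (w + u)))
     e1 0 1 M). cbv beta in K.
  replace (w + 0) with w in K by ring. rewrite Rminus_0_r, Rmult_1_r in K.
  match type of K with _ -> _ -> _ -> (Cmod ?x <= _)%R => replace x with (tau al be w) in K end.
  2: { unfold tau, Cdiv. ring. }
  apply K; auto. lra.
  intros v Hv. destruct (H v) as [Hs _]. lra. unfold e1. eapply Dc_eq.
  apply Dc_minus. apply Dc_minus. apply Dc_eA; eauto. apply Dc_const.
  apply Dc_mult. unfold Cdiv. apply Dc_mult. apply Dc_id. apply Dc_const.
  apply Dc_plus. apply Dc_const. apply Dc_el; eauto. cbv beta. field.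
Qed.

(** [1] and [z] are independent over the reals. With [v] the modulus on the right, the imaginary
    part gives [t |Im z| <= v], and the triangle inequality [x <= v + t |z|]. *)
Lemma cone_bound (z : C) : Im z <> 0%R -> exists k, (0 < k)%R /\
  forall x t, (0 <= x)%R -> (0 <= t)%R -> (k * (x + t) <= Cmod (x + t * z))%R.
Proof.
  intros Hz. set (b := Rabs (Im z)). assert (Hb : (0 < b)%R) by now apply Rabs_pos_lt.
  set (m := Cmod z). assert (Hm : (0 <= m)%R) by apply Cmod_ge_0.
  assert (HC : (0 < 1 + (1 + m) / b)%R). { assert (0 < (1 + m) / b)%R by (apply Rdiv_lt_0_compat; lra). lra. }
  exists (/ (1 + (1 + m) / b))%R. split. now apply Rinv_0_lt_compat.
  intros x t Hx Ht. apply Rmult_le_reg_l with (1 + (1 + m) / b)%R; auto.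
  rewrite <- Rmult_assoc, Rinv_r, Rmult_1_l by lra.
  set (v := Cmod (x + t * z)).
  assert (A1 : (t * b <= v)%R).
  { replace (t * b)%R with (Rabs (Im (x + t * z))). apply im_le_Cmod.
    creim. rewrite Rplus_0_l, Rmult_0_l, Rplus_0_r, Rabs_mult, (Rabs_pos_eq t); auto. }
  assert (A2 : (x <= v + t * m)%R).
  { assert (K := Cmod_triangle_rev (RtoC x) (- (t * z))).
    replace (RtoC x - - (t * z)) with (x + t * z) in K by ring.
    rewrite Cmod_opp, Cmod_mult, !Cmod_R, !Rabs_pos_eq in K by auto. fold v m in K. lra. }
  assert (A3 : (t <= v / b)%R). { apply Rmult_le_reg_r with b; auto. unfold Rdiv. rewrite Rmult_assoc, Rinv_l; lra. }
  unfold Rdiv in *. rewrite Rmult_plus_distr_r, Rmult_1_l.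
  replace ((1 + m) * / b * v)%R with ((1 + m) * (v * / b))%R by ring. nra.
Qed.

(** * Termwise integration *)

(* The difference of the two partial sums has a derivative bounded by the tails
   of the majorants, so its increments vanish in the limit. *)
Lemma series_integration (F f G g : nat -> R -> C) (s : R -> C) (b c : nat -> R) :
  summable b -> summable c ->
  (forall k t, (0 <= t <= 1)%R -> Dc (F k) t (f k t) /\ (Cmod (f k t) <= b k)%R) ->
  (forall k t, (0 <= t <= 1)%R -> Dc (G k) t (g k t) /\ (Cmod (g k t) <= c k)%R) ->
  (forall t, (0 <= t <= 1)%R -> cser (fun k => f k t) (s t) /\ cser (fun k => g k t) (s t)) ->
  exists X, cser (fun k => F k 1%R - F k 0%R) X /\ cser (fun k => G k 1%R - G k 0%R) X.
Proof.
  intros Hb Hc HF HG Hs.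
  assert (HFd : forall k, (Cmod (F k 1%R - F k 0%R) <= b k)%R).
  { intros k. replace (b k) with (b k * (1 - 0))%R by ring. apply mean_value with (f k); try lra.
    intros; now apply HF. intros; now apply HF. }
  destruct (cser_abs _ b HFd Hb) as [X HX]. exists X. split; auto.
  destruct (summable_tail b Hb) as [tb [Htb [_ Hb1]]].
  destruct (summable_tail c Hc) as [tc [Htc [_ Hc1]]].
  assert (HD : Clim (fun n => csum (fun k => F k 1%R - F k 0%R) n - csum (fun k => G k 1%R - G k 0%R) n) 0).
  { apply Clim_squeeze with (fun n => tb n + tc n)%R O. 2: now apply is_lim_seq_0_plus.
    intros n _. rewrite !csum_minus.
    assert (K := mean_value (fun u => csum (fun k => F k u) n - csum (fun k => G k u) n)
      (fun u => csum (fun k => f k u) n - csum (fun k => g k u) n) 0 1 (tb n + tc n)).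
    cbv beta in K. rewrite Rminus_0_r, Rmult_1_r in K.
    match type of K with _ -> _ -> _ -> (Cmod ?x <= _)%R => match goal with |- (Cmod ?y <= _)%R =>
      replace y with x by ring end end.
    apply K. lra.
    - intros t Ht. apply Dc_minus.
      + assert (HH : forall m, Dc (fun u => csum (fun k => F k u) m) t (csum (fun k => f k t) m)).
        { induction m; simpl. apply Dc_const. apply Dc_plus; auto. now apply HF. } apply HH.
      + assert (HH : forall m, Dc (fun u => csum (fun k => G k u) m) t (csum (fun k => g k t) m)).
        { induction m; simpl. apply Dc_const. apply Dc_plus; auto. now apply HG. } apply HH.
    - intros t Ht. destruct (Hs t Ht) as [H1 H2].
      replace (csum (fun k => f k t) n - csum (fun k => g k t) n) with
        ((s t - csum (fun k => g k t) n) - (s t - csum (fun k => f k t) n)) by ring.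
      eapply Rle_trans. apply Cmod_triangle_minus. rewrite Rplus_comm. apply Rplus_le_compat.
      + apply cser_tail_le with b; auto. intros; now apply HF.
      + apply cser_tail_le with c; auto. intros; now apply HG. }
  apply Clim_ext with (fun n => csum (fun k => F k 1%R - F k 0%R) n -
    (csum (fun k => F k 1%R - F k 0%R) n - csum (fun k => G k 1%R - G k 0%R) n)).
  intros; ring. replace X with (X - 0) by ring. now apply Clim_minus.
Qed.

Lemma cser_zero : cser (fun _ => 0) 0.
Proof.
  apply Clim_ext with (fun _ => 0). induction n; simpl; auto. rewrite <- IHn. ring. apply Clim_const.
Qed.

Lemma cser_single (l : C) : cser (fun k => match k with O => l | S _ => 0 end) l.
Proof.
  apply cser_first. replace (l - l) with (RtoC 0) by ring. apply cser_zero.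
Qed.

Lemma summable_single (l : R) : (0 <= l)%R -> summable (fun k => match k with O => l | S _ => 0 end)%R.
Proof.
  intros H. split. intros [|n]; lra. exists l. destruct n; simpl. lra.
  induction n; simpl in *; lra.
Qed.

(** Termwise integration against a known sum: the second series of [series_integration] is taken
    with [S] as its only nonzero term. *)
Lemma primitive_series (F f : nat -> R -> C) (S s : R -> C) (b : nat -> R) (M : R) :
  summable b ->
  (forall k t, (0 <= t <= 1)%R -> Dc (F k) t (f k t) /\ (Cmod (f k t) <= b k)%R) ->
  (forall t, (0 <= t <= 1)%R -> cser (fun k => f k t) (s t)) ->
  (forall t, (0 <= t <= 1)%R -> Dc S t (s t)) ->
  (forall t, (0 <= t <= 1)%R -> (Cmod (s t) <= M)%R) ->
  cser (fun k => F k 1%R - F k 0%R) (S 1%R - S 0%R).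
Proof.
  intros Hb HF Hf HS HM.
  assert (H0 : (0 <= M)%R). { eapply Rle_trans. apply Cmod_ge_0. apply (HM 0%R). lra. }
  destruct (series_integration F f (fun k t => match k with O => S t | _ => 0 end)
     (fun k t => match k with O => s t | _ => 0 end) s b
     (fun k => match k with O => M | _ => 0 end)%R) as [X [H1 H2]]; auto.
  - now apply summable_single.
  - intros [|k] t Ht. split; auto. split. apply Dc_const. rewrite Cmod_0; lra.
  - intros t Ht. split; auto. apply cser_single.
  - replace (S 1%R - S 0%R) with X; auto.
    apply cser_unique with (1 := H2). 
    apply cser_ext with (2 := cser_single (S 1%R - S 0%R)). intros [|n]; ring.
Qed.

(** * Power series *)

(** The cube of [y <= exp y] at [y = s (n + 1) / 3], whence [27 = 3 ^ 3]. *)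
Lemma cube_exp_bound (s : R) (n : nat) : (0 < s)%R ->
  ((INR n + 1) * ((INR n + 1) * (INR n + 1)) * exp (- s * INR n) <= exp s * (27 / (s * s * s)))%R.
Proof.
  intros Hs. set (x := (INR n + 1)%R). assert (Hx : (0 < x)%R) by (unfold x; assert (K := INR_ge_0 n); lra).
  replace (- s * INR n)%R with (s + - (s * x))%R by (unfold x; ring). rewrite exp_plus.
  set (y := (s * x / 3)%R). assert (Hy : (0 < y)%R) by (unfold y; apply Rdiv_lt_0_compat; nra).
  assert (E : (exp (- (s * x)) * (exp y * exp y * exp y) = 1)%R).
  { rewrite <- !exp_plus. rewrite <- exp_0. f_equal. unfold y. field. }
  assert (K := exp_ineq1_le y).
  assert (Hc : (y * y * y <= exp y * exp y * exp y)%R).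
  { assert (y * y <= exp y * exp y)%R by nra. apply Rmult_le_compat; nra. }
  assert (Hp := exp_pos (- (s * x))).
  assert (H1 : (exp (- (s * x)) * (y * y * y) <= 1)%R). { rewrite <- E. apply Rmult_le_compat_l; lra. }
  assert (H2 : (x * (x * x) = 27 / (s * s * s) * (y * y * y))%R) by (unfold y; field; lra).
  rewrite H2. assert (0 < exp s)%R by apply exp_pos.
  assert (0 < 27 / (s * s * s))%R. { apply Rdiv_lt_0_compat. lra. repeat apply Rmult_lt_0_compat; auto. }
  replace (27 / (s * s * s) * (y * y * y) * (exp s * exp (- (s * x))))%R with
    (exp s * (27 / (s * s * s)) * (exp (- (s * x)) * (y * y * y)))%R by ring.
  rewrite <- (Rmult_1_r (exp s * _)) at 2. apply Rmult_le_compat_l; nra.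
Qed.

Lemma pw_2 (n : nat) : pw 2 n = (/ ((INR n + 1) * (INR n + 1)))%R.
Proof.
  assert (K := INR_ge_0 n). unfold pw. rewrite Rpower_Ropp. f_equal.
  replace 2%R with (1 + 1)%R by ring. rewrite Rpower_plus, Rpower_1; lra.
Qed.

(** Of the three factors [n + 1] controlled above, one is kept as a weight for coefficients of
    linear growth, such as bounds on harmonic numbers; the other two give convergence. *)
Lemma exp_majorant (s : R) : (0 < s)%R -> exists B, (0 <= B)%R /\
  forall n, ((INR n + 1) * exp (- s * INR n) <= B * pw 2 n)%R.
Proof.
  intros Hs. exists (exp s * (27 / (s * s * s)))%R. split.
  - left. apply Rmult_lt_0_compat. apply exp_pos. apply Rdiv_lt_0_compat. lra.
    repeat apply Rmult_lt_0_compat; auto.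
  - intros n. assert (K := cube_exp_bound s n Hs). assert (Hn := INR_ge_0 n). rewrite pw_2.
    apply Rmult_le_reg_r with ((INR n + 1) * (INR n + 1))%R. nra.
    match goal with |- (_ <= ?r)%R => replace r with (exp s * (27 / (s * s * s)))%R by (field; lra) end.
    nra.
Qed.

Lemma geom_majorant (r : R) : (0 <= r < 1)%R -> exists B, (0 <= B)%R /\
  forall n, ((INR n + 1) * r ^ n <= B * pw 2 n)%R.
Proof.
  intros Hr. set (r' := ((1 + r) / 2)%R). assert (Hr' : (r <= r' < 1 /\ 0 < r')%R) by (unfold r'; lra).
  destruct (exp_majorant (- ln r')) as [B [HB H]].
  { assert (ln r' < ln 1)%R by (apply ln_increasing; lra). rewrite ln_1 in H. lra. }
  exists B. split; auto. intros n. eapply Rle_trans. 2: apply H.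
  apply Rmult_le_compat_l. assert (K := INR_ge_0 n); lra.
  eapply Rle_trans. apply pow_incr. split. lra. apply Hr'.
  right. rewrite <- Rpower_pow by lra. unfold Rpower. f_equal. ring.
Qed.

Lemma summable_geom (r : R) : (0 <= r < 1)%R -> summable (fun n => (INR n + 1) * r ^ n)%R.
Proof.
  intros Hr. destruct (geom_majorant r Hr) as [B [HB H]].
  apply summable_le with (fun n => B * pw 2 n)%R.
  - intros n. split; auto. apply Rmult_le_pos. assert (K := INR_ge_0 n); lra. now apply pow_le.
  - apply summable_scal; auto. apply summable_pw. lra.
Qed.

Lemma summable_lim_0 (b : nat -> R) : summable b -> is_lim_seq b 0%R.
Proof.
  intros Hb. destruct (summable_tail b Hb) as [t [Ht [_ H]]].
  apply is_lim_seq_le_le with (fun _ => 0%R) t; auto using is_lim_seq_const.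
  intros n. split. apply Hb. specialize (H n (S n)). simpl in H.
  assert (rsum b n + b n - rsum b n <= t n)%R by (apply H; lia). lra.
Qed.

Lemma geom_sum (q : C) (n : nat) : (1 - q) * csum (fun j => q ^ j)%C n = 1 - (q ^ n)%C.
Proof. induction n; simpl. ring. rewrite Cmult_plus_distr_l, IHn. ring. Qed.

Lemma Clim_pow_0 (q : C) : (Cmod q < 1)%R -> Clim (fun n => q ^ n)%C 0.
Proof.
  intros H. apply Clim_squeeze with (fun n => (INR n + 1) * Cmod q ^ n)%R O.
  - intros n _. replace (q ^ n - 0)%C with (q ^ n)%C by ring. rewrite Cmod_pow.
    assert (0 <= Cmod q ^ n)%R by (apply pow_le, Cmod_ge_0). assert (K := INR_ge_0 n). nra.
  - apply summable_lim_0, summable_geom. split; auto. apply Cmod_ge_0.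
Qed.

Lemma one_minus_slit (q : C) : (Cmod q < 1)%R -> slit (1 - q).
Proof.
  intros H. left. creim. assert (K := re_le_Cmod q). apply Rabs_le_between in K. lra.
Qed.

Lemma cser_geom (q : C) : (Cmod q < 1)%R -> cser (fun j => q ^ j)%C (/ (1 - q)).
Proof.
  intros H. assert (H0 := slit_neq_0 _ (one_minus_slit q H)).
  apply Clim_ext with (fun n => / (1 - q) * (1 - q ^ n)%C).
  { intros n. rewrite <- geom_sum. field. auto. }
  replace (/ (1 - q)) with (/ (1 - q) * (1 - 0)) at 1 by ring.
  apply Clim_scal, Clim_minus. apply Clim_const. now apply Clim_pow_0.
Qed.

Lemma Dc_pow (n : nat) (t : R) : Dc (fun u => RtoC u ^ n)%C t (INR n * RtoC t ^ (n - 1))%C.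
Proof.
  induction n. simpl. eapply Dc_eq. apply Dc_const. ring.
  simpl Cpow. eapply Dc_eq. apply Dc_mult. apply Dc_id. apply IHn.
  rewrite S_INR, RtoC_plus. destruct n. simpl. ring. simpl Nat.sub. rewrite Nat.sub_0_r. simpl Cpow. ring.
Qed.

Lemma Cmod_pow_R_le (t : R) (q : C) (n : nat) : (0 <= t <= 1)%R ->
  (Cmod ((t * q) ^ n)%C <= Cmod q ^ n)%R.
Proof.
  intros Ht. rewrite Cmod_pow, Cmod_mult, Cmod_R, Rabs_pos_eq by lra.
  apply pow_incr. assert (K := Cmod_ge_0 q). split; nra.
Qed.

Lemma Cmod_R_mult_lt (t : R) (q : C) : (0 <= t <= 1)%R -> (Cmod q < 1)%R -> (Cmod (t * q) < 1)%R.
Proof.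
  intros Ht Hq. rewrite Cmod_mult, Cmod_R, Rabs_pos_eq by lra. assert (K := Cmod_ge_0 q). nra.
Qed.

Lemma one_minus_lower (t : R) (q : C) : (0 <= t <= 1)%R -> (1 - Cmod q <= Cmod (1 - t * q))%R.
Proof.
  intros Ht. eapply Rle_trans. 2: apply Cmod_triangle_rev.
  rewrite Cmod_1, Cmod_mult, Cmod_R, Rabs_pos_eq by lra. assert (K := Cmod_ge_0 q). nra.
Qed.

Lemma INR_S_neq_0 (n : nat) : RtoC (INR (S n)) <> 0.
Proof. intros E. apply RtoC_inj in E. now apply (not_0_INR (S n)). Qed.

Lemma Dc_monomial (q : C) (j : nat) (t : R) :
  Dc (fun t => RtoC t ^ (S j) * (q ^ (S j) / INR (S j)))%C t (q * (t * q) ^ j)%C.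
Proof.
  eapply Dc_eq. apply Dc_mult. apply Dc_pow. apply Dc_const.
  simpl Nat.sub. rewrite Nat.sub_0_r. rewrite Cpow_mult_l. simpl Cpow. field. apply INR_S_neq_0.
Qed.

(** Integration of the geometric series over the segment from 0 to [q], parametrised as [t q]. *)
Lemma cser_log (q : C) : (Cmod q < 1)%R -> cser (fun j => q ^ (S j) / INR (S j))%C (- Clog (1 - q)).
Proof.
  intros Hq.
  assert (K := primitive_series (fun j t => RtoC t ^ (S j) * (q ^ (S j) / INR (S j)))%C
    (fun j t => q * (t * q) ^ j)%C (fun t => - 1 * Clog (1 - t * q)) (fun t => q * / (1 - t * q))
    (fun j => (INR j + 1) * Cmod q ^ j)%R (1 / (1 - Cmod q))).
  cbv beta in K. assert (Hq0 := Cmod_ge_0 q).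
  replace (- Clog (1 - q)) with (-1 * Clog (1 - 1 * q) - -1 * Clog (1 - 0 * q)).
  2: { replace (1 - 0 * q) with (RtoC 1) by ring. rewrite Clog_R, ln_1 by lra.
       replace (1 * q) with q by ring. ring. }
  eapply cser_ext; [| apply K].
  - intros j. cbv beta. rewrite !Cpow_1_l. simpl. ring.
  - apply summable_geom. lra.
  - intros j t Ht. split. apply Dc_monomial.
    rewrite Cmod_mult. assert (A := Cmod_pow_R_le t q j Ht). assert (B := Cmod_ge_0 ((t * q) ^ j)).
    assert (Cn := INR_ge_0 j). assert (0 <= Cmod q ^ j)%R by (apply pow_le; lra). nra.
  - intros t Ht. apply cser_scal, cser_geom, Cmod_R_mult_lt; auto.
  - intros t Ht. assert (Hs : slit (1 - t * q)) by (apply one_minus_slit, Cmod_R_mult_lt; auto).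
    eapply Dc_eq. apply Dc_scal. apply Dc_Clog; auto. apply Dc_minus. apply Dc_const.
    apply Dc_mult. apply Dc_id. apply Dc_const. assert (H0 := slit_neq_0 _ Hs). cbv beta. field. auto.
  - intros t Ht. assert (Hs : slit (1 - t * q)) by (apply one_minus_slit, Cmod_R_mult_lt; auto).
    rewrite Cmod_mult, Cmod_inv by now apply slit_neq_0.
    apply Rmult_le_compat; auto. left. apply Rinv_0_lt_compat. apply Cmod_pos. now apply slit_neq_0. lra.
    apply Rinv_le_contravar. lra. now apply one_minus_lower.
Qed.

Definition harm (n : nat) : R := rsum (fun k => / INR (S k))%R n.

Lemma harm_S (n : nat) : harm (S n) = (harm n + / INR (S n))%R.
Proof. reflexivity. Qed.

Lemma harm_ge_0 (n : nat) : (0 <= harm n)%R.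
Proof.
  induction n. apply Rle_refl. rewrite harm_S.
  assert (0 < / INR (S n))%R by (apply Rinv_0_lt_compat, lt_0_INR; lia). lra.
Qed.

Lemma harm_le (n : nat) : (harm n <= INR n)%R.
Proof.
  induction n. apply Rle_refl. rewrite harm_S.
  assert (/ INR (S n) <= 1)%R. { apply Rle_trans with (/ 1)%R; [|lra]. apply Rinv_le_contravar. lra. rewrite S_INR.
    assert (K := INR_ge_0 n). lra. }
  rewrite S_INR in *. lra.
Qed.

Lemma harm_geom_bound (q : C) (n : nat) : (Cmod (harm n * q ^ n)%C <= (INR n + 1) * Cmod q ^ n)%R.
Proof.
  rewrite Cmod_mult, Cmod_R, Cmod_pow, Rabs_pos_eq by apply harm_ge_0.
  apply Rmult_le_compat_r. apply pow_le, Cmod_ge_0. assert (K := harm_le n). lra.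
Qed.

(** Summation by parts: [(1 - q)] times the partial sum is the partial sum of the logarithmic series
    minus [H_n q ^ n], and this last term tends to 0. *)
Lemma cser_harm (q : C) : (Cmod q < 1)%R ->
  cser (fun j => harm j * q ^ j)%C (- Clog (1 - q) / (1 - q)).
Proof.
  intros Hq. assert (H0 := slit_neq_0 _ (one_minus_slit q Hq)).
  assert (E : forall n, csum (fun j => harm j * q ^ j)%C n =
     / (1 - q) * (csum (fun j => q ^ (S j) / INR (S j))%C n - harm n * q ^ n)).
  { induction n. simpl. unfold harm; simpl. ring. rewrite !csum_S, IHn, harm_S, RtoC_plus, RtoC_inv.
    2: now apply not_0_INR. simpl Cpow. field. split; auto. apply INR_S_neq_0. }
  apply Clim_ext with (1 := fun n => eq_sym (E n)).
  replace (- Clog (1 - q) / (1 - q)) with (/ (1 - q) * (- Clog (1 - q) - 0)) by (field; auto).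
  apply Clim_scal, Clim_minus. now apply cser_log.
  apply Clim_squeeze with (fun n => (INR n + 1) * Cmod q ^ n)%R O.
  - intros n _. replace (harm n * q ^ n - 0)%C with (harm n * q ^ n)%C by ring. apply harm_geom_bound.
  - apply summable_lim_0, summable_geom. split; auto. apply Cmod_ge_0.
Qed.

(** The generating function of the harmonic numbers, integrated from 0 to [q]. It is the source of
    the squared logarithm in the behaviour of the exponential series near 0. *)
Lemma cser_half_log_sqr (q : C) : (Cmod q < 1)%R ->
  cser (fun j => harm j * (q ^ (S j) / INR (S j)))%C (1 / 2 * (Clog (1 - q) * Clog (1 - q))).
Proof.
  intros Hq.
  assert (Hm : forall t, (0 <= t <= 1)%R -> cser (fun j => q * (harm j * (t * q) ^ j))%C
      (q * (- Clog (1 - t * q) / (1 - t * q)))).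
  { intros t Ht. apply cser_scal, cser_harm, Cmod_R_mult_lt; auto. }
  assert (Hq0 := Cmod_ge_0 q).
  assert (Hg : summable (fun j => (INR j + 1) * Cmod q ^ j)%R) by (apply summable_geom; lra).
  assert (Hb : forall j t, (0 <= t <= 1)%R -> (Cmod (q * (harm j * (t * q) ^ j))%C <= (INR j + 1) * Cmod q ^ j)%R).
  { intros j t Ht. rewrite Cmod_mult. assert (A := harm_geom_bound (t * q) j).
    assert (B := Cmod_ge_0 (harm j * (t * q) ^ j)). 
    assert (Cn := INR_ge_0 j). assert (Cmod (t * q) ^ j <= Cmod q ^ j)%R.
    { rewrite <- !Cmod_pow, (Cmod_pow q). now apply Cmod_pow_R_le. }
    assert (0 <= Cmod (t * q) ^ j)%R by (apply pow_le, Cmod_ge_0). nra. }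
  destruct Hg as [Hg1 [B HB]].
  assert (K := primitive_series (fun j t => harm j * (RtoC t ^ (S j) * (q ^ (S j) / INR (S j))))%C
    (fun j t => q * (harm j * (t * q) ^ j))%C (fun t => 1 / 2 * (Clog (1 - t * q) * Clog (1 - t * q)))
    (fun t => q * (- Clog (1 - t * q) / (1 - t * q)))
    (fun j => (INR j + 1) * Cmod q ^ j)%R B).
  cbv beta in K.
  replace (1 / 2 * (Clog (1 - q) * Clog (1 - q))) with (1 / 2 * (Clog (1 - 1 * q) * Clog (1 - 1 * q)) -
     1 / 2 * (Clog (1 - 0 * q) * Clog (1 - 0 * q))).
  2: { replace (1 - 0 * q) with (RtoC 1) by ring. rewrite Clog_R, ln_1 by lra.
       replace (1 * q) with q by ring. ring. }
  eapply cser_ext; [| apply K].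
  - intros j. cbv beta. rewrite !Cpow_1_l. simpl. ring.
  - apply summable_geom. lra.
  - intros j t Ht. split; auto. eapply Dc_eq. apply Dc_scal. apply Dc_monomial. ring.
  - auto.
  - intros t Ht. assert (Hs : slit (1 - t * q)) by (apply one_minus_slit, Cmod_R_mult_lt; auto).
    assert (HL : Dc (fun u => Clog (1 - u * q)) t (- q / (1 - t * q))).
    { eapply Dc_eq. apply Dc_Clog; auto. apply Dc_minus. apply Dc_const.
      apply Dc_mult. apply Dc_id. apply Dc_const. assert (H0 := slit_neq_0 _ Hs). cbv beta. field. auto. }
    eapply Dc_eq. apply Dc_scal. apply Dc_mult; exact HL.
    assert (H0 := slit_neq_0 _ Hs). cbv beta. field. auto.
  (* The required bound on the derivative is the bound of the partial sums of the majorant, passed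
     to the limit. *)
  - intros t Ht. eapply Clim_le with (N := O). 2: apply Hm; auto. intros n _.
    eapply Rle_trans. 2: apply (HB n). apply csum_Cmod_le. intros; now apply Hb.
Qed.

(** * Euler's constant *)

Lemma sum_n_m_1_rsum (f : nat -> R) (n : nat) : sum_n_m f 1 n = rsum (fun k => f (S k)) n.
Proof.
  induction n. rewrite sum_n_m_zero by lia. reflexivity.
  rewrite sum_n_Sm by lia. rewrite IHn. reflexivity.
Qed.

Lemma ln_S_bounds (x : R) : (0 < x)%R -> (/ (x + 1) <= ln (x + 1) - ln x <= / x)%R.
Proof.
  intros Hx. rewrite <- ln_div by lra. split.
  - assert (K := ln_le_minus_1 (x / (x + 1))). rewrite !ln_div in * by lra.
    assert (x / (x + 1) = 1 - / (x + 1))%R by (field; lra).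
    assert (0 < x / (x + 1))%R by (apply Rdiv_lt_0_compat; lra). lra.
  - assert (K := ln_le_minus_1 ((x + 1) / x)).
    assert ((x + 1) / x = 1 + / x)%R by (field; lra).
    assert (0 < (x + 1) / x)%R by (apply Rdiv_lt_0_compat; lra). lra.
Qed.

Lemma ln_ge_0 (x : R) : (1 <= x)%R -> (0 <= ln x)%R.
Proof. intros H. rewrite <- ln_1. apply ln_le; lra. Qed.

Lemma INR_S_pos (n : nat) : (0 < INR (S n))%R.
Proof. apply lt_0_INR. lia. Qed.

(** Both monotonicities in one induction: [H_N - log N] decreases while [H_(N-1) - log N]
    increases. *)
Lemma harm_ln_anti (n : nat) (m : nat) :
  (harm (S n) - ln (INR (S n)) - / INR (S n) + / INR (S (n + m)) <=
   harm (S (n + m)) - ln (INR (S (n + m))) <= harm (S n) - ln (INR (S n)))%R.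
Proof.
  induction m.
  - rewrite Nat.add_0_r. lra.
  - rewrite Nat.add_succ_r, (harm_S (S (n + m))), (S_INR (S (n + m))).
    assert (K := ln_S_bounds (INR (S (n + m))) (INR_S_pos _)). lra.
Qed.

Lemma harm_ln_lim : is_lim_seq (fun n => harm n - ln (INR n))%R euler_gamma.
Proof.
  assert (H : ex_finite_lim_seq (fun n => harm (S n) - ln (INR (S n)))%R).
  { apply ex_finite_lim_seq_decr with (harm 1 - ln (INR 1) - / INR 1)%R.
    - intros n. assert (K := harm_ln_anti n 1). rewrite Nat.add_1_r in K. lra.
    - intros n. assert (K := harm_ln_anti 0 n). rewrite Nat.add_0_l in K.
      assert (0 < / INR (S n))%R by (apply Rinv_0_lt_compat, INR_S_pos). lra. }
  destruct H as [l Hl]. apply (is_lim_seq_incr_1 (fun n => harm n - ln (INR n))%R) in Hl.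
  replace euler_gamma with l; auto. unfold euler_gamma.
  rewrite (is_lim_seq_unique _ l); auto.
  eapply is_lim_seq_ext. 2: exact Hl. intros n. cbv beta. now rewrite sum_n_m_1_rsum.
Qed.

Lemma harm_ln_gamma (n : nat) :
  (0 <= harm (S n) - ln (INR (S n)) - euler_gamma <= / INR (S n))%R.
Proof.
  assert (Hl := harm_ln_lim).
  assert (Hl2 := proj1 (is_lim_seq_incr_n (fun k => harm k - ln (INR k))%R (S n) euler_gamma) Hl).
  assert (A : Rbar_le (harm (S n) - ln (INR (S n)) - / INR (S n))%R euler_gamma).
  { eapply is_lim_seq_le. 2: apply is_lim_seq_const. 2: exact Hl2. intros m. cbv beta.
    assert (K := harm_ln_anti n m). replace (m + S n)%nat with (S (n + m)) by lia.
    assert (0 < / INR (S (n + m)))%R by (apply Rinv_0_lt_compat, INR_S_pos). lra. }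
  assert (B : Rbar_le euler_gamma (harm (S n) - ln (INR (S n)))%R).
  { eapply is_lim_seq_le. 3: apply is_lim_seq_const. 2: exact Hl2. intros m. cbv beta.
    assert (K := harm_ln_anti n m). replace (m + S n)%nat with (S (n + m)) by lia. lra. }
  simpl in A, B. simpl INR in *. lra.
Qed.

(** * Sums over the multiples of a period *)

(* [csum (pairz a h) (S r)] is the sum of [h (k * a)] over [- r <= k <= r]. *)
Definition pairz (a : C) (h : C -> C) (k : nat) : C :=
  match k with O => h 0 | S _ => h (INR k * a) + h (- (INR k * a)) end.

Lemma pairz_ext (a : C) (h g : C -> C) (k : nat) : (forall o, h o = g o) -> pairz a h k = pairz a g k.
Proof. intros H. destruct k; simpl; now rewrite !H. Qed.

Lemma pairz_ext_at (a : C) (h g : C -> C) (k : nat) :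
  h (INR k * a) = g (INR k * a) -> h (- (INR k * a)) = g (- (INR k * a)) ->
  pairz a h k = pairz a g k.
Proof.
  intros H1 H2. destruct k; unfold pairz.
  - replace (RtoC 0) with (INR 0 * a) by (simpl; ring). exact H1.
  - now rewrite H1, H2.
Qed.

Lemma pairz_plus (a : C) (h g : C -> C) (k : nat) :
  pairz a (fun o => h o + g o) k = pairz a h k + pairz a g k.
Proof. destruct k; simpl; ring. Qed.

Lemma pairz_minus (a : C) (h g : C -> C) (k : nat) :
  pairz a (fun o => h o - g o) k = pairz a h k - pairz a g k.
Proof. destruct k; simpl; ring. Qed.

Lemma pairz_scal (a c : C) (h : C -> C) (k : nat) :
  pairz a (fun o => c * h o) k = c * pairz a h k.
Proof. destruct k; simpl; ring. Qed.

Lemma pairz_bound (a : C) (h : C -> C) (k : nat) (B : R) :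
  (Cmod (h (INR k * a)%C) <= B)%R -> (Cmod (h (- (INR k * a))%C) <= B)%R ->
  (Cmod (pairz a h k) <= 2 * B)%R.
Proof.
  intros H1 H2. assert (0 <= B)%R by (eapply Rle_trans; [apply Cmod_ge_0|exact H1]).
  destruct k; unfold pairz.
  - replace (RtoC 0) with (INR 0 * a) by (simpl; ring). lra.
  - eapply Rle_trans. apply Cmod_triangle. lra.
Qed.

Lemma pairz_lim (a : C) (h : nat -> C -> C) (g : C -> C) (k : nat) :
  Clim (fun j => h j (INR k * a)) (g (INR k * a)) ->
  Clim (fun j => h j (- (INR k * a))) (g (- (INR k * a))) ->
  Clim (fun j => pairz a (h j) k) (pairz a g k).
Proof.
  intros H1 H2. destruct k; unfold pairz.
  - replace (RtoC 0) with (INR 0 * a) by (simpl; ring). exact H1.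
  - now apply Clim_plus.
Qed.

(** * The roots of unity filter *)

Definition tpi : C := 2 * PI * Ci.

Lemma tpi_Re : Re tpi = 0%R. Proof. unfold tpi. creim. ring. Qed.
Lemma tpi_Im : Im tpi = (2 * PI)%R. Proof. unfold tpi. creim. ring. Qed.

Lemma Cexp_tpi_nat (n : nat) : Cexp (INR n * tpi) = 1.
Proof.
  unfold Cexp. creim. rewrite tpi_Re, tpi_Im. apply C_eq; creim.
  - replace (INR n * (2 * PI) + 0 * 0)%R with (0 + 2 * INR n * PI)%R by ring. rewrite cos_period, cos_0.
    replace (INR n * 0 - 0 * (2 * PI))%R with 0%R by ring. rewrite exp_0. ring.
  - replace (INR n * (2 * PI) + 0 * 0)%R with (0 + 2 * INR n * PI)%R by ring. rewrite sin_period, sin_0. ring.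
Qed.

(** The factor [exp th - 1] makes the sum of [exp (k th)] over [- r <= k <= r] telescope. *)
Lemma dirichlet_kernel (th : C) (r : nat) :
  (Cexp th - 1) * csum (pairz th Cexp) (S r) = Cexp (INR (S r) * th) - Cexp (- (INR r * th)).
Proof.
  induction r.
  - simpl. rewrite Cexp_0. replace (1 * th) with th by ring. replace (- (0 * th)) with (RtoC 0) by ring.
    rewrite Cexp_0. ring.
  - rewrite csum_S, Cmult_plus_distr_l, IHr. unfold pairz at 1.
    replace (INR (S (S r)) * th) with (INR (S r) * th + th) by (rewrite (S_INR (S r)), RtoC_plus; ring).
    replace (- (INR r * th)) with (- (INR (S r) * th) + th) by (rewrite S_INR, RtoC_plus; ring).
    rewrite !(Cexp_plus _ th). ring.
Qed.

Lemma pairz_comp_scal (a c : C) (h : C -> C) (k : nat) :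
  pairz a (fun o => h (c * o)) k = pairz (c * a) h k.
Proof.
  destruct k; unfold pairz. f_equal; ring. f_equal; f_equal; ring.
Qed.

(** Orthogonality of characters modulo [2 r + 1]. The odd order makes [- r, ..., r] a complete
    residue system, so the sum can be taken symmetrically, as [pairz] does. *)
Lemma root_of_unity_sum (r j : nat) :
  csum (pairz tpi (fun o => Cexp (- (RtoC (INR j / INR (2 * r + 1))) * o))) (S r) =
  if Nat.eqb (j mod (2 * r + 1)) 0 then INR (2 * r + 1) else 0.
Proof.
  set (N := (2 * r + 1)%nat). assert (HN : INR N <> 0%R) by (apply not_0_INR; lia).
  assert (HN2 : (0 < INR N)%R) by (apply lt_0_INR; lia).
  set (th := - RtoC (INR j / INR N) * tpi).
  rewrite (csum_ext _ (pairz th Cexp)) by (intros; apply pairz_comp_scal).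
  assert (Hj := Nat.div_mod_eq j N). set (b := (j mod N)%nat) in *.
  assert (Hb : (b < N)%nat) by (apply Nat.mod_upper_bound; lia).
  assert (EN : (INR N = INR r + INR (S r))%R) by (rewrite <- plus_INR; f_equal; lia).
  assert (D := dirichlet_kernel th r).
  (* The two ends of the kernel differ by [(2 r + 1) th], a multiple of [2 pi i], so its numerator
     vanishes. *)
  assert (Ex : Cexp (INR (S r) * th) = Cexp (- (INR r * th))).
  { replace (INR (S r) * th) with (- (INR r * th) + - (INR j * tpi)).
    - rewrite Cexp_plus, (Cexp_opp (INR j * tpi)), Cexp_tpi_nat. field; intros K; apply RtoC_inj in K; lra.
    - unfold th. unfold Rdiv. rewrite RtoC_mult, RtoC_inv by auto.
      replace (RtoC (INR (S r))) with (RtoC (INR N) - RtoC (INR r)) by (rewrite EN, RtoC_plus; ring).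
      field; intros K; apply RtoC_inj in K; lra. }
  rewrite Ex in D. replace (Cexp (- (INR r * th)) - Cexp (- (INR r * th))) with (RtoC 0) in D by ring.
  assert (Eth : Cexp th = Cexp (- RtoC (INR b / INR N) * tpi)).
  { unfold th. replace (- RtoC (INR j / INR N) * tpi) with
      (- RtoC (INR b / INR N) * tpi + - (INR (j / N) * tpi)).
    - rewrite Cexp_plus, (Cexp_opp (INR (j / N) * tpi)), Cexp_tpi_nat. field; intros K; apply RtoC_inj in K; lra.
    - rewrite Hj at 2. rewrite plus_INR, mult_INR. unfold Rdiv.
      rewrite !RtoC_mult, RtoC_inv, RtoC_plus, RtoC_mult by auto. field; intros K; apply RtoC_inj in K; lra. }
  destruct (Nat.eqb_spec b 0) as [Z|Z].
  - assert (E1 : Cexp th = 1).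
    { rewrite Eth, Z. simpl INR. replace (- RtoC (0 / INR N) * tpi) with (RtoC 0). apply Cexp_0.
      unfold Rdiv. rewrite Rmult_0_l. ring. }
    assert (En : forall n, Cexp (INR n * th) = 1).
    { intros n. rewrite Cexp_pow, E1, Cpow_1_l. reflexivity. }
    assert (forall n, csum (pairz th Cexp) (S n) = 1 + 2 * INR n).
    { induction n. simpl. rewrite Cexp_0. ring.
      rewrite csum_S, IHn. unfold pairz. rewrite Cexp_opp, En, S_INR, RtoC_plus. field; intros K; apply RtoC_inj in K; lra. }
    rewrite H, EN, S_INR, !RtoC_plus. ring.
  (* Otherwise [cos (2 pi b / N) = 1], hence [sin (pi b / N) = 0], which is impossible for
     [0 < b < N]. *)
  - assert (E1 : Cexp th - 1 <> 0).
    { intros K. assert (Ec : Re (Cexp th) = 1%R). { replace (Cexp th) with (Cexp th - 1 + 1) by ring. rewrite K. creim. ring. }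
      rewrite Eth in Ec. unfold Cexp in Ec. creim. rewrite tpi_Re, tpi_Im in Ec.
      replace (- (INR b / INR N) * 0 - - 0 * (2 * PI))%R with 0%R in Ec by ring.
      replace (- (INR b / INR N) * (2 * PI) + - 0 * 0)%R with (- (2 * (INR b / INR N * PI)))%R in Ec by ring.
      rewrite exp_0, cos_neg, cos_2a_sin in Ec.
      assert (Hb0 : (0 < INR b)%R) by (apply lt_0_INR; lia). apply lt_INR in Hb.
      assert (Hd : (0 < INR b / INR N < 1)%R).
      { split. apply Rdiv_lt_0_compat; auto. apply Rmult_lt_reg_r with (INR N); auto.
        unfold Rdiv. rewrite Rmult_assoc, Rinv_l; lra. }
      assert (HP := PI_RGT_0).
      assert (0 < sin (INR b / INR N * PI))%R by (apply sin_gt_0; nra). nra. }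
    replace (csum (pairz th Cexp) (S r)) with (/ (Cexp th - 1) * ((Cexp th - 1) * csum (pairz th Cexp) (S r))).
    rewrite D. ring. rewrite Cmult_assoc, Cinv_l by auto. ring.
Qed.

Lemma csum_multiples (g : nat -> C) (N M : nat) : (0 < N)%nat ->
  csum (fun j => if Nat.eqb (j mod N) 0 then g j else 0) (N * M) = csum (fun m => g (N * m)%nat) M.
Proof.
  intros HN. induction M. rewrite Nat.mul_0_r. reflexivity.
  rewrite Nat.mul_succ_r, csum_split, IHM, csum_S. f_equal.
  destruct N as [|N]. lia. rewrite csum_first.
  rewrite Nat.add_0_r, (Nat.mul_comm (S N) M), Nat.Div0.mod_mul, Nat.eqb_refl.
  rewrite (csum_ext _ (fun _ => 0)).
  - rewrite csum_const. ring.
  - intros k Hk. replace (M * S N + S k)%nat with (S k + M * S N)%nat by lia.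
    rewrite Nat.Div0.mod_add, Nat.mod_small by lia. reflexivity.
Qed.

Lemma Clim_subseq (u : nat -> C) (l : C) (p : nat -> nat) :
  (forall n, (n <= p n)%nat) -> Clim u l -> Clim (fun n => u (p n)) l.
Proof.
  intros Hp H. apply Clim_eps. intros eps He. destruct (Clim_eps_inv _ _ H eps He) as [N HN].
  exists N. intros n Hn. apply HN. specialize (Hp n). lia.
Qed.

Lemma csum_pairz_lim (a : C) (h : nat -> C -> C) (g : C -> C) (K : nat) :
  (forall k, (k < K)%nat -> Clim (fun j => h j (INR k * a)) (g (INR k * a)) /\
      Clim (fun j => h j (- (INR k * a))) (g (- (INR k * a)))) ->
  Clim (fun j => csum (pairz a (h j)) K) (csum (pairz a g) K).
Proof. intros H. apply csum_lim. intros k Hk. destruct (H k Hk). now apply pairz_lim. Qed.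

Lemma csum_pairz_csum (a : C) (h : nat -> C -> C) (n K : nat) :
  csum (pairz a (fun o => csum (fun j => h j o) n)) K = csum (fun j => csum (pairz a (h j)) K) n.
Proof.
  rewrite csum_swap. apply csum_ext. intros k _. destruct k; simpl; auto. now rewrite csum_plus.
Qed.

Lemma Cexp_lt_1 (z : C) : (0 < Re z)%R -> (Cmod (Cexp (- z)) < 1)%R.
Proof. intros H. rewrite Cmod_Cexp. creim. rewrite <- exp_0. apply exp_increasing. lra. Qed.

(** The points [exp (- (c + 2 pi i k) / N)] are the [N]-th roots of [exp (- c)]; averaging a power
    series over them keeps the exponents divisible by [N]. *)
Lemma filter_series (cf : nat -> C) (Hh : C -> C) (c X : C) (r : nat) :
  (0 < Re c)%R -> (forall q, (Cmod q < 1)%R -> cser (fun j => cf j * q ^ j)%C (Hh q)) ->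
  cser (fun m => cf ((2 * r + 1) * m)%nat * (Cexp (- c) ^ m))%C X ->
  csum (pairz tpi (fun o => Hh (Cexp (- ((c + o) / INR (2 * r + 1)))))) (S r) = INR (2 * r + 1) * X.
Proof.
  intros Hc Hs HX. set (N := (2 * r + 1)%nat) in *.
  assert (HN : INR N <> 0%R) by (apply not_0_INR; lia).
  assert (HNc : RtoC (INR N) <> 0) by (intros K; apply RtoC_inj in K; lra).
  assert (HN2 : (0 < INR N)%R) by (apply lt_0_INR; lia).
  set (q := fun o => Cexp (- ((c + o) / INR N))).
  assert (Hq : forall o, Re o = 0%R -> (Cmod (q o) < 1)%R).
  { intros o Ho. apply Cexp_lt_1. unfold Cdiv. rewrite <- RtoC_inv by auto. creim. rewrite Ho.
    assert (0 < / INR N)%R by now apply Rinv_0_lt_compat. nra. }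
  assert (Ho : forall k, Re (INR k * tpi) = 0%R /\ Re (- (INR k * tpi)) = 0%R).
  { intros k. creim. rewrite tpi_Re. split; ring. }
  eapply Clim_unique.
  (* Partial sums of length [N * M] consist of complete blocks, so the filter acts exactly on them,
     and both sides are limits in [M] of one sequence. *)
  - apply (csum_pairz_lim tpi (fun M o => csum (fun j => cf j * q o ^ j)%C (N * M)) (fun o => Hh (q o)) (S r)).
    intros k _. destruct (Ho k) as [H1 H2].
    split; apply (Clim_subseq (csum _)); try (intros; nia); apply Hs; auto.
  - apply Clim_ext with (fun M => INR N * csum (fun m => cf (N * m)%nat * (Cexp (- c) ^ m))%C M).
    2: now apply Clim_scal.
    intros M. rewrite csum_pairz_csum, <- csum_scal.
    set (g := fun j => INR N * (cf j * Cexp (- (RtoC (INR j / INR N) * c)))).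
    transitivity (csum (fun m => g (N * m)%nat) M).
    + apply csum_ext. intros m _. unfold g. rewrite <- Cexp_pow. do 4 f_equal. unfold Rdiv.
      rewrite mult_INR, !RtoC_mult, RtoC_inv by auto. field. auto.
    + rewrite <- csum_multiples by lia.
      apply csum_ext. intros j _. unfold g.
      rewrite (csum_ext (fun i => pairz tpi (fun o => cf j * q o ^ j)%C i)
        (fun k => (cf j * Cexp (- (RtoC (INR j / INR N) * c))) *
         pairz tpi (fun o => Cexp (- RtoC (INR j / INR N) * o)) k)).
      * rewrite csum_scal. unfold N. rewrite root_of_unity_sum. fold N.
        destruct (Nat.eqb (j mod N) 0); ring.
      * intros k _. rewrite <- pairz_scal. apply pairz_ext. intros o. unfold q.
        rewrite <- Cexp_pow, <- !Cmult_assoc, <- Cexp_plus. f_equal. f_equal.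
        unfold Rdiv. rewrite RtoC_mult, RtoC_inv by auto. field. auto.
Qed.

Lemma summable_plus (b c : nat -> R) : summable b -> summable c -> summable (fun n => b n + c n)%R.
Proof.
  intros [Hb [B HB]] [Hc [D HD]]. split. intros n. specialize (Hb n). specialize (Hc n). lra.
  exists (B + D)%R. intros n. specialize (HB n). specialize (HD n).
  replace (rsum (fun n => b n + c n)%R n) with (rsum b n + rsum c n)%R. lra.
  clear. induction n; simpl. ring. rewrite <- IHn. ring.
Qed.

(** * Uniform estimates for the discretised variable *)

(** Otherwise [cos 1.95 >= 0], while [1 - x ^ 2 / 2 + x ^ 4 / 24] is negative at [x = 1.95]. A bound
    strictly below 4 is what makes the angles fit into the rectangle of [Cexp_opp_diff_ge]. *)
Lemma PI_lt : (PI < 39 / 10)%R.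
Proof.
  destruct (Rlt_dec PI (39 / 10)) as [|H]; auto. exfalso.
  destruct (cos_bound (195 / 100) 0) as [_ K]; try lra.
  unfold cos_approx, cos_term in K. simpl in K.
  assert (0 <= cos (195 / 100))%R by (apply cos_ge_0; lra). field_simplify in K. lra.
Qed.

(* [n (1 - exp (- z / n))], which tends to [z] as [n = 2 r + 1] grows. *)
Definition vdisc (r : nat) (z : C) : C := INR (2 * r + 1) * (1 - Cexp (- (z / INR (2 * r + 1)))).

Lemma odd_pos (r : nat) : (0 < INR (2 * r + 1))%R.
Proof. apply lt_0_INR. lia. Qed.

Lemma odd_neq_0 (r : nat) : RtoC (INR (2 * r + 1)) <> 0.
Proof. intros K. apply RtoC_inj in K. assert (H := odd_pos r). lra. Qed.

Lemma Re_div_R (z : C) (x : R) : x <> 0%R -> Re (z / x) = (Re z / x)%R.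
Proof. intros H. unfold Cdiv. rewrite <- RtoC_inv by auto. creim. unfold Rdiv. ring. Qed.

Lemma Im_div_R (z : C) (x : R) : x <> 0%R -> Im (z / x) = (Im z / x)%R.
Proof. intros H. unfold Cdiv. rewrite <- RtoC_inv by auto. creim. unfold Rdiv. ring. Qed.

Lemma q_lt_1 (r : nat) (z : C) : (0 < Re z)%R -> (Cmod (Cexp (- (z / INR (2 * r + 1)))) < 1)%R.
Proof.
  intros H. apply Cexp_lt_1. assert (K := odd_pos r). rewrite Re_div_R by lra.
  now apply Rdiv_lt_0_compat.
Qed.

Lemma vdisc_slit (r : nat) (z : C) : (0 < Re z)%R -> slit (vdisc r z).
Proof.
  intros H. left. unfold vdisc. assert (K := odd_pos r). assert (Q := q_lt_1 r z H).
  assert (A := re_le_Cmod (Cexp (- (z / INR (2 * r + 1))))). apply Rabs_le_between in A.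
  creim. nra.
Qed.

Lemma vdisc_lim (z : C) : (0 < Re z)%R -> Clim (fun r => vdisc r z) z.
Proof.
  intros H. apply Clim_squeeze with (fun r => Cmod z * Cmod z * pw 1 r)%R O.
  - intros r _. set (u := z / INR (2 * r + 1)).
    assert (K := odd_pos r). assert (Kc := odd_neq_0 r).
    replace (vdisc r z - z) with (INR (2 * r + 1) * (1 - Cexp (- u) - u)).
    2: { unfold vdisc, u. field. auto. }
    rewrite Cmod_mult, Cmod_R, Rabs_pos_eq by lra.
    assert (Hu : (0 <= Re u)%R). { unfold u. rewrite Re_div_R by lra. left. now apply Rdiv_lt_0_compat. }
    assert (T := Cexp_opp_taylor u Hu).
    assert (Eu : Cmod u = (Cmod z / INR (2 * r + 1))%R).
    { unfold u. rewrite Cmod_div by auto. rewrite Cmod_R, Rabs_pos_eq by lra. reflexivity. }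
    apply Rle_trans with (INR (2 * r + 1) * (Cmod u * Cmod u))%R. apply Rmult_le_compat_l; lra.
    rewrite Eu.
    replace (INR (2 * r + 1) * (Cmod z / INR (2 * r + 1) * (Cmod z / INR (2 * r + 1))))%R with
      (Cmod z * Cmod z * / INR (2 * r + 1))%R by (field; lra).
    apply Rmult_le_compat_l. assert (A := Cmod_ge_0 z); nra.
    unfold pw. rewrite Rpower_Ropp, Rpower_1 by (assert (A := INR_ge_0 r); lra).
    apply Rinv_le_contravar. assert (A := INR_ge_0 r); lra.
    rewrite plus_INR, mult_INR. simpl. assert (A := INR_ge_0 r); lra.
  - apply is_lim_seq_0_scal, pw_lim. lra.
Qed.

Lemma Clim_el (al be : C) (u : nat -> C) (l : C) : slit l -> Clim u l ->
  Clim (fun n => el al be (u n)) (el al be l).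
Proof.
  intros Hl Hu. unfold el, Cdiv. apply Clim_mult.
  - apply Clim_plus. apply Clim_const. apply Clim_scal. now apply Clim_Clog.
  - apply Clim_inv; auto. now apply slit_neq_0.
Qed.

Lemma Clim_eA (al be : C) (u : nat -> C) (l : C) : slit l -> Clim u l ->
  Clim (fun n => eA al be (u n)) (eA al be l).
Proof.
  intros Hl Hu. assert (H := Clim_Clog u l Hl Hu). unfold eA.
  apply Clim_plus; apply Clim_scal; auto. now apply Clim_mult.
Qed.

(** The counterpart of [cone_bound] for a purely imaginary shift [o]. The constant depends only on
    [s] and [M], hence is uniform as [z] runs over a segment in the right half-plane. *)
Lemma right_cone_bound (s M : R) (z o : C) (k : R) : (0 < s)%R -> (0 <= k)%R -> (s <= Re z)%R ->
  (Cmod z <= M)%R -> Re o = 0%R -> (k <= Cmod o)%R ->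
  (/ (1 + (1 + M) / s) * (k + 1) <= Cmod (z + o))%R.
Proof.
  intros Hs Hk Hz HM Ho Hko.
  assert (HM0 : (0 <= M)%R) by (eapply Rle_trans; [apply Cmod_ge_0|exact HM]).
  assert (HC : (0 < 1 + (1 + M) / s)%R). { assert (0 < (1 + M) / s)%R by (apply Rdiv_lt_0_compat; lra). lra. }
  apply Rmult_le_reg_l with (1 + (1 + M) / s)%R; auto.
  rewrite <- Rmult_assoc, Rinv_r, Rmult_1_l by lra. set (v := Cmod (z + o)).
  assert (A1 : (s <= v)%R).
  { eapply Rle_trans. exact Hz. assert (K := re_le_Cmod (z + o)). creim. rewrite Ho in K.
    apply Rabs_le_between in K. unfold v. lra. }
  assert (A2 : (k <= v + M)%R).
  { assert (K := Cmod_triangle_rev o (- z)). rewrite Cmod_opp in K.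
    replace (o - - z) with (z + o) in K by ring. fold v in K. lra. }
  assert (A3 : (1 <= v / s)%R). { apply Rmult_le_reg_r with s; auto. unfold Rdiv. rewrite Rmult_assoc, Rinv_l; lra. }
  replace ((1 + (1 + M) / s) * v)%R with (v + (1 + M) * (v / s))%R by (field; lra). nra.
Qed.

(** The lower bound behind domination, uniform in [r] for [k <= r]. The imaginary part of [z + o] is
    at most [M + 2 pi r <= r / 10 + 7.8 r], so after division by [2 r + 1] it stays below 4: this is
    where [10 * M <= r] and [pi < 3.9] meet. *)
Lemma vdisc_lower (s M : R) (z o : C) (r k : nat) : (0 < s)%R -> (s <= Re z)%R -> (Cmod z <= M)%R ->
  (k <= r)%nat -> (10 * M <= INR r)%R -> Re o = 0%R -> Rabs (Im o) = (2 * PI * INR k)%R ->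
  (/ (1 + (1 + M) / s) / 6 * (INR k + 1) <= Cmod (vdisc r (z + o)))%R.
Proof.
  intros Hs Hz HM Hkr HrM Ho Hio. assert (K := odd_pos r). assert (Kc := odd_neq_0 r).
  assert (HPI := PI_lt). assert (HP2 := PI_RGT_0). assert (HP3 := PI2_3_2).
  assert (Hk := INR_ge_0 k). assert (Hkr' := le_INR _ _ Hkr).
  assert (EN : INR (2 * r + 1) = (2 * INR r + 1)%R) by (rewrite plus_INR, mult_INR; simpl; ring).
  set (u := (z + o) / INR (2 * r + 1)).
  assert (Eu : Cmod u = (Cmod (z + o) / INR (2 * r + 1))%R).
  { unfold u. rewrite Cmod_div by auto. rewrite Cmod_R, Rabs_pos_eq by lra. reflexivity. }
  assert (HzR := re_le_Cmod z). assert (HzI := im_le_Cmod z).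
  apply Rabs_le_between in HzR. apply Rabs_le_between in HzI.
  assert (HiO : (- (2 * PI * INR k) <= Im o <= 2 * PI * INR k)%R).
  { apply Rabs_le_between. rewrite Hio. lra. }
  assert (L := Cexp_opp_diff_ge u).
  assert (L2 : (Cmod u / 6 <= Cmod (1 - Cexp (- u)))%R).
  { apply L; unfold u; rewrite ?Re_div_R, ?Im_div_R by lra; creim; try rewrite Ho.
    - split. left; apply Rdiv_lt_0_compat; lra. apply Rmult_le_reg_r with (INR (2 * r + 1)); auto.
      unfold Rdiv. rewrite Rmult_assoc, Rinv_l by lra. lra.
    - assert (2 * PI * INR k <= 2 * PI * INR r)%R by (apply Rmult_le_compat_l; lra).
      split; apply Rmult_le_reg_r with (INR (2 * r + 1)); auto;
      unfold Rdiv; rewrite Rmult_assoc, Rinv_l by lra; nra. }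
  assert (B := right_cone_bound s M z o (INR k) Hs Hk Hz HM Ho).
  assert (Hko : (INR k <= Cmod o)%R).
  { eapply Rle_trans. 2: apply im_le_Cmod. rewrite Hio. nra. }
  specialize (B Hko). unfold vdisc. fold u. rewrite Cmod_mult, Cmod_R, Rabs_pos_eq by lra.
  apply Rle_trans with (INR (2 * r + 1) * (Cmod u / 6))%R. 2: apply Rmult_le_compat_l; lra.
  rewrite Eu. replace (INR (2 * r + 1) * (Cmod (z + o) / INR (2 * r + 1) / 6))%R with (Cmod (z + o) / 6)%R by (field; lra).
  lra.
Qed.

Lemma Dc_line (a b : C) (t : R) : Dc (fun u => a + RtoC u * b) t b.
Proof.
  eapply Dc_eq. apply Dc_plus. apply Dc_const. apply Dc_mult. apply Dc_id. apply Dc_const. cbv beta. ring.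
Qed.

Lemma segment_right (c c' : C) (t : R) : (0 <= t <= 1)%R ->
  (Rmin (Re c) (Re c') <= Re (c' + t * (c - c')))%R /\
  (Cmod (c' + t * (c - c')) <= Cmod c + Cmod c')%R.
Proof.
  intros Ht. split.
  - creim. assert (A := Rmin_l (Re c) (Re c')). assert (B := Rmin_r (Re c) (Re c')). nra.
  - replace (c' + t * (c - c')) with (t * c + RtoC (1 - t) * c') by (rewrite RtoC_minus; ring).
    eapply Rle_trans. apply Cmod_triangle. rewrite !Cmod_mult, !Cmod_R, !Rabs_pos_eq by lra.
    assert (A := Cmod_ge_0 c). assert (B := Cmod_ge_0 c'). nra.
Qed.

(** The mean value inequality from [c'] to [c]: the inner derivative is an exponential of modulus
    below 1, and [el1] is [O (|v| ^ (- 3 / 2))]. A single value of [el] is only controlled by the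
    power [- 1 / 2], which would not dominate. *)
Lemma vdisc_el_diff (al be c c' : C) : (0 < Re c)%R -> (0 < Re c')%R ->
  exists B J, forall r k o, (J <= r)%nat -> (k <= r)%nat -> Re o = 0%R ->
    Rabs (Im o) = (2 * PI * INR k)%R ->
    (Cmod (el al be (vdisc r (c + o)) - el al be (vdisc r (c' + o))) <= B * pw (3 / 2) k)%R.
Proof.
  intros Hc Hc'. set (s := Rmin (Re c) (Re c')). set (M := (Cmod c + Cmod c')%R).
  assert (Hs : (0 < s)%R) by (apply Rmin_glb_lt; auto).
  set (kp := (/ (1 + (1 + M) / s) / 6)%R).
  assert (HM0 : (0 <= M)%R). { unfold M. assert (A := Cmod_ge_0 c). assert (A' := Cmod_ge_0 c'). lra. }
  assert (Hkp : (0 < kp)%R).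
  { unfold kp. assert (0 < (1 + M) / s)%R by (apply Rdiv_lt_0_compat; lra).
    apply Rdiv_lt_0_compat. apply Rinv_0_lt_compat; lra. lra. }
  destruct (el1_bound kp al be Hkp) as [B [HB Hel]].
  destruct (INR_unbounded (10 * M)) as [J HJ].
  exists (Cmod (c - c') * (B * Rpower kp (- (3 / 2))))%R, J.
  intros r k o Hr Hk Ho Hio. assert (K := odd_pos r). assert (Kc := odd_neq_0 r).
  assert (Hrr : (10 * M <= INR r)%R) by (apply le_INR in Hr; lra).
  assert (Hseg := fun t Ht => segment_right c c' t Ht). fold s M in Hseg.
  assert (T := mean_value (fun t => el al be (vdisc r (c' + RtoC t * (c - c') + o)))
    (fun t => (c - c') * Cexp (- ((c' + RtoC t * (c - c') + o) / INR (2 * r + 1))) *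
       el1 al be (vdisc r (c' + RtoC t * (c - c') + o))) 0 1
    (Cmod (c - c') * (B * Rpower kp (- (3 / 2))) * pw (3 / 2) k)).
  cbv beta in T. replace (c' + 1 * (c - c') + o) with (c + o) in T by ring.
  replace (c' + 0 * (c - c') + o) with (c' + o) in T by ring. rewrite Rminus_0_r, Rmult_1_r in T.
  apply T. lra.
  - intros t Ht. destruct (Hseg t Ht) as [S1 S2].
    assert (Hre : (0 < Re (c' + RtoC t * (c - c') + o))%R).
    { assert (Re (c' + RtoC t * (c - c') + o) = Re (c' + RtoC t * (c - c')) + Re o)%R by reflexivity. lra. }
    eapply Dc_eq. apply Dc_el. now apply vdisc_slit.
    unfold vdisc. apply Dc_scal. apply Dc_minus. apply Dc_const. apply Dc_Cexp.
    apply Dc_ext with (fun u => - (1 / INR (2 * r + 1)) * (c' + RtoC u * (c - c') + o)).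
    { intros u. unfold Cdiv. ring. }
    apply Dc_scal. apply Dc_plus. apply Dc_line. apply Dc_const.
    cbv beta. unfold Cdiv. field. auto.
  - intros t Ht. destruct (Hseg t Ht) as [S1 S2].
    assert (Hre : (0 < Re (c' + RtoC t * (c - c') + o))%R).
    { assert (Re (c' + RtoC t * (c - c') + o) = Re (c' + RtoC t * (c - c')) + Re o)%R by reflexivity. lra. }
    assert (Hq := q_lt_1 r _ Hre).
    assert (Hv := vdisc_lower s M _ o r k Hs S1 S2 Hk Hrr Ho Hio). fold kp in Hv.
    assert (Hkk := INR_ge_0 k).
    assert (Hv2 : (kp <= Cmod (vdisc r (c' + RtoC t * (c - c') + o)))%R) by nra.
    assert (He := Hel _ (vdisc_slit r _ Hre) Hv2).
    assert (He2 : (Rpower (Cmod (vdisc r (c' + RtoC t * (c - c') + o))) (- (3 / 2)) <=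
       Rpower kp (- (3 / 2)) * pw (3 / 2) k)%R).
    { unfold pw. rewrite Rpower_mult_distr by lra. apply Rpower_le_neg; try lra. split; nra. }
    rewrite !Cmod_mult. 
    set (Q := Cmod (Cexp (- ((c' + t * (c - c') + o) / INR (2 * r + 1))))) in *.
    set (E := Cmod (el1 al be (vdisc r (c' + t * (c - c') + o)))) in *.
    assert (HQ : (0 <= Q)%R) by apply Cmod_ge_0. assert (HE : (0 <= E)%R) by apply Cmod_ge_0.
    assert (HC := Cmod_ge_0 (c - c')).
    assert (E1 : (E <= B * (Rpower kp (- (3 / 2)) * pw (3 / 2) k))%R).
    { eapply Rle_trans. exact He. apply Rmult_le_compat_l; auto. }
    apply Rle_trans with (Cmod (c - c') * 1 * E)%R.
    + apply Rmult_le_compat_r; auto. apply Rmult_le_compat_l; lra.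
    + rewrite Rmult_1_r, !Rmult_assoc. apply Rmult_le_compat_l; auto.
Qed.

(** * A Lipschitz summation formula *)

(** With [v = N (1 - q)], [log v = ln N + log (1 - q)], so [el] at [v] combines [1 / (1 - q)] and
    [log (1 - q) / (1 - q)]. Their coefficients are 1 and minus the harmonic numbers, and the filter
    keeps those of index [N m]. *)
Lemma vdisc_sum (al be c : C) (r : nat) : (0 < Re c)%R ->
  cser (fun m => (al + be * (ln (INR (2 * r + 1)) - harm ((2 * r + 1) * m))%R) * (Cexp (- c) ^ m)%C)
    (csum (pairz tpi (fun o => el al be (vdisc r (c + o)))) (S r)).
Proof.
  intros Hc. assert (K := odd_pos r). assert (Kc := odd_neq_0 r).
  assert (Hq := Cexp_lt_1 c Hc). assert (HX1 := cser_geom _ Hq).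
  assert (HX2 : exists X, cser (fun m => harm ((2 * r + 1) * m) * (Cexp (- c) ^ m)%C) X).
  { apply cser_abs with (fun m => INR (2 * r + 1) * ((INR m + 1) * Cmod (Cexp (- c)) ^ m))%R.
    - intros m. rewrite Cmod_mult, Cmod_R, Cmod_pow, Rabs_pos_eq, <- Rmult_assoc by apply harm_ge_0.
      apply Rmult_le_compat_r. apply pow_le, Cmod_ge_0. eapply Rle_trans. apply harm_le.
      rewrite mult_INR. apply Rmult_le_compat_l; lra.
    - apply summable_scal. lra. apply summable_geom. split; auto. apply Cmod_ge_0. }
  destruct HX2 as [X HX].
  assert (F1 := filter_series (fun _ => 1) (fun q => / (1 - q)) c (/ (1 - Cexp (- c))) r Hc).
  assert (F2 := filter_series (fun m => harm m) (fun q => - Clog (1 - q) / (1 - q)) c X r Hc cser_harm HX).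
  rewrite (csum_ext _ (fun k => (al + be * ln (INR (2 * r + 1))) / INR (2 * r + 1) *
      pairz tpi (fun o => / (1 - Cexp (- ((c + o) / INR (2 * r + 1))))) k -
      be / INR (2 * r + 1) * pairz tpi (fun o => - Clog (1 - Cexp (- ((c + o) / INR (2 * r + 1)))) /
         (1 - Cexp (- ((c + o) / INR (2 * r + 1))))) k)).
  - rewrite csum_minus, !csum_scal, F1, F2.
    + apply cser_ext with (fun m => (al + be * ln (INR (2 * r + 1))) * (Cexp (- c) ^ m)%C -
         be * (harm ((2 * r + 1) * m) * (Cexp (- c) ^ m)%C)).
      { intros m. rewrite RtoC_minus. ring. }
      replace ((al + be * ln (INR (2 * r + 1))) / INR (2 * r + 1) * (INR (2 * r + 1) * / (1 - Cexp (- c))) -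
        be / INR (2 * r + 1) * (INR (2 * r + 1) * X)) with
        ((al + be * ln (INR (2 * r + 1))) * / (1 - Cexp (- c)) - be * X).
      2: { field. split; auto. apply slit_neq_0, one_minus_slit; auto. }
      apply cser_minus; apply cser_scal; auto.
    + intros q H. eapply cser_ext. 2: now apply cser_geom. intros; cbv beta; ring.
    + eapply cser_ext. 2: exact HX1. intros; cbv beta; ring.
  - intros k _.
    assert (Hel : forall o, Re o = 0%R -> el al be (vdisc r (c + o)) =
      (al + be * ln (INR (2 * r + 1))) / INR (2 * r + 1) * / (1 - Cexp (- ((c + o) / INR (2 * r + 1)))) -
      be / INR (2 * r + 1) * (- Clog (1 - Cexp (- ((c + o) / INR (2 * r + 1)))) /
         (1 - Cexp (- ((c + o) / INR (2 * r + 1)))))).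
    { intros o Ho. assert (Hs : slit (1 - Cexp (- ((c + o) / INR (2 * r + 1))))).
      { apply one_minus_slit, q_lt_1. creim. lra. }
      unfold el, vdisc. rewrite Clog_scal by auto. field. split; auto. now apply slit_neq_0. }
    rewrite <- !pairz_scal, <- pairz_minus. apply pairz_ext_at; apply Hel; creim; rewrite tpi_Re; ring.
Qed.

Lemma pairz_offset (k : nat) : Re (INR k * tpi) = 0%R /\ Re (- (INR k * tpi)) = 0%R /\
  Rabs (Im (INR k * tpi)) = (2 * PI * INR k)%R /\ Rabs (Im (- (INR k * tpi))) = (2 * PI * INR k)%R.
Proof.
  creim. rewrite tpi_Re, tpi_Im. assert (H := INR_ge_0 k). assert (P := PI_RGT_0).
  rewrite Rabs_Ropp. repeat split; try ring; rewrite Rabs_pos_eq; try ring; nra.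
Qed.

Lemma log_harm_lim (m : nat) :
  is_lim_seq (fun r => ln (INR (2 * r + 1)) - harm ((2 * r + 1) * S m))%R (- (euler_gamma + ln (INR (S m))))%R.
Proof.
  apply is_lim_seq_ext with
    (fun r => - (harm ((2 * r + 1) * S m) - ln (INR ((2 * r + 1) * S m))) + - ln (INR (S m)))%R.
  { intros r. rewrite mult_INR, ln_mult. ring. apply odd_pos. apply INR_S_pos. }
  replace (- (euler_gamma + ln (INR (S m))))%R with (- euler_gamma + - ln (INR (S m)))%R by ring.
  apply is_lim_seq_plus'. 2: apply is_lim_seq_const.
  apply (is_lim_seq_opp _ euler_gamma).
  apply (is_lim_seq_subseq (fun n => harm n - ln (INR n))%R euler_gamma (fun r => (2 * r + 1) * S m)%nat).
  - apply eventually_subseq. intros n. nia.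
  - apply harm_ln_lim.
Qed.

(** Uniform in [r] and linear in [m], as a majorant against geometric decay must be. *)
Lemma log_harm_bound (r m : nat) :
  (Rabs (ln (INR (2 * r + 1)) - harm ((2 * r + 1) * S m)) <= (Rabs euler_gamma + 2) * (INR m + 1))%R.
Proof.
  assert (E : exists j, ((2 * r + 1) * S m = S j)%nat) by (exists (2 * r * S m + m)%nat; lia).
  destruct E as [j Ej].
  assert (A := harm_ln_gamma j). rewrite <- Ej in A. rewrite (mult_INR (2 * r + 1)), ln_mult in A.
  2: apply odd_pos. 2: apply INR_S_pos.
  assert (Hj : (/ (INR (2 * r + 1) * INR (S m)) <= 1)%R).
  { rewrite <- mult_INR, Ej. apply Rle_trans with (/ 1)%R; [|lra]. apply Rinv_le_contravar. lra.
    rewrite S_INR. assert (K := INR_ge_0 j). lra. }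
  assert (B : (0 <= ln (INR (S m)) <= INR m)%R).
  { split. apply ln_ge_0. rewrite S_INR. assert (K := INR_ge_0 m). lra.
    assert (K := ln_le_minus_1 _ (INR_S_pos m)). rewrite S_INR in *. lra. }
  assert (K := INR_ge_0 m). assert (G := Rabs_pos euler_gamma). assert (G2 := Rle_abs euler_gamma).
  assert (G3 := Rle_abs (- euler_gamma)). rewrite Rabs_Ropp in G3.
  apply Rabs_le. nra.
Qed.

(** Dominated convergence in [r] on both sides of [vdisc_sum]: the sum over offsets has a growing
    range and the majorant of [vdisc_el_diff], the power series has a geometric majorant. *)
Lemma lipschitz_formula (al be c c' : C) : (0 < Re c)%R -> (0 < Re c')%R ->
  exists L, cser (pairz tpi (fun o => el al be (c + o) - el al be (c' + o))) L /\
    cser (fun m => (al - be * (euler_gamma + ln (INR (S m)))) *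
       ((Cexp (- c) ^ S m)%C - (Cexp (- c') ^ S m)%C)) L.
Proof.
  intros Hc Hc'.
  set (Lr := fun r => csum (pairz tpi (fun o => el al be (vdisc r (c + o)) - el al be (vdisc r (c' + o)))) (S r)).
  assert (H1 : exists L, cser (pairz tpi (fun o => el al be (c + o) - el al be (c' + o))) L /\ Clim Lr L).
  { destruct (vdisc_el_diff al be c c' Hc Hc') as [B [J HB]].
    apply (tannery_sums (fun r => pairz tpi (fun o => el al be (vdisc r (c + o)) - el al be (vdisc r (c' + o))))
      S _ (fun k => 2 * (Rmax 0 B * pw (3 / 2) k))%R).
    - apply summable_scal. lra. apply summable_scal. apply Rmax_l. apply summable_pw. lra.
    - intros K. exists K. intros. lia.
    - exists J. intros r k Hr Hk. destruct (pairz_offset k) as [A1 [A2 [A3 A4]]].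
      assert (HBm : (B * pw (3 / 2) k <= Rmax 0 B * pw (3 / 2) k)%R).
      { apply Rmult_le_compat_r. left; apply pw_pos. apply Rmax_r. }
      apply pairz_bound; (eapply Rle_trans; [apply (HB r k); try lia; assumption | exact HBm]).
    - intros k. destruct (pairz_offset k) as [A1 [A2 [A3 A4]]].
      apply (pairz_lim tpi (fun r o => el al be (vdisc r (c + o)) - el al be (vdisc r (c' + o)))
         (fun o => el al be (c + o) - el al be (c' + o)));
      apply Clim_minus; (apply Clim_el; [left | apply vdisc_lim]);
        rewrite Re_plus, ?A1, ?A2; lra. }
  destruct H1 as [L [HL1 HL2]]. exists L. split; auto.
  set (q := Cmod (Cexp (- c))). set (q' := Cmod (Cexp (- c'))).
  assert (Hq : (0 <= q < 1)%R) by (split; [apply Cmod_ge_0|now apply Cexp_lt_1]).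
  assert (Hq' : (0 <= q' < 1)%R) by (split; [apply Cmod_ge_0|now apply Cexp_lt_1]).
  set (D := (Cmod al + Cmod be * (Rabs euler_gamma + 2))%R).
  assert (HD0 : (0 <= Cmod be * (Rabs euler_gamma + 2))%R).
  { apply Rmult_le_pos. apply Cmod_ge_0. assert (G := Rabs_pos euler_gamma). lra. }
  assert (HD : (0 <= D)%R). { unfold D. assert (A := Cmod_ge_0 al). lra. }
  destruct (tannery_series
    (fun r m => (al + be * (ln (INR (2 * r + 1)) - harm ((2 * r + 1) * S m))%R) *
       ((Cexp (- c) ^ S m)%C - (Cexp (- c') ^ S m)%C)) Lr
    (fun m => (al - be * (euler_gamma + ln (INR (S m)))) *
       ((Cexp (- c) ^ S m)%C - (Cexp (- c') ^ S m)%C))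
    (fun m => D * ((INR m + 1) * q ^ m + (INR m + 1) * q' ^ m))%R) as [G [HG1 HG2]].
  - apply summable_scal; auto. apply summable_plus; now apply summable_geom.
  - intros r. unfold Lr.
    assert (K := cser_minus _ _ _ _ (vdisc_sum al be c r Hc) (vdisc_sum al be c' r Hc')).
    (* The terms [m = 0] carry the coefficient [al + be * log N], unbounded in [N] when [be] is not
       0; since [q ^ 0 = 1] they are equal for [c] and [c'] and cancel. *)
    apply cser_first in K. rewrite <- csum_minus in K.
    rewrite (csum_ext _ (pairz tpi (fun o => el al be (vdisc r (c + o)) - el al be (vdisc r (c' + o))))) in K.
    2: intros; now rewrite pairz_minus.
    match type of K with cser _ ?x => match goal with |- cser _ ?y => replace y with x end end.
    2: { simpl Cpow. ring. }
    eapply cser_ext. 2: exact K. intros m. cbv beta. ring.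
  - intros r m. rewrite Cmod_mult.
    assert (B1 : (Cmod (al + be * (ln (INR (2 * r + 1)) - harm ((2 * r + 1) * S m))%R) <= D * (INR m + 1))%R).
    { eapply Rle_trans. apply Cmod_triangle. rewrite Cmod_mult, Cmod_R.
      assert (K := log_harm_bound r m). assert (A := Cmod_ge_0 al). assert (Bb := Cmod_ge_0 be).
      assert (K0 := INR_ge_0 m). unfold D.
      apply Rle_trans with (Cmod al + Cmod be * ((Rabs euler_gamma + 2) * (INR m + 1)))%R.
      apply Rplus_le_compat_l, Rmult_le_compat_l; auto. nra. }
    assert (B2 : (Cmod ((Cexp (- c) ^ S m)%C - (Cexp (- c') ^ S m)%C) <= q ^ m + q' ^ m)%R).
    { eapply Rle_trans. apply Cmod_triangle_minus. rewrite !Cmod_pow. fold q q'. simpl.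
      assert (P1 : (0 <= q ^ m)%R) by (apply pow_le; lra). assert (P2 : (0 <= q' ^ m)%R) by (apply pow_le; lra).
      nra. }
    eapply Rle_trans. apply Rmult_le_compat; try apply Cmod_ge_0. exact B1. exact B2. right. ring.
  - intros m. rewrite Cmult_comm. eapply Clim_ext. intros r. apply Cmult_comm. apply Clim_scal.
    replace (al - be * (euler_gamma + ln (INR (S m)))) with
      (al + be * RtoC (- (euler_gamma + ln (INR (S m))))%R) by (rewrite RtoC_opp, RtoC_plus; ring).
    apply Clim_plus. apply Clim_const. apply Clim_scal. apply Clim_RtoC. apply log_harm_lim.
  - replace L with G; auto. eapply Clim_unique; eauto.
Qed.

(** * The Lipschitz formula with period 2 pi i / y *)

Definition per (y : C) : C := tpi / y.

(** Indexed from 0: [rho] and [qx] at [m] belong to the frequency [m + 1]. *)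
Definition rho (al be y : C) (m : nat) : C := al - be * (Clog y + (euler_gamma + ln (INR (S m)))%R).

Definition qx (y : C) (x : R) (m : nat) : C := (Cexp (- (x * y)) ^ S m)%C.

Lemma right_neq_0 (y : C) : (0 < Re y)%R -> y <> 0.
Proof. intros H. apply slit_neq_0. now left. Qed.

Lemma per_Im (y : C) : (0 < Re y)%R -> (0 < Im (per y))%R.
Proof.
  intros H. assert (Hy := right_neq_0 y H). assert (Hp := Cmod_sqr_pos y Hy).
  assert (E : per y = RtoC (2 * PI / (Re y * Re y + Im y * Im y)) * (Ci * Cconj y)).
  { unfold per, tpi. unfold Rdiv. rewrite !RtoC_mult, RtoC_inv, RtoC_sqr_conj by lra. field.
    split; auto. intros K. apply Hy. rewrite <- (Cconj_conj y), K. unfold Cconj; apply C_eq; simpl; ring. }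
  rewrite E. creim. rewrite Re_conj, Im_conj. assert (P := PI_RGT_0).
  assert (0 < 2 * PI / (Re y * Re y + Im y * Im y))%R by (apply Rdiv_lt_0_compat; lra). nra.
Qed.

Definition off (a : C) (k : nat) (o : C) : Prop := o = INR k * a \/ o = - (INR k * a).

Lemma off_slit (a o : C) (k : nat) (x : R) : (0 < Im a)%R -> off a k o ->
  (0 < x \/ (0 <= x /\ (1 <= k)%nat))%R -> slit (x + o).
Proof.
  intros Ha Ho Hx. destruct k as [|k].
  - destruct Hx as [Hx|[_ Hx]]; [|lia]. left.
    destruct Ho as [->| ->]; creim; simpl; lra.
  - right. assert (H := INR_S_pos k). destruct Ho as [->| ->]; creim; nra.
Qed.

Lemma off_bound (a : C) : (0 < Im a)%R -> exists kp, (0 < kp)%R /\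
  forall k o x, off a k o -> (0 <= x)%R -> (kp * (x + INR k) <= Cmod (x + o))%R.
Proof.
  intros Ha. destruct (cone_bound a) as [k1 [H1 B1]]. lra.
  destruct (cone_bound (- a)) as [k2 [H2 B2]]. creim; lra.
  exists (Rmin k1 k2). split. now apply Rmin_glb_lt.
  intros k o x Ho Hx. assert (Hk := INR_ge_0 k).
  assert (M1 := Rmin_l k1 k2). assert (M2 := Rmin_r k1 k2). 
  destruct Ho as [->| ->].
  - eapply Rle_trans. 2: apply B1; auto. apply Rmult_le_compat_r; lra.
  - replace (x + - (INR k * a)) with (x + INR k * - a) by ring.
    eapply Rle_trans. 2: apply B2; auto. apply Rmult_le_compat_r; lra.
Qed.

Lemma pairz_off_bound (a : C) (h : C -> C) (k : nat) (B : R) :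
  (forall o, off a k o -> (Cmod (h o) <= B)%R) -> (Cmod (pairz a h k) <= 2 * B)%R.
Proof. intros H. apply pairz_bound; apply H; [now left|now right]. Qed.

Lemma pairz_off_ext (a : C) (h g : C -> C) (k : nat) :
  (forall o, off a k o -> h o = g o) -> pairz a h k = pairz a g k.
Proof. intros H. apply pairz_ext_at; apply H; [now left|now right]. Qed.

Lemma pairz_off_lim (a : C) (h : nat -> C -> C) (g : C -> C) (k : nat) :
  (forall o, off a k o -> Clim (fun j => h j o) (g o)) ->
  Clim (fun j => pairz a (h j) k) (pairz a g k).
Proof. intros H. apply pairz_lim; apply H; [now left|now right]. Qed.

Lemma Dc_pairz (a : C) (h h' : R -> C -> C) (k : nat) (t : R) :
  (forall o, off a k o -> Dc (fun u => h u o) t (h' t o)) ->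
  Dc (fun u => pairz a (h u) k) t (pairz a (h' t) k).
Proof.
  intros H. destruct k; unfold pairz.
  - apply H. left. simpl. ring.
  - apply Dc_plus; apply H; [now left|now right].
Qed.

Lemma off_scale (y o : C) (k : nat) : y <> 0 -> off (per y) k o -> Re (y * o) = 0%R.
Proof.
  intros Hy Ho. assert (E : y * per y = tpi) by (unfold per; field; auto).
  assert (Hr := tpi_Re). rewrite <- E in Hr.
  destruct Ho as [->| ->].
  - replace (y * (INR k * per y)) with (INR k * (y * per y)) by ring. rewrite Re_mult, Hr, Im_R. ring.
  - replace (y * - (INR k * per y)) with (- (INR k * (y * per y))) by ring.
    rewrite Re_opp, Re_mult, Hr, Im_R. ring.
Qed.

(** Both [y] and [y w] have arguments in [(- pi / 2, pi / 2)], so the difference of the arguments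
    stays in the principal range. *)
Lemma Clog_quot (y w : C) : (0 < Re y)%R -> (0 < Re (y * w))%R -> Clog w = Clog (y * w) - Clog y.
Proof.
  intros Hy Hw. apply Clog_unique.
  - rewrite Cexp_minus, !Cexp_Clog by now left. field. now apply right_neq_0.
  - creim. assert (A := Clog_Im_right y Hy). assert (B := Clog_Im_right (y * w)). 
    rewrite Re_mult in B. specialize (B Hw). lra.
Qed.

Lemma Re_scaled (y o : C) (k : nat) (x : R) : (0 < Re y)%R -> off (per y) k o -> 
  Re (y * (x + o)) = (x * Re y)%R.
Proof.
  intros Hy Ho. replace (y * (x + o)) with (y * x + y * o) by ring.
  rewrite Re_plus, (off_scale y o k (right_neq_0 y Hy) Ho). creim. ring.
Qed.

(** Multiplication by [y] turns the offsets into multiples of [2 pi i]; the logarithm splits without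
    a branch jump and [- be * log y] is added to [al]. *)
Lemma el_scaled (al be y o : C) (k : nat) (x : R) : (0 < Re y)%R -> (0 < x)%R -> off (per y) k o ->
  el al be (x + o) = y * el (al - be * Clog y) be (x * y + y * o).
Proof.
  intros Hy Hx Ho. assert (Hy0 := right_neq_0 y Hy).
  assert (HR := Re_scaled y o k x Hy Ho).
  assert (Hp : (0 < Re (y * (x + o)))%R) by (rewrite HR; nra).
  assert (H0 := right_neq_0 _ Hp).
  replace (x * y + y * o) with (y * (x + o)) by ring.
  unfold el. rewrite (Clog_quot y (x + o)) by auto. field. split; auto.
  intros K. apply H0. rewrite K. ring.
Qed.

Lemma lipschitz_unscaled (al be y : C) (x x' : R) : (0 < Re y)%R -> (0 < x)%R -> (0 < x')%R ->
  exists L, cser (pairz (per y) (fun o => el al be (x + o) - el al be (x' + o))) L /\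
    cser (fun m => y * rho al be y m * (qx y x m - qx y x' m)) L.
Proof.
  intros Hy Hx Hx'. assert (Hy0 := right_neq_0 y Hy).
  destruct (lipschitz_formula (al - be * Clog y) be (x * y) (x' * y)) as [L [H1 H2]].
  { creim. nra. } { creim. nra. }
  exists (y * L). split.
  - eapply cser_ext. 2: apply cser_scal; exact H1. intros k. cbv beta.
    rewrite <- pairz_scal. replace tpi with (y * per y) by (unfold per; field; auto).
    rewrite <- (pairz_comp_scal (per y) y (fun o => y * (el (al - be * Clog y) be (x * y + o) -
         el (al - be * Clog y) be (x' * y + o)))).
    apply pairz_off_ext. intros o Ho.
    rewrite (el_scaled al be y o k x), (el_scaled al be y o k x') by auto. ring.
  - eapply cser_ext. 2: apply cser_scal; exact H2. intros m. cbv beta. unfold rho, qx.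
    rewrite RtoC_plus. ring.
Qed.

Lemma rho_bound (al be y : C) : exists B, (0 <= B)%R /\
  forall m, (Cmod (rho al be y m) <= B * (INR m + 1))%R.
Proof.
  set (G := (Cmod (Clog y) + Rabs euler_gamma + 1)%R).
  assert (G0 := Cmod_ge_0 (Clog y)). assert (G1 := Rabs_pos euler_gamma).
  assert (A := Cmod_ge_0 al). assert (Bb := Cmod_ge_0 be).
  assert (HG : (0 <= G)%R) by (unfold G; lra).
  exists (Cmod al + Cmod be * G)%R. split. { assert (0 <= Cmod be * G)%R by now apply Rmult_le_pos. lra. }
  intros m. unfold rho. eapply Rle_trans. apply Cmod_triangle_minus. rewrite Cmod_mult.
  assert (K0 := INR_ge_0 m).
  assert (Hl : (0 <= ln (INR (S m)) <= INR m)%R).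
  { split. apply ln_ge_0. rewrite S_INR. lra.
    assert (K := ln_le_minus_1 _ (INR_S_pos m)). rewrite S_INR in *. lra. }
  assert (B1 : (Cmod (Clog y + (euler_gamma + ln (INR (S m)))%R) <= G * (INR m + 1))%R).
  { eapply Rle_trans. apply Cmod_triangle. rewrite Cmod_R.
    assert (T := Rabs_triang euler_gamma (ln (INR (S m)))). rewrite (Rabs_pos_eq (ln _)) in T by lra.
    unfold G. nra. }
  assert (Cmod be * Cmod (Clog y + (euler_gamma + ln (INR (S m)))%R) <= Cmod be * (G * (INR m + 1)))%R
    by (apply Rmult_le_compat_l; auto). nra.
Qed.

Lemma qx_bound (y : C) (x x0 : R) (m : nat) : (0 < Re y)%R -> (0 < x0 <= x)%R ->
  (Cmod (qx y x m) <= exp (- (x0 * Re y)) ^ S m)%R.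
Proof.
  intros Hy Hx. unfold qx. rewrite Cmod_pow, Cmod_Cexp. apply pow_incr. split.
  left; apply exp_pos. creim. apply exp_le_compat. nra.
Qed.

Lemma exp_neg_lt_1 (x : R) : (0 < x)%R -> (0 <= exp (- x) < 1)%R.
Proof. intros H. split. left; apply exp_pos. rewrite <- exp_0. apply exp_increasing. lra. Qed.

Lemma rho_qx_bound (al be y : C) (x0 : R) : (0 < Re y)%R -> (0 < x0)%R ->
  exists b, summable b /\ forall x m, (x0 <= x)%R -> (Cmod (rho al be y m * qx y x m) <= b m)%R.
Proof.
  intros Hy Hx. destruct (rho_bound al be y) as [B [HB HR]].
  set (r := exp (- (x0 * Re y))).
  assert (Hr : (0 <= r < 1)%R) by (apply exp_neg_lt_1; nra).
  exists (fun m => B * ((INR m + 1) * r ^ m))%R. split. apply summable_scal; auto. now apply summable_geom.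
  intros x m Hxx. rewrite Cmod_mult, <- Rmult_assoc. apply Rmult_le_compat; try apply Cmod_ge_0. apply HR.
  eapply Rle_trans. apply qx_bound with (x0 := x0); auto. fold r. simpl.
  assert (0 <= r ^ m)%R by (apply pow_le; lra). nra.
Qed.

Lemma el_diff_bound (al be a : C) (x : R) : (0 < Im a)%R -> (0 < x)%R -> exists B, (0 <= B)%R /\
  forall k o u v, off a k o -> (0 <= u <= 1)%R -> (0 <= v <= 1)%R ->
    (Cmod (el al be (RtoC (x + u) + o) - el al be (RtoC (x + v) + o)) <= B * pw (3 / 2) k)%R.
Proof.
  intros Ha Hx. destruct (off_bound a Ha) as [kp [Hkp Hoff]].
  (* For [k >= 1] one has [k >= (k + 1) / 2]; for [k = 0] the abscissa [x] alone keeps the point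
     away from 0. *)
  set (c := (kp * Rmin x (1 / 2))%R).
  assert (Hm : (0 < Rmin x (1 / 2))%R) by (apply Rmin_glb_lt; lra).
  assert (Hc : (0 < c)%R) by (unfold c; nra).
  destruct (el1_bound c al be Hc) as [B [HB Hel]].
  exists (B * Rpower c (- (3 / 2)))%R. split. { apply Rmult_le_pos; auto. left; apply Rpower_pos. }
  intros k o u v Ho Hu Hv.
  assert (Hlow : forall w, (0 <= w <= 1)%R -> (c * (INR k + 1) <= Cmod (RtoC (x + w) + o))%R).
  { intros w Hw. eapply Rle_trans. 2: apply Hoff with (k := k); auto; lra. unfold c. rewrite Rmult_assoc.
    apply Rmult_le_compat_l. lra. assert (M1 := Rmin_l x (1 / 2)). assert (M2 := Rmin_r x (1 / 2)).
    destruct k. simpl. lra. rewrite S_INR. assert (K := INR_ge_0 k). nra. }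
  assert (Hk := INR_ge_0 k).
  assert (T := mean_value (fun t => el al be (RtoC (x + v) + o + RtoC t * RtoC (u - v)))
    (fun t => RtoC (u - v) * el1 al be (RtoC (x + v) + o + RtoC t * RtoC (u - v))) 0 1
    (B * Rpower c (- (3 / 2)) * pw (3 / 2) k)).
  cbv beta in T. rewrite Rminus_0_r, Rmult_1_r in T.
  replace (RtoC (x + v) + o + 1 * RtoC (u - v)) with (RtoC (x + u) + o) in T.
  2: { rewrite !RtoC_plus, RtoC_minus. ring. }
  replace (RtoC (x + v) + o + 0 * RtoC (u - v)) with (RtoC (x + v) + o) in T by ring.
  assert (Hw : forall t, RtoC (x + v) + o + RtoC t * RtoC (u - v) = RtoC (x + (v + t * (u - v))) + o).
  { intros t. rewrite !RtoC_plus, RtoC_mult, RtoC_minus. ring. }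
  assert (Hwt : forall t, (0 <= t <= 1)%R -> (0 <= v + t * (u - v) <= 1)%R) by (intros; nra).
  assert (Hs : forall t, (0 <= t <= 1)%R -> slit (RtoC (x + v) + o + RtoC t * RtoC (u - v))).
  { intros t Ht. rewrite Hw. apply off_slit with (a := a) (k := k); auto. left. specialize (Hwt t Ht). lra. }
  apply T. lra.
  - intros t Ht. apply Dc_el; auto. apply Dc_line.
  - intros t Ht. rewrite Cmod_mult, Cmod_R.
    assert (L := Hlow _ (Hwt t Ht)). rewrite <- Hw in L.
    assert (He := Hel _ (Hs t Ht)). assert (L1 : (c <= Cmod (RtoC (x + v) + o + RtoC t * RtoC (u - v)))%R) by nra.
    specialize (He L1).
    assert (He2 : (Rpower (Cmod (RtoC (x + v) + o + RtoC t * RtoC (u - v))) (- (3 / 2)) <=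
       Rpower c (- (3 / 2)) * pw (3 / 2) k)%R).
    { unfold pw. rewrite Rpower_mult_distr by lra. apply Rpower_le_neg; try lra. split; nra. }
    assert (Ha1 : (Rabs (u - v) <= 1)%R) by (apply Rabs_le; lra).
    assert (Hp := Rpower_pos (Cmod (RtoC (x + v) + o + RtoC t * RtoC (u - v))) (- (3 / 2))).
    assert (Hp2 := Rabs_pos (u - v)).
    apply Rle_trans with (1 * (B * (Rpower c (- (3 / 2)) * pw (3 / 2) k)))%R; [|lra].
    apply Rmult_le_compat; auto. apply Cmod_ge_0. eapply Rle_trans. exact He. apply Rmult_le_compat_l; auto.
Qed.

(** * Trapezoidal defects summed over the period lattice *)

(** The Lipschitz formula integrated over [u] in [[0, 1]], with [x + u] compared to [x] and to
    [x + 1] with weights one half. On the left the integral is the defect; on the right [qx]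
    integrates to a quotient of differences by [m + 1]. *)
Lemma tau_zsum (al be y : C) (x : R) : (0 < Re y)%R -> (0 < x)%R ->
  exists X, cser (pairz (per y) (fun o => tau al be (x + o))) X /\
    cser (fun m => rho al be y m * ((qx y x m - qx y (x + 1) m) / INR (S m) -
       y / 2 * (qx y x m + qx y (x + 1) m))) X.
Proof.
  intros Hy Hx. assert (Ha := per_Im y Hy). set (a := per y) in *.
  destruct (el_diff_bound al be a x Ha Hx) as [B [HB Hel]].
  destruct (rho_qx_bound al be y x Hy Hx) as [b [Hb Hrq]].
  (* The half sum of the differences from [x + u] to [x] and to [x + 1]; only such differences are
     summable in [k]. [F] and [G] are the primitives in [u] of [f] and [g]. *)
  set (f := fun k u => pairz a (fun o => el al be (RtoC (x + u) + o) -
       1 / 2 * (el al be (x + o) + el al be (RtoC (x + 1) + o))) k).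
  set (F := fun k u => pairz a (fun o => eA al be (x + o + RtoC u) -
       RtoC u * (1 / 2 * (el al be (x + o) + el al be (RtoC (x + 1) + o)))) k).
  set (g := fun m u => y * rho al be y m * (qx y (x + u) m - 1 / 2 * (qx y x m + qx y (x + 1) m))).
  set (G := fun m u => rho al be y m * (- (1 / INR (S m)) * Cexp (- (INR (S m) * x * y) + RtoC u * (- (INR (S m) * y)))
       - RtoC u * (y / 2 * (qx y x m + qx y (x + 1) m)))).
  assert (HG0 : forall m u, Cexp (- (INR (S m) * x * y) + RtoC u * (- (INR (S m) * y))) = qx y (x + u) m).
  { intros m u. unfold qx. rewrite <- Cexp_pow. f_equal. rewrite RtoC_plus. ring. }
  destruct (series_integration F f G g (fun t => CSeries (fun k => f k t))
    (fun k => 2 * (2 * (B * pw (3 / 2) k)))%R (fun m => Cmod y * (2 * b m))%R) as [X [H1 H2]].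
  - do 2 (apply summable_scal; [lra|]). apply summable_scal; auto. apply summable_pw. lra.
  - apply summable_scal. apply Cmod_ge_0. apply summable_scal; auto. lra.
  - intros k t Ht. split.
    + unfold F, f. apply (Dc_pairz a (fun u o => eA al be (x + o + RtoC u) -
       RtoC u * (1 / 2 * (el al be (x + o) + el al be (RtoC (x + 1) + o)))) (fun u o => el al be (RtoC (x + u) + o) -
       1 / 2 * (el al be (x + o) + el al be (RtoC (x + 1) + o)))).
      intros o Ho. assert (E : x + o + RtoC t = RtoC (x + t) + o) by (rewrite RtoC_plus; ring).
      eapply Dc_eq. apply Dc_minus. apply Dc_eA. 
      rewrite E. apply off_slit with (a := a) (k := k); auto. left; lra.
      apply Dc_plus. apply Dc_const. apply Dc_id. apply Dc_mult. apply Dc_id. apply Dc_const.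
      cbv beta. rewrite E. ring.
    + apply pairz_off_bound. intros o Ho.
      assert (E1 := Hel k o t 0%R Ho Ht). assert (E2 := Hel k o t 1%R Ho Ht).
      rewrite Rplus_0_r in E1.
      replace (el al be (RtoC (x + t) + o) - 1 / 2 * (el al be (x + o) + el al be (RtoC (x + 1) + o))) with
        (1 / 2 * (el al be (RtoC (x + t) + o) - el al be (x + o)) + 
         1 / 2 * (el al be (RtoC (x + t) + o) - el al be (RtoC (x + 1) + o))) by field.
      eapply Rle_trans. apply Cmod_triangle. rewrite !Cmod_mult.
      assert (E3 : Cmod (1 / 2) = (1 / 2)%R).
      { rewrite <- RtoC_div by lra. rewrite Cmod_R, Rabs_pos_eq; lra. }
      rewrite E3.
      assert (E1' : (Cmod (el al be (RtoC (x + t) + o) - el al be (x + o)) <= B * pw (3 / 2) k)%R) by (apply E1; lra).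
      assert (E2' : (Cmod (el al be (RtoC (x + t) + o) - el al be (RtoC (x + 1) + o)) <= B * pw (3 / 2) k)%R) by (apply E2; lra).
      assert (P := Cmod_ge_0 (el al be (RtoC (x + t) + o) - el al be (x + o))). lra.
  - intros m t Ht. assert (Hm := INR_S_neq_0 m). split.
    + unfold G, g. eapply Dc_eq. apply Dc_scal. apply Dc_minus. apply Dc_scal. apply Dc_Cexp.
      apply Dc_line. apply Dc_mult. apply Dc_id. apply Dc_const. cbv beta. rewrite HG0. field. auto.
    + unfold g. 
      replace (y * rho al be y m * (qx y (x + t) m - 1 / 2 * (qx y x m + qx y (x + 1) m))) with
        (y * (rho al be y m * qx y (x + t) m - 1 / 2 * (rho al be y m * qx y x m) -
             1 / 2 * (rho al be y m * qx y (x + 1) m))) by field.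
      rewrite Cmod_mult. apply Rmult_le_compat_l. apply Cmod_ge_0.
      eapply Rle_trans. apply Cmod_triangle_minus.
      assert (E0 := Cmod_triangle_minus (rho al be y m * qx y (x + t) m) (1 / 2 * (rho al be y m * qx y x m))).
      rewrite !(Cmod_mult (1 / 2)) in *.
      assert (E3 : Cmod (1 / 2) = (1 / 2)%R).
      { rewrite <- RtoC_div by lra. rewrite Cmod_R, Rabs_pos_eq; lra. }
      rewrite E3 in *.
      assert (K1 := Hrq (x + t)%R m). assert (K2 := Hrq x m). assert (K3 := Hrq (x + 1)%R m).
      assert (K1' : (Cmod (rho al be y m * qx y (x + t) m) <= b m)%R) by (apply K1; lra).
      assert (K2' : (Cmod (rho al be y m * qx y x m) <= b m)%R) by (apply K2; lra).
      assert (K3' : (Cmod (rho al be y m * qx y (x + 1) m) <= b m)%R) by (apply K3; lra).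
      lra.
  - intros t Ht. assert (Hxt : (0 < x + t)%R) by lra. assert (Hx1 : (0 < x + 1)%R) by lra.
    destruct (lipschitz_unscaled al be y (x + t) x Hy Hxt Hx) as [L1 [A1 A2]].
    destruct (lipschitz_unscaled al be y (x + t) (x + 1) Hy Hxt Hx1) as [L2 [A3 A4]].
    assert (S1 : cser (fun k => f k t) (1 / 2 * L1 + 1 / 2 * L2)).
    { eapply cser_ext. 2: apply cser_plus; apply cser_scal; [exact A1|exact A3].
      intros k. cbv beta. rewrite <- !pairz_scal, <- pairz_plus. unfold f. fold a. apply pairz_ext.
      intros o. field. }
    rewrite (CSeries_cser _ _ S1). split; auto.
    eapply cser_ext. 2: apply cser_plus; apply cser_scal; [exact A2|exact A4].
    intros m. cbv beta. unfold g. field.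
  - exists X. split.
    + eapply cser_ext. 2: exact H1. intros k. cbv beta. unfold F. rewrite <- pairz_minus. apply pairz_ext.
      intros o. unfold tau. replace (x + o + 0) with (x + o) by ring. 
      replace (RtoC (x + 1) + o) with (x + o + 1) by (rewrite RtoC_plus; ring). ring.
    + eapply cser_ext. 2: exact H2. intros m. cbv beta. unfold G. rewrite !HG0, Rplus_0_r. field.
      apply INR_S_neq_0.
Qed.

Lemma tau_off_bound (al be a : C) : (0 < Im a)%R -> exists B, (0 <= B)%R /\
  forall k o x, off a (S k) o -> (0 <= x)%R ->
    slit (x + o) /\ (Cmod (tau al be (x + o)) <= B * Rpower (x + (INR k + 1)) (- (5 / 2)))%R.
Proof.
  intros Ha. destruct (off_bound a Ha) as [kp [Hkp Hoff]].
  destruct (el2_bound kp al be Hkp) as [B [HB Hel]].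
  exists (B * Rpower kp (- (5 / 2)))%R. split. { apply Rmult_le_pos; auto. left; apply Rpower_pos. }
  intros k o x Ho Hx. assert (Hk := INR_ge_0 k).
  assert (Hsl : forall u, (0 <= u)%R -> slit (RtoC (x + u) + o)).
  { intros u Hu. apply off_slit with (a := a) (k := S k); auto. right. split. lra. lia. }
  split. { specialize (Hsl 0%R). rewrite Rplus_0_r in Hsl. apply Hsl. lra. }
  apply tau_bound. intros u Hu.
  replace (x + o + RtoC u) with (RtoC (x + u) + o) by (rewrite RtoC_plus; ring).
  split. apply Hsl; lra.
  assert (L := Hoff (S k) o (x + u)%R Ho). rewrite S_INR in L.
  assert (L1 : (kp * (x + u + (INR k + 1)) <= Cmod (RtoC (x + u) + o))%R) by (apply L; lra).
  eapply Rle_trans. apply Hel. apply Hsl; lra. nra. rewrite Rmult_assoc.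
  apply Rmult_le_compat_l; auto. rewrite Rpower_mult_distr by lra.
  apply Rpower_le_neg; try lra. split; nra.
Qed.

(** [(x + k) ^ 2 >= (x + 1) k], raised to the power [- 5 / 4]. Both factors have exponent above 1,
    as the exchange of summations requires. *)
Lemma Rpower_product_bound (x k : R) : (0 <= x)%R -> (1 <= k)%R ->
  (Rpower (x + k) (- (5 / 2)) <= Rpower (x + 1) (- (5 / 4)) * Rpower k (- (5 / 4)))%R.
Proof.
  intros Hx Hk. rewrite Rpower_mult_distr by lra.
  replace (- (5 / 2))%R with (2 * - (5 / 4))%R by field. rewrite <- Rpower_mult.
  apply Rpower_le_neg; try lra. split. nra.
  replace 2%R with (1 + 1)%R by ring. rewrite Rpower_plus, Rpower_1 by lra. nra.
Qed.

(* Indexed from [k = 0], which stands for the offsets [a] and [- a]. *)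
Definition tz (al be a : C) (x : R) (k : nat) : C := pairz a (fun o => tau al be (x + o)) (S k).

Lemma tz_bound (al be a : C) : (0 < Im a)%R -> exists B, (0 <= B)%R /\
  forall x k, (0 <= x)%R -> (Cmod (tz al be a x k) <= B * Rpower (x + 1) (- (5 / 4)) * pw (5 / 4) k)%R.
Proof.
  intros Ha. destruct (tau_off_bound al be a Ha) as [B [HB Ht]].
  exists (2 * B)%R. split. lra. intros x k Hx. unfold tz.
  replace (2 * B * Rpower (x + 1) (- (5 / 4)) * pw (5 / 4) k)%R with
    (2 * (B * (Rpower (x + 1) (- (5 / 4)) * pw (5 / 4) k)))%R by ring.
  apply pairz_off_bound. intros o Ho. destruct (Ht k o x Ho Hx) as [_ T].
  eapply Rle_trans. exact T. apply Rmult_le_compat_l; auto. unfold pw.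
  apply Rpower_product_bound; auto. assert (K := INR_ge_0 k). lra.
Qed.

Lemma Clim_tau (al be : C) (u : nat -> C) (l : C) : slit l -> slit (l + 1) -> Clim u l ->
  Clim (fun n => tau al be (u n)) (tau al be l).
Proof.
  intros Hl Hl1 Hu. assert (Hu1 : Clim (fun n => u n + 1) (l + 1)).
  { apply Clim_plus; auto. apply Clim_const. }
  unfold tau. apply Clim_minus. apply Clim_minus; apply Clim_eA; auto.
  apply Clim_scal. apply Clim_plus; apply Clim_el; auto.
Qed.

Lemma tz_lim (al be a : C) (x : nat -> R) (k : nat) : (0 < Im a)%R -> is_lim_seq x 0%R ->
  Clim (fun j => tz al be a (x j) k) (tz al be a 0 k).
Proof.
  intros Ha Hx. unfold tz. apply (pairz_off_lim a (fun j o => tau al be (x j + o)) (fun o => tau al be (RtoC 0 + o))).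
  intros o Ho. apply Clim_tau.
  - apply off_slit with (a := a) (k := S k); auto. right. split. lra. lia.
  - replace (RtoC 0 + o + 1) with (RtoC 1 + o) by ring. apply off_slit with (a := a) (k := S k); auto. left. lra.
  - apply Clim_plus. now apply Clim_RtoC. apply Clim_const.
Qed.

(** * The exponential series of the Lipschitz formula *)

(** [Fs] is the series attached to the abscissa [x], and [- Qs] is its termwise primitive; they
    stand to each other as [el] to [eA]. *)
Definition Qs (al be y : C) (x : R) : C := CSeries (fun m => rho al be y m * qx y x m / INR (S m)).
Definition Fs (al be y : C) (x : R) : C := CSeries (fun m => y * (rho al be y m * qx y x m)).

Lemma Cmod_div_S_le (z : C) (m : nat) : (Cmod (z / INR (S m)) <= Cmod z)%R.
Proof.
  rewrite Cmod_div by apply INR_S_neq_0. assert (H := INR_S_pos m).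
  rewrite Cmod_R, Rabs_pos_eq by lra. rewrite <- (Rmult_1_r (Cmod z)) at 2.
  apply Rmult_le_compat_l. apply Cmod_ge_0. apply Rle_trans with (/ 1)%R; [|lra].
  apply Rinv_le_contravar. lra. rewrite S_INR. assert (K := INR_ge_0 m). lra.
Qed.

Lemma Qs_cser (al be y : C) (x : R) : (0 < Re y)%R -> (0 < x)%R ->
  cser (fun m => rho al be y m * qx y x m / INR (S m)) (Qs al be y x).
Proof.
  intros Hy Hx. destruct (rho_qx_bound al be y x Hy Hx) as [b [Hb H]].
  destruct (cser_abs (fun m => rho al be y m * qx y x m / INR (S m)) b) as [l Hl]; auto.
  { intros m. eapply Rle_trans. apply Cmod_div_S_le. apply H. lra. }
  unfold Qs. now rewrite (CSeries_cser _ _ Hl).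
Qed.

Lemma Fs_cser (al be y : C) (x : R) : (0 < Re y)%R -> (0 < x)%R ->
  cser (fun m => y * (rho al be y m * qx y x m)) (Fs al be y x).
Proof.
  intros Hy Hx. destruct (rho_qx_bound al be y x Hy Hx) as [b [Hb H]].
  destruct (cser_abs (fun m => rho al be y m * qx y x m) b) as [l Hl]; auto.
  { intros m. apply H. lra. }
  unfold Fs. apply cser_scal with (c := y) in Hl. now rewrite (CSeries_cser _ _ Hl).
Qed.

Lemma Clim_qx (y : C) (x : nat -> R) (x0 : R) (m : nat) : is_lim_seq x x0 ->
  Clim (fun j => qx y (x j) m) (qx y x0 m).
Proof.
  intros Hx. unfold qx. apply Clim_ext with (fun j => Cexp (INR (S m) * - (x j * y))).
  { intros. apply Cexp_pow. } rewrite <- Cexp_pow. apply Clim_Cexp. apply Clim_scal, Clim_opp.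
  apply Clim_mult. now apply Clim_RtoC. apply Clim_const.
Qed.

Lemma Qs_Fs_lim (al be y : C) (x : nat -> R) (x0 : R) : (0 < Re y)%R -> (0 < x0)%R ->
  (forall j, (x0 <= x j)%R) -> is_lim_seq x x0 ->
  Clim (fun j => Qs al be y (x j)) (Qs al be y x0) /\ Clim (fun j => Fs al be y (x j)) (Fs al be y x0).
Proof.
  intros Hy Hx0 Hge Hx. destruct (rho_qx_bound al be y x0 Hy Hx0) as [b [Hb H]]. split.
  - destruct (tannery_series (fun j m => rho al be y m * qx y (x j) m / INR (S m))
      (fun j => Qs al be y (x j)) (fun m => rho al be y m * qx y x0 m / INR (S m)) b) as [G [H1 H2]]; auto.
    + intros j. apply Qs_cser; auto. specialize (Hge j); lra.
    + intros j m. eapply Rle_trans. apply Cmod_div_S_le. auto.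
    + intros m. unfold Cdiv. apply Clim_mult. apply Clim_scal. now apply Clim_qx. apply Clim_const.
    + now rewrite (cser_unique _ _ _ (Qs_cser al be y x0 Hy Hx0) H1).
  - destruct (tannery_series (fun j m => y * (rho al be y m * qx y (x j) m))
      (fun j => Fs al be y (x j)) (fun m => y * (rho al be y m * qx y x0 m)) (fun m => Cmod y * b m)%R) as [G [H1 H2]].
    + apply summable_scal; auto. apply Cmod_ge_0.
    + intros j. apply Fs_cser; auto. specialize (Hge j); lra.
    + intros j m. rewrite Cmod_mult. apply Rmult_le_compat_l. apply Cmod_ge_0. auto.
    + intros m. apply Clim_scal, Clim_scal. now apply Clim_qx.
    + now rewrite (cser_unique _ _ _ (Fs_cser al be y x0 Hy Hx0) H1).
Qed.

Lemma Qs_Fs_infty (al be y : C) : (0 < Re y)%R ->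
  Clim (fun j => Qs al be y (INR (S j))) 0 /\ Clim (fun j => Fs al be y (INR (S j))) 0.
Proof.
  intros Hy. destruct (rho_qx_bound al be y 1 Hy) as [b [Hb H]]. lra.
  assert (Hge : forall j, (1 <= INR (S j))%R). { intros j. rewrite S_INR. assert (K := INR_ge_0 j). lra. }
  assert (Hq : forall m, Clim (fun j => qx y (INR (S j)) m) 0).
  { intros m. apply Clim_ext with (fun j => ((Cexp (- (INR (S m) * y))) ^ S j)%C).
    { intros j. unfold qx. rewrite <- !Cexp_pow. f_equal. ring. }
    apply (Clim_incr_1 (fun j => (Cexp (- (INR (S m) * y))) ^ j)%C). apply Clim_pow_0, Cexp_lt_1.
    creim. assert (K := INR_S_pos m). nra. }
  split.
  - destruct (tannery_series (fun j m => rho al be y m * qx y (INR (S j)) m / INR (S m))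
      (fun j => Qs al be y (INR (S j))) (fun m => 0) b) as [G [H1 H2]]; auto.
    + intros j. apply Qs_cser; auto. apply INR_S_pos.
    + intros j m. eapply Rle_trans. apply Cmod_div_S_le. auto.
    + intros m. replace (RtoC 0) with (rho al be y m * 0 * / INR (S m)) by ring.
      unfold Cdiv. apply Clim_mult. apply Clim_scal, Hq. apply Clim_const.
    + now rewrite (cser_unique _ _ _ cser_zero H1).
  - destruct (tannery_series (fun j m => y * (rho al be y m * qx y (INR (S j)) m))
      (fun j => Fs al be y (INR (S j))) (fun m => 0) (fun m => Cmod y * b m)%R) as [G [H1 H2]].
    + apply summable_scal; auto. apply Cmod_ge_0.
    + intros j. apply Fs_cser; auto. apply INR_S_pos.
    + intros j m. rewrite Cmod_mult. apply Rmult_le_compat_l. apply Cmod_ge_0. auto.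
    + intros m. replace (RtoC 0) with (y * (rho al be y m * 0)) by ring. apply Clim_scal, Clim_scal, Hq.
    + now rewrite (cser_unique _ _ _ cser_zero H1).
Qed.

Definition inv_S (j : nat) : R := (/ INR (S j))%R.

Lemma inv_S_pos (j : nat) : (0 < inv_S j)%R.
Proof. apply Rinv_0_lt_compat, INR_S_pos. Qed.

Lemma inv_S_lim : is_lim_seq inv_S 0%R.
Proof.
  apply is_lim_seq_ext with (pw 1). 2: apply pw_lim; lra.
  intros n. unfold pw, inv_S. rewrite Rpower_Ropp, Rpower_1, S_INR; auto. assert (K := INR_ge_0 n). lra.
Qed.

(** * Exchange of the summations over the lattice *)

Lemma tz_sum (al be y : C) (x : R) : (0 < Re y)%R -> (0 < x)%R ->
  cser (tz al be (per y) x) (Qs al be y x - Qs al be y (x + 1) -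
     1 / 2 * (Fs al be y x + Fs al be y (x + 1)) - tau al be x).
Proof.
  intros Hy Hx. assert (Hx1 : (0 < x + 1)%R) by lra.
  destruct (tau_zsum al be y x Hy Hx) as [X [H1 H2]].
  assert (E : X = Qs al be y x - Qs al be y (x + 1) - 1 / 2 * (Fs al be y x + Fs al be y (x + 1))).
  { eapply cser_unique. exact H2. eapply cser_ext.
    2: { apply cser_minus. apply cser_minus; apply Qs_cser; auto.
         apply cser_scal. apply cser_plus; apply Fs_cser; auto. }
    intros m. cbv beta. field. apply INR_S_neq_0. }
  rewrite <- E. apply cser_first in H1. unfold pairz at 2 in H1. 
  replace (x + 0) with (RtoC x) in H1 by ring. exact H1.
Qed.

Lemma tau_nat_bound (al be : C) : exists B, (0 <= B)%R /\
  forall n, (Cmod (tau al be (INR (S n))) <= B * pw (5 / 2) n)%R.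
Proof.
  destruct (el2_bound 1 al be) as [B [HB H]]. lra.
  exists B. split; auto.
  intros n. assert (P := INR_S_pos n). assert (K := INR_ge_0 n). apply tau_bound. intros u Hu.
  rewrite <- RtoC_plus. split. { apply slit_R. lra. }
  assert (E : Cmod (RtoC (INR (S n) + u)) = (INR (S n) + u)%R) by (rewrite Cmod_R, Rabs_pos_eq; lra).
  eapply Rle_trans. apply H. { apply slit_R. lra. } { rewrite E, S_INR. lra. }
  rewrite E. apply Rmult_le_compat_l; auto. unfold pw. apply Rpower_le_neg; try lra. rewrite S_INR. lra.
Qed.

Lemma el_nat_lim (al be : C) : Clim (fun n => el al be (INR (S n))) 0.
Proof.
  destruct (el_bound 1 al be) as [B1 [HB1 Hl1]]. lra.
  apply Clim_squeeze with (fun n => B1 * pw (1 / 2) n)%R O. 2: apply is_lim_seq_0_scal, pw_lim; lra.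
  intros n _. replace (el al be (INR (S n)) - 0) with (el al be (INR (S n))) by ring.
  assert (P := INR_S_pos n). assert (K := INR_ge_0 n).
  assert (Hh := Hl1 (RtoC (INR (S n)))). rewrite !(Cmod_R (INR (S n))), !(Rabs_pos_eq (INR (S n))) in * by lra.
  unfold pw. rewrite <- S_INR. apply Hh. now apply slit_R. rewrite S_INR; lra.
Qed.

Lemma csum_trapezoid (Q F : nat -> C) (n : nat) :
  csum (fun j => Q j - Q (S j) - 1 / 2 * (F j + F (S j))) n =
  Q O - Q n - csum F n + 1 / 2 * F O - 1 / 2 * F n.
Proof. induction n. simpl. field. rewrite !csum_S, IHn. field. Qed.

(** [V k] is the sum of a column. The rows [n >= 1] telescope into trapezoidal sums of [Fs] and
    [el], whose limits are given by [FF] and [ci]. [Z] gathers the four quantities singular at 0,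
    which have a joint limit although not each has one. *)
Lemma lattice_sum (al be y Z FF ci : C) (V : nat -> C) : (0 < Re y)%R ->
  Clim (fun j => Qs al be y (inv_S j) + eA al be (inv_S j) -
     1 / 2 * (Fs al be y (inv_S j) - el al be (inv_S j))) Z ->
  cser (fun n => Fs al be y (INR (S n))) FF ->
  Clim (fun n => csum (fun j => el al be (INR (S j))) n - eA al be (INR (S n))) ci ->
  (forall k, cser (fun n => tz al be (per y) (INR n) k) (V k)) ->
  cser V (Z - FF + ci).
Proof.
  intros Hy HZ HF Hci HV. assert (Ha := per_Im y Hy). set (a := per y) in *.
  destruct (tz_bound al be a Ha) as [B [HB Hb]].
  assert (Hs1 : slit 1) by (left; simpl; lra).
  (* [Fs] and [el] are singular at 0, so the row of index 0 is obtained as a limit from the right *)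
  destruct (tannery_series (fun j k => tz al be a (inv_S j) k)
    (fun j => Qs al be y (inv_S j) - Qs al be y (inv_S j + 1) -
     1 / 2 * (Fs al be y (inv_S j) + Fs al be y (inv_S j + 1)) - tau al be (inv_S j))
    (fun k => tz al be a 0 k) (fun k => B * pw (5 / 4) k)%R) as [T0 [HT0 HT0l]].
  { apply summable_scal; auto. apply summable_pw. lra. }
  { intros j. apply tz_sum; auto. apply inv_S_pos. }
  { intros j k. assert (P := inv_S_pos j). eapply Rle_trans. apply Hb. lra.
    assert (R1 : (Rpower (inv_S j + 1) (- (5 / 4)) <= 1)%R).
    { apply Rle_trans with (Rpower 1 (- (5 / 4))). apply Rpower_le_neg; lra.
      unfold Rpower. rewrite ln_1, Rmult_0_r, exp_0. lra. }
    assert (P2 := pw_pos (5 / 4) k). apply Rmult_le_compat_r. lra. nra. }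
  { intros k. apply tz_lim; auto. apply inv_S_lim. }
  assert (ET0 : T0 = Z - Qs al be y 1 - 1 / 2 * Fs al be y 1 - eA al be 1 + 1 / 2 * el al be 1).
  { eapply Clim_unique. exact HT0l.
    assert (Hx1 : is_lim_seq (fun j => inv_S j + 1)%R 1%R).
    { replace (Finite 1%R) with (Finite (0 + 1)%R) by (f_equal; ring).
      apply is_lim_seq_plus'. apply inv_S_lim. apply is_lim_seq_const. }
    destruct (Qs_Fs_lim al be y (fun j => inv_S j + 1)%R 1 Hy) as [L1 L2]; auto. lra.
    { intros j. assert (P := inv_S_pos j). lra. }
    assert (Hx1c : Clim (fun j => RtoC (inv_S j + 1)) 1) by (now apply Clim_RtoC).
    assert (L3 := Clim_eA al be _ _ Hs1 Hx1c). assert (L4 := Clim_el al be _ _ Hs1 Hx1c).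
    eapply Clim_ext.
    2: { apply Clim_plus; [apply Clim_minus; [apply Clim_minus; [apply Clim_minus; [exact HZ|exact L1]|
          apply (Clim_scal (1 / 2)); exact L2]|exact L3]|apply (Clim_scal (1 / 2)); exact L4]. }
    intros j. cbv beta. unfold tau. rewrite <- RtoC_plus. field. }
  set (T := fun n => match n with O => T0 | S j => Qs al be y (INR (S j)) - Qs al be y (INR (S j) + 1) -
     1 / 2 * (Fs al be y (INR (S j)) + Fs al be y (INR (S j) + 1)) - tau al be (INR (S j)) end).
  assert (HT : forall n, cser (fun k => tz al be a (INR n) k) (T n)).
  { intros [|j]. exact HT0. apply tz_sum; auto. apply INR_S_pos. }
  destruct (cser_fubini (fun n k => tz al be a (INR n) k) (fun n => B * pw (5 / 4) n)%R (pw (5 / 4)) T V)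
    as [S0 [HS1 HS2]]; auto.
  { apply summable_scal; auto. apply summable_pw. lra. }
  { apply summable_pw. lra. }
  { intros n k. apply Hb. apply INR_ge_0. }
  replace (Z - FF + ci) with S0; auto.
  apply cser_first in HS1. change (T O) with T0 in HS1.
  (* The boundary terms at 1 left by the rows [n >= 1] are the opposites of those in [ET0], so they
     cancel in the total. The explicit zeros are the limits at infinity of [Qs], [Fs] and [el]. *)
  enough (EL : S0 - T0 = Qs al be y 1 - 0 - FF + 1 / 2 * Fs al be y 1 - 1 / 2 * 0 + (ci + eA al be 1 - 1 / 2 * el al be 1 + 1 / 2 * 0)).
  { rewrite ET0 in EL. 
    replace S0 with ((S0 - (Z - Qs al be y 1 - 1 / 2 * Fs al be y 1 - eA al be 1 + 1 / 2 * el al be 1)) +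
       (Z - Qs al be y 1 - 1 / 2 * Fs al be y 1 - eA al be 1 + 1 / 2 * el al be 1)) by ring.
    rewrite EL. field. }
  eapply Clim_unique. exact HS1.
  destruct (Qs_Fs_infty al be y Hy) as [Q0 F0].
  assert (Hel0 := el_nat_lim al be).
  apply Clim_ext with (fun n => 
    (Qs al be y (INR 1) - Qs al be y (INR (S n)) - csum (fun j => Fs al be y (INR (S j))) n +
      1 / 2 * Fs al be y (INR 1) - 1 / 2 * Fs al be y (INR (S n))) +
    ((csum (fun j => el al be (INR (S j))) n - eA al be (INR (S n))) + eA al be (INR 1) -
      1 / 2 * el al be (INR 1) + 1 / 2 * el al be (INR (S n)))).
  { intros n. rewrite (csum_ext (fun k => T (S k)) (fun j => (Qs al be y (INR (S j)) - Qs al be y (INR (S (S j))) -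
      1 / 2 * (Fs al be y (INR (S j)) + Fs al be y (INR (S (S j))))) + 
      (eA al be (INR (S j)) - eA al be (INR (S (S j))) -
      1 / 2 * (- el al be (INR (S j)) + - el al be (INR (S (S j))))))).
    - rewrite csum_plus, (csum_trapezoid (fun j => Qs al be y (INR (S j))) (fun j => Fs al be y (INR (S j)))),
        (csum_trapezoid (fun j => eA al be (INR (S j))) (fun j => - el al be (INR (S j)))).
      rewrite (csum_ext (fun j => - el al be (INR (S j))) (fun j => (-1) * el al be (INR (S j)))) by (intros; ring).
      rewrite csum_scal. cbv beta. field.
    - intros j _. unfold T, tau. rewrite <- !RtoC_plus. rewrite (S_INR (S j)). field. }
  apply Clim_plus.
  - apply Clim_minus. apply Clim_plus. apply Clim_minus. apply Clim_minus.
    apply Clim_const. exact Q0. exact HF. apply Clim_const. now apply Clim_scal.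
  - apply Clim_plus. apply Clim_minus. apply Clim_plus. exact Hci. apply Clim_const. apply Clim_const.
    now apply Clim_scal.
Qed.

(** The Lambert series appears by exchanging the sums of [exp (- n m y)]: over [n] it is geometric,
    with sum [1 / (exp (m y) - 1)]. *)
Lemma Fs_double_sum (al be y : C) : (0 < Re y)%R -> exists FF,
  cser (fun n => Fs al be y (INR (S n))) FF /\
  cser (fun m => y * (rho al be y m / (Cexp (INR (S m) * y) - 1))) FF.
Proof.
  intros Hy. destruct (rho_bound al be y) as [B [HB HR]].
  set (r := exp (- (1 * Re y))).
  assert (Hr : (0 <= r < 1)%R) by (apply exp_neg_lt_1; lra).
  destruct (cser_fubini (fun n m => y * (rho al be y m * qx y (INR (S n)) m))
    (fun n => (INR n + 1) * r ^ n)%R (fun m => Cmod y * B * ((INR m + 1) * r ^ m))%R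
    (fun n => Fs al be y (INR (S n))) (fun m => y * (rho al be y m / (Cexp (INR (S m) * y) - 1))))
    as [FF [H1 H2]].
  - now apply summable_geom.
  - apply summable_scal. apply Rmult_le_pos; auto. apply Cmod_ge_0. now apply summable_geom.
  - intros n m. rewrite !Cmod_mult.
    assert (Hq : (Cmod (qx y (INR (S n)) m) <= r ^ n * r ^ m)%R).
    { assert (E : qx y (INR (S n)) m = (Cexp (- (1 * y)) ^ (S n * S m))%C).
      { unfold qx. rewrite <- !Cexp_pow, mult_INR, RtoC_mult. f_equal. ring. }
      rewrite E, Cmod_pow, Cmod_Cexp. creim. replace (- (1 * Re y - 0 * Im y))%R with (- (1 * Re y))%R by ring.
      (* Since [(n + 1) (m + 1) = n + m + (1 + n m)], the power of [r] is at most [r ^ n * r ^ m], a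
         product majorant. *)
      fold r. replace (S n * S m)%nat with (n + m + (1 + n * m))%nat by lia.
      rewrite !pow_add. assert (P1 : (0 <= r ^ n)%R) by (apply pow_le; lra).
      assert (P2 : (0 <= r ^ m)%R) by (apply pow_le; lra).
      assert (P3 : (r ^ 1 * r ^ (n * m) <= 1)%R).
      { assert (0 <= r ^ 1 <= 1)%R by (simpl; lra).
        assert (0 <= r ^ (n * m) <= 1)%R. { split. apply pow_le; lra. rewrite <- (pow1 (n * m)). apply pow_incr. lra. }
        nra. }
      assert (0 <= r ^ n * r ^ m)%R by nra. nra. }
    assert (Hn := INR_ge_0 n). assert (P1 : (0 <= r ^ n)%R) by (apply pow_le; lra).
    apply Rle_trans with (Cmod y * (B * (INR m + 1) * (r ^ n * r ^ m)))%R.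
    + apply Rmult_le_compat_l. apply Cmod_ge_0. apply Rmult_le_compat; auto; apply Cmod_ge_0.
    + assert (Hm := INR_ge_0 m). assert (P2 : (0 <= r ^ m)%R) by (apply pow_le; lra).
      assert (PP : (0 <= Cmod y * (B * (INR m + 1) * (r ^ n * r ^ m)))%R).
      { apply Rmult_le_pos. apply Cmod_ge_0. repeat apply Rmult_le_pos; lra. }
      replace ((INR n + 1) * r ^ n * (Cmod y * B * ((INR m + 1) * r ^ m)))%R with
        ((INR n + 1) * (Cmod y * (B * (INR m + 1) * (r ^ n * r ^ m))))%R by ring. nra.
  - intros n. apply Fs_cser; auto. apply INR_S_pos.
  - intros m. set (q := Cexp (- (INR (S m) * y))).
    assert (Hq : (Cmod q < 1)%R). { apply Cexp_lt_1. creim. assert (K := INR_S_pos m). nra. }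
    assert (Hq0 : q <> 0) by apply Cexp_neq_0.
    assert (H1q := slit_neq_0 _ (one_minus_slit q Hq)).
    assert (E : Cexp (INR (S m) * y) = / q).
    { unfold q. rewrite Cexp_opp. field. apply Cexp_neq_0. }
    rewrite E. replace (y * (rho al be y m / (/ q - 1))) with (y * rho al be y m * q * / (1 - q)).
    2: { field. repeat split; auto. }
    eapply cser_ext. 2: apply cser_scal; now apply cser_geom.
    intros n. cbv beta.
    assert (Eq : qx y (INR (S n)) m = (q * q ^ n)%C).
    { change (q * q ^ n)%C with (q ^ (S n))%C. unfold qx, q. rewrite <- !Cexp_pow. f_equal. ring. }
    rewrite Eq. ring.
  - exists FF. auto.
Qed.

(** * Remainders of shifted series *)

Lemma csum_tau (al be z : C) (n : nat) :
  csum (fun j => tau al be (INR j + z)) n =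
  eA al be (INR n + z) - eA al be z - csum (fun j => el al be (INR j + z)) n +
    1 / 2 * el al be z - 1 / 2 * el al be (INR n + z).
Proof.
  induction n. simpl. replace (0 + z) with z by ring. field.
  rewrite !csum_S, IHn. unfold tau. replace (INR n + z + 1) with (INR (S n) + z) by (rewrite S_INR, RtoC_plus; ring).
  field.
Qed.

Lemma cone_slit (z : C) (x t : R) : Im z <> 0%R -> (0 < x)%R -> (0 <= t)%R -> slit (x + t * z).
Proof.
  intros Hz Hx Ht. destruct (Req_dec t 0) as [->|Ht0].
  - left. creim. lra.
  - right. creim. replace (0 + (t * Im z + 0 * Re z))%R with (t * Im z)%R by ring.
    apply Rmult_integral_contrapositive_currified; auto.
Qed.

Lemma el_shift_lim (al be z : C) : Im z <> 0%R -> Clim (fun n => el al be (INR (S n) + z)) 0.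
Proof.
  intros Hz. destruct (cone_bound z Hz) as [k [Hk Hc]].
  destruct (el_bound k al be Hk) as [B [HB H]].
  apply Clim_squeeze with (fun n => (B * Rpower k (- (1 / 2))) * pw (1 / 2) n)%R O.
  2: apply is_lim_seq_0_scal, pw_lim; lra.
  intros n _. replace (el al be (INR (S n) + z) - 0) with (el al be (INR (S n) + 1 * z)).
  2: { replace (1 * z) with z by ring. ring. }
  assert (P := INR_S_pos n). assert (K := INR_ge_0 n).
  assert (L := Hc (INR (S n)) 1%R). 
  assert (L1 : (k * (INR n + 1) <= Cmod (INR (S n) + 1 * z))%R).
  { eapply Rle_trans. 2: apply L; lra. rewrite S_INR. nra. }
  eapply Rle_trans. apply H. apply cone_slit; auto; lra. nra.
  rewrite Rmult_assoc. apply Rmult_le_compat_l; auto. unfold pw. rewrite Rpower_mult_distr by lra.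
  apply Rpower_le_neg; try lra. split; nra.
Qed.

Lemma eA_shift_lim (al be z : C) : Im z <> 0%R ->
  Clim (fun n => eA al be (INR (S n) + z) - eA al be (INR (S n))) 0.
Proof.
  intros Hz. destruct (cone_bound z Hz) as [k [Hk Hc]].
  destruct (el_bound k al be Hk) as [B [HB H]].
  apply Clim_squeeze with (fun n => (Cmod z * (B * Rpower k (- (1 / 2)))) * pw (1 / 2) n)%R O.
  2: apply is_lim_seq_0_scal, pw_lim; lra.
  intros n _. assert (P := INR_S_pos n). assert (K := INR_ge_0 n).
  assert (T := mean_value (fun t => eA al be (INR (S n) + RtoC t * z))
    (fun t => z * el al be (INR (S n) + RtoC t * z)) 0 1 (Cmod z * (B * Rpower k (- (1 / 2))) * pw (1 / 2) n)).
  cbv beta in T. rewrite Rminus_0_r, Rmult_1_r in T.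
  replace (INR (S n) + 1 * z) with (INR (S n) + z) in T by ring.
  replace (INR (S n) + 0 * z) with (RtoC (INR (S n))) in T by ring.
  match goal with |- Rle (Cmod (Cminus ?x _)) _ => replace (Cminus x (RtoC 0)) with x by ring end.
  apply T. lra.
  - intros t Ht. apply Dc_eA. apply cone_slit; auto; lra. apply Dc_line.
  - intros t Ht. rewrite Cmod_mult, Rmult_assoc. apply Rmult_le_compat_l. apply Cmod_ge_0.
    assert (L1 : (k * (INR n + 1) <= Cmod (INR (S n) + t * z))%R).
    { eapply Rle_trans. 2: apply Hc; lra. rewrite S_INR. nra. }
    eapply Rle_trans. apply H. apply cone_slit; auto; lra. nra.
    rewrite Rmult_assoc. apply Rmult_le_compat_l; auto. unfold pw. rewrite Rpower_mult_distr by lra.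
    apply Rpower_le_neg; try lra. split; nra.
Qed.

(** The remainder of the expansion at infinity: what is left of [digamma z] after
    [log z - 1 / (2 z)] for [(1, 0)], and of [psi1 z] after [log z ^ 2 / 2 - log z / (2 z)] for
    [(0, 1)]. *)
Definition Wt (al be z : C) : C := CSeries (fun n => tau al be (INR n + z)).

Lemma Wt_cser (al be z : C) : Im z <> 0%R -> cser (fun n => tau al be (INR n + z)) (Wt al be z).
Proof.
  intros Hz.
  assert (H : exists B, (0 <= B)%R /\ forall n, (Cmod (tau al be (INR n + z)) <= B * pw (5 / 2) n)%R).
  (* The lattice generated by [z], or by [- z] when [Im z < 0], has [z] among its first offsets, so
     [tau_off_bound] applies with [k = 0]. *)
  { destruct (Rlt_dec 0 (Im z)) as [Hp|Hn].
    - destruct (tau_off_bound al be z Hp) as [B [HB H]]. exists B. split; auto.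
      intros n. destruct (H 0%nat z (INR n)) as [_ T]. left; simpl; ring. apply INR_ge_0.
      simpl INR in T. rewrite Rplus_0_l in T. exact T.
    - assert (Hp : (0 < Im (- z))%R) by (creim; lra).
      destruct (tau_off_bound al be (- z) Hp) as [B [HB H]]. exists B. split; auto.
      intros n. destruct (H 0%nat z (INR n)) as [_ T]. right; simpl; ring. apply INR_ge_0.
      simpl INR in T. rewrite Rplus_0_l in T. exact T. }
  destruct H as [B [HB H]].
  destruct (cser_abs (fun n => tau al be (INR n + z)) (fun n => B * pw (5 / 2) n)%R) as [l Hl]; auto.
  { apply summable_scal; auto. apply summable_pw. lra. }
  unfold Wt. now rewrite (CSeries_cser _ _ Hl).
Qed.

(** [csum_tau] solved for the sum of [el] at [j + z]. That sum starts at [j = 0]; removing its first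
    term turns [1 / 2 * el z] into [- 1 / 2 * el z]. *)
Lemma el_series (al be z ci : C) : Im z <> 0%R ->
  Clim (fun n => csum (fun j => el al be (INR (S j))) n - eA al be (INR (S n))) ci ->
  cser (fun j => el al be (INR (S j) + z) - el al be (INR (S j)))
    (- eA al be z - 1 / 2 * el al be z - Wt al be z - ci).
Proof.
  intros Hz Hci. assert (HW := Wt_cser al be z Hz).
  apply Clim_ext with (fun n => (eA al be (INR (S n) + z) - eA al be (INR (S n))) - eA al be z - 1 / 2 * el al be z
     - 1 / 2 * el al be (INR (S n) + z) - csum (fun j => tau al be (INR j + z)) (S n) -
     (csum (fun j => el al be (INR (S j))) n - eA al be (INR (S n)))).
  - intros n. rewrite csum_tau, csum_first, csum_minus. simpl (INR 0). replace (0 + z) with z by ring. field.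
  - replace (- eA al be z - 1 / 2 * el al be z - Wt al be z - ci) with
      (0 - eA al be z - 1 / 2 * el al be z - 1 / 2 * 0 - Wt al be z - ci) by ring.
    repeat apply Clim_minus; auto using Clim_const.
    + now apply eA_shift_lim.
    + now apply (Clim_scal (1 / 2)), el_shift_lim.
    + now apply Clim_incr_1.
Qed.

Lemma tz_cser (al be a : C) (k : nat) : (0 < Im a)%R ->
  cser (fun n => tz al be a (INR n) k) (Wt al be (INR (S k) * a) + Wt al be (- (INR (S k) * a))).
Proof.
  intros Ha. assert (P := INR_S_pos k).
  apply (cser_plus (fun n => tau al be (INR n + INR (S k) * a)) (fun n => tau al be (INR n + - (INR (S k) * a))));
  apply Wt_cser; creim; nra.
Qed.

(** * The constants *)

(** The defects at the positive integers form a convergent series. This gives existence of the limit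
    before it is identified with a named constant. *)
Lemma el_sum_cv (al be : C) : exists ci,
  Clim (fun n => csum (fun j => el al be (INR (S j))) n - eA al be (INR (S n))) ci.
Proof.
  destruct (tau_nat_bound al be) as [B [HB H]].
  destruct (cser_abs (fun n => tau al be (INR (S n))) (fun n => B * pw (5 / 2) n)%R) as [l Hl]; auto.
  - apply summable_scal; auto. apply summable_pw. lra.
  - exists (- l - eA al be 1 + 1 / 2 * el al be 1 - 1 / 2 * 0).
    assert (Hel0 := el_nat_lim al be).
    apply Clim_ext with (fun n => - csum (fun n => tau al be (INR (S n))) n - eA al be 1 + 1 / 2 * el al be 1 -
       1 / 2 * el al be (INR (S n))).
    { intros n. rewrite (csum_ext (fun n => tau al be (INR (S n))) (fun n => tau al be (INR n + 1))).
      2: { intros. now rewrite S_INR, RtoC_plus. }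
      rewrite csum_tau. rewrite (csum_ext (fun j => el al be (INR j + 1)) (fun j => el al be (INR (S j)))).
      2: { intros. now rewrite S_INR, RtoC_plus. }
      rewrite <- RtoC_plus, <- S_INR. field. }
    apply Clim_minus. apply Clim_plus. apply Clim_minus. apply Clim_opp. exact Hl.
    apply Clim_const. apply Clim_const. now apply Clim_scal.
Qed.

Lemma el_10 (x : R) : (0 < x)%R -> el 1 0 x = RtoC (/ x).
Proof. intros H. unfold el. rewrite RtoC_inv by lra. field. intros K. apply RtoC_inj in K. lra. Qed.

Lemma el_01 (x : R) : (0 < x)%R -> el 0 1 x = RtoC (ln x / x).
Proof.
  intros H. unfold el. rewrite Clog_R, RtoC_div by lra. field. intros K. apply RtoC_inj in K. lra.
Qed.

Lemma eA_10 (z : C) : eA 1 0 z = Clog z.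
Proof. unfold eA. field. Qed.

Lemma eA_01 (z : C) : eA 0 1 z = 1 / 2 * (Clog z * Clog z).
Proof. unfold eA. ring. Qed.

Lemma ln_S_div_lim : is_lim_seq (fun n => ln (INR (S n)) * inv_S n)%R 0%R.
Proof.
  assert (K := Clim_Re _ _ (el_nat_lim 0 1)). eapply is_lim_seq_ext. 2: exact K.
  intros n. cbv beta. rewrite el_01 by apply INR_S_pos. reflexivity.
Qed.

Lemma ci_10 : Clim (fun n => csum (fun j => el 1 0 (INR (S j))) n - eA 1 0 (INR (S n))) euler_gamma.
Proof.
  apply Clim_ext with (fun n => RtoC ((harm (S n) - ln (INR (S n))) - / INR (S n))%R).
  { intros n. rewrite eA_10, Clog_R by apply INR_S_pos.
    rewrite (csum_ext _ (fun j => RtoC (/ INR (S j)))) by (intros; apply el_10, INR_S_pos).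
    rewrite csum_RtoC. fold (harm n). rewrite harm_S. rewrite <- RtoC_minus. f_equal. ring. }
  apply Clim_RtoC. replace euler_gamma with (euler_gamma - 0)%R by ring. apply is_lim_seq_minus'.
  - apply (is_lim_seq_incr_1 (fun n => harm n - ln (INR n))%R), harm_ln_lim.
  - apply inv_S_lim.
Qed.

(** [stieltjes1] is the [real] of a [Lim_seq], so it can be identified only once convergence is
    known. The sum here stops one term before [eA], which costs a null term [log n / n]. *)
Lemma ci_01 : Clim (fun n => csum (fun j => el 0 1 (INR (S j))) n - eA 0 1 (INR (S n))) stieltjes1.
Proof.
  destruct (el_sum_cv 0 1) as [ci Hci].
  set (s := fun n => (rsum (fun j => ln (INR (S j)) / INR (S j)) n - ln (INR n) ^ 2 / 2)%R).
  assert (E : forall n, csum (fun j => el 0 1 (INR (S j))) n - eA 0 1 (INR (S n)) =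
     RtoC (s (S n) - ln (INR (S n)) / INR (S n))).
  { intros n. rewrite eA_01, Clog_R by apply INR_S_pos.
    rewrite (csum_ext _ (fun j => RtoC (ln (INR (S j)) / INR (S j)))) by (intros; apply el_01, INR_S_pos).
    rewrite csum_RtoC. unfold s.
    change (rsum (fun j => ln (INR (S j)) / INR (S j))%R (S n)) with
      (rsum (fun j => ln (INR (S j)) / INR (S j))%R n + ln (INR (S n)) / INR (S n))%R.
    rewrite <- RtoC_mult. replace (1 / 2) with (RtoC (1 / 2)) by (rewrite RtoC_div by lra; reflexivity).
    rewrite <- RtoC_mult, <- RtoC_minus. f_equal. field. apply not_0_INR. lia. }
  assert (Hl0 : is_lim_seq (fun n => ln (INR (S n)) / INR (S n))%R 0%R) by exact ln_S_div_lim.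
  assert (Hs : is_lim_seq (fun n => s (S n)) (Re ci)).
  { apply is_lim_seq_ext with (fun n => (s (S n) - ln (INR (S n)) / INR (S n)) + ln (INR (S n)) / INR (S n))%R.
    intros; ring. replace (Finite (Re ci)) with (Finite (Re ci + 0)%R) by (f_equal; ring).
    apply is_lim_seq_plus'; auto. apply Clim_Re in Hci. eapply is_lim_seq_ext. 2: exact Hci.
    intros n. cbv beta. rewrite E. reflexivity. }
  assert (Es : stieltjes1 = Re ci).
  { unfold stieltjes1. rewrite (is_lim_seq_unique _ (Re ci)); auto.
    apply is_lim_seq_ext with s. { intros n. unfold s. now rewrite sum_n_m_1_rsum. }
    now apply is_lim_seq_incr_1. }
  rewrite Es. eapply Clim_ext. intros n. symmetry. apply E. apply Clim_RtoC.
  replace (Finite (Re ci)) with (Finite (Re ci - 0)%R) by (f_equal; ring).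
  now apply is_lim_seq_minus'.
Qed.

(** * The terms of the psi1 series *)

Lemma psi1_Wt (z : C) : Im z <> 0%R -> psi1 z = Wt 0 1 z + 1 / 2 * (Clog z * Clog z) - 1 / 2 * (Clog z / z).
Proof.
  intros Hz. unfold psi1, CSeries1.
  assert (K := el_series 0 1 z stieltjes1 Hz ci_01).
  assert (E : forall w, slit w -> el 0 1 w = Clog w / w).
  { intros w Hw. unfold el. field. now apply slit_neq_0. }
  rewrite (CSeries_cser _ (- eA 0 1 z - 1 / 2 * el 0 1 z - Wt 0 1 z - stieltjes1)).
  - rewrite eA_01, E by (now right). field. intros ->. simpl in Hz. lra.
  - eapply cser_ext. 2: exact K. intros j. cbv beta. assert (P := INR_S_pos j).
    rewrite !E. reflexivity. now apply slit_R.
    replace (INR (S j) + z) with (INR (S j) + 1 * z) by ring. apply cone_slit; auto; lra.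
Qed.

Lemma Clog_opp_upper (z : C) : (0 < Im z)%R -> Clog (- z) = Clog z - Ci * PI.
Proof.
  intros Hz. apply Clog_unique.
  - unfold Cminus. rewrite Cexp_plus, Cexp_Clog by (right; lra).
    replace (Cexp (- (Ci * PI))) with (RtoC (-1)). ring.
    unfold Cexp. apply C_eq; creim.
    + replace (- (0 * 0 + 1 * PI))%R with (- PI)%R by ring. rewrite cos_neg, cos_PI.
      replace (- (0 * PI - 1 * 0))%R with 0%R by ring. rewrite exp_0. ring.
    + replace (- (0 * 0 + 1 * PI))%R with (- PI)%R by ring. rewrite sin_neg, sin_PI. ring.
  - creim. assert (H := Clog_Im_upper z Hz). lra.
Qed.

Lemma Clog_Ci_right (w : C) : (0 < Re w)%R -> Clog (Ci * w) = Clog w + Ci * PI / 2.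
Proof.
  intros Hw. assert (E : Ci * PI / 2 = Ci * RtoC (PI / 2)) by (rewrite RtoC_div by lra; field).
  rewrite E. apply Clog_unique.
  - rewrite Cexp_plus, Cexp_Clog by now left.
    replace (Cexp (Ci * RtoC (PI / 2))) with Ci. ring.
    unfold Cexp. apply C_eq; creim.
    + replace (0 * 0 + 1 * (PI / 2))%R with (PI / 2)%R by ring. rewrite cos_PI2. ring.
    + replace (0 * 0 + 1 * (PI / 2))%R with (PI / 2)%R by ring. rewrite sin_PI2.
      replace (0 * (PI / 2) - 1 * 0)%R with 0%R by ring. rewrite exp_0. ring.
  - creim. assert (H := Clog_Im_right w Hw). assert (P := PI_RGT_0). lra.
Qed.

Lemma per_k (y : C) (k : nat) : y <> 0 -> 2 * PI * Ci * INR k / y = INR k * per y.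
Proof. intros Hy. unfold per, tpi. field. auto. Qed.

Lemma RtoC_PI_neq_0 : RtoC PI <> 0.
Proof. intros K. apply RtoC_inj in K. assert (P := PI_RGT_0). lra. Qed.

Lemma Ci_neq_0 : Ci <> 0.
Proof. intros K. assert (Im Ci = 0%R) by now rewrite K. simpl in H. lra. Qed.

(** For [z] in the upper half-plane, [log z - log (- z) = i pi], so the parts [- log z / (2 z)] at
    [z] and [- z] add up to [- i pi / (2 z)]. With [z = 2 pi i k / y] this is [- y / (4 k)], which
    the last summand of [psi1_term] removes. *)
Lemma psi1_term_Wt (y : C) (k : nat) : (0 < Re y)%R ->
  psi1_term y (S k) = Wt 0 1 (INR (S k) * per y) + Wt 0 1 (- (INR (S k) * per y)).
Proof.
  intros Hy. assert (Hy0 := right_neq_0 y Hy). unfold psi1_term. rewrite per_k by auto.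
  assert (Ha := per_Im y Hy). set (z := INR (S k) * per y).
  assert (P := INR_S_pos k). assert (Hz : (0 < Im z)%R) by (unfold z; creim; nra).
  assert (Hz0 : z <> 0). { apply slit_neq_0. right; lra. }
  rewrite !psi1_Wt by (creim; lra). rewrite Clog_opp_upper by auto.
  assert (Ey : y / (4 * INR (S k)) = 1 / 2 * (Ci * PI / z)).
  { unfold z, per, tpi. field. repeat split; auto using INR_S_neq_0, RtoC_PI_neq_0, Ci_neq_0. }
  rewrite Ey. field. auto.
Qed.

(** With [z = i w] and [Re w > 0], the logarithms at [z] and [- z] are [log w] plus and minus
    [i pi / 2]. *)
Lemma Clog_sum_conj (y : C) (k : nat) : (0 < Re y)%R ->
  Clog (INR (S k) * per y) + Clog (- (INR (S k) * per y)) = 2 * Clog (2 * PI * INR (S k) / y).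
Proof.
  intros Hy. assert (Hy0 := right_neq_0 y Hy). assert (Ha := per_Im y Hy). assert (P := INR_S_pos k).
  rewrite Clog_opp_upper by (creim; nra).
  set (w := 2 * PI * INR (S k) / y).
  assert (Ew : INR (S k) * per y = Ci * w) by (unfold w, per, tpi; field; auto).
  assert (Hw : (0 < Re w)%R).
  { assert (K : Im (INR (S k) * per y) = Re w). { rewrite Ew. creim. ring. }
    rewrite <- K. creim. nra. }
  rewrite Ew, Clog_Ci_right by auto. field.
Qed.

(** * The Gamma and digamma functions *)

Definition psi_seq (n : nat) (z : C) : C := ln (INR n) - csum (fun k => / (z + INR k)) (S n).

(** A logarithm of the Euler-Gauss quotient, taken factor by factor: it need not be the principal
    one, since Gamma is recovered by [Cexp]. Its derivative in [z] is [psi_seq]. *)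
Definition lgamma_seq (n : nat) (z : C) : C :=
  ln (INR (fact n)) + z * ln (INR n) - csum (fun k => Clog (z + INR k)) (S n).

Lemma slit_shift (z : C) (x : R) : Im z <> 0%R -> slit (z + x).
Proof. intros H. right. rewrite Im_plus, Im_R, Rplus_0_r. auto. Qed.

Lemma psi_seq_lim (z : C) : Im z <> 0%R ->
  Clim (fun n => psi_seq n z) (Wt 1 0 z + Clog z - 1 / 2 * (1 / z)).
Proof.
  intros Hz. assert (Hz0 : z <> 0) by (apply slit_neq_0; now right).
  assert (K := el_series 1 0 z euler_gamma Hz ci_10).
  assert (E : forall w, slit w -> el 1 0 w = / w).
  { intros w Hw. unfold el. field. now apply slit_neq_0. }
  apply Clim_ext with (fun n => - RtoC (harm n - ln (INR n)) - / z -
     csum (fun j => el 1 0 (INR (S j) + z) - el 1 0 (INR (S j))) n).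
  - intros n. unfold psi_seq. rewrite csum_first, csum_minus.
    rewrite (csum_ext (fun j => el 1 0 (INR (S j))) (fun j => RtoC (/ INR (S j)))) by (intros; apply el_10, INR_S_pos).
    rewrite csum_RtoC. fold (harm n).
    rewrite (csum_ext (fun j => el 1 0 (INR (S j) + z)) (fun j => / (z + INR (S j)))).
    2: { intros j _. rewrite Cplus_comm. apply E. now apply slit_shift. }
    simpl (INR 0). replace (z + 0) with z by ring. rewrite RtoC_minus. ring.
  - rewrite eA_10, E in K by (now right).
    replace (Wt 1 0 z + Clog z - 1 / 2 * (1 / z)) with
      (- RtoC euler_gamma - / z - (- Clog z - 1 / 2 * / z - Wt 1 0 z - euler_gamma)) by (field; auto).
    apply Clim_minus; auto. apply Clim_minus. apply Clim_opp, Clim_RtoC, harm_ln_lim. apply Clim_const.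
Qed.

Lemma Cexp_lgamma_seq (n : nat) (z : C) : Im z <> 0%R ->
  Cexp (lgamma_seq n z) = INR (fact n) * Cexp (z * ln (INR n)) / Crising z (S n).
Proof.
  intros Hz. unfold lgamma_seq. rewrite Cexp_minus, Cexp_plus, Cexp_R, exp_ln by apply INR_fact_lt_0.
  f_equal. f_equal.
  assert (E : forall m, Cexp (csum (fun k => Clog (z + INR k)) m) = Crising z m).
  { induction m. apply Cexp_0. rewrite csum_S, Cexp_plus, IHm, Cexp_Clog by now apply slit_shift. reflexivity. }
  apply E.
Qed.

(** The increments are [O (1 / n ^ 2)]: both [log (N + z) - log N - z / N] and
    [log N - log (N - 1) - 1 / N] are of second order. The sequence is started at index 1 because it
    contains [ln (INR n)]. *)
Lemma lgamma_seq_cv (z : C) : Im z <> 0%R -> exists G, Clim (fun n => lgamma_seq n z) G.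
Proof.
  intros Hz. destruct (cone_bound z Hz) as [k [Hk Hc]].
  set (B := (Cmod z * Cmod z / (k * k) + 2 * Cmod z)%R).
  assert (HB0 : (0 <= Cmod z * Cmod z / (k * k))%R).
  { assert (A := Cmod_ge_0 z). apply Rdiv_le_0_compat; nra. }
  assert (HB : (0 <= B)%R). { assert (A := Cmod_ge_0 z). unfold B; lra. }
  destruct (cser_abs (fun n => lgamma_seq (S (S n)) z - lgamma_seq (S n) z) (fun n => B * pw 2 n)%R) as [l Hl].
  - intros n. set (N := S (S n)). assert (K := INR_ge_0 n). assert (P := INR_S_pos n).
    assert (EN : INR N = (INR n + 2)%R) by (unfold N; rewrite !S_INR; ring).
    assert (EN1 : INR (S n) = (INR n + 1)%R) by apply S_INR.
    assert (HNpos : (0 < INR N)%R) by lra.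
    replace (lgamma_seq N z - lgamma_seq (S n) z) with
      (- (Clog (INR N + z) - Clog (INR N) - z / INR N) + z * RtoC (ln (INR N) - ln (INR (S n)) - / INR N)).
    2: { unfold lgamma_seq. rewrite (csum_S _ N). unfold N at 9.
         assert (Ef : ln (INR (fact N)) = (ln (INR N) + ln (INR (fact (S n))))%R).
         { unfold N. rewrite <- ln_mult. rewrite <- mult_INR. reflexivity. apply INR_S_pos. apply INR_fact_lt_0. }
         rewrite Ef, (Clog_R (INR N)) by auto. rewrite !RtoC_minus, RtoC_plus, RtoC_inv by lra.
         rewrite (Cplus_comm (INR N) z). fold N. field. intros Q. apply RtoC_inj in Q. lra. }
    eapply Rle_trans. apply Cmod_triangle. rewrite Cmod_opp, Cmod_mult, Cmod_R.
    assert (A := Cmod_ge_0 z). rewrite pw_2.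
    assert (T1 : (Cmod (Clog (INR N + z) - Clog (INR N) - z / INR N) <=
       Cmod z * Cmod z / (k * k) * / ((INR n + 1) * (INR n + 1)))%R).
    { eapply Rle_trans. apply Clog_taylor with (m := (k * (INR n + 1))%R). nra.
      intros t Ht. split. apply cone_slit; auto; lra. eapply Rle_trans. 2: apply Hc; lra. nra.
      right. field. lra. }
    assert (T2 : (Rabs (ln (INR N) - ln (INR (S n)) - / INR N) <= 2 * / ((INR n + 1) * (INR n + 1)))%R).
    { assert (L := ln_S_bounds (INR (S n)) P). rewrite <- S_INR in L. fold N in L.
      assert (E1 : (/ INR (S n) - / INR N <= / ((INR n + 1) * (INR n + 1)))%R).
      { rewrite EN, EN1. replace (/ (INR n + 1) - / (INR n + 2))%R with (/ ((INR n + 1) * (INR n + 2)))%R by (field; lra).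
        apply Rinv_le_contravar; nra. }
      assert (E2 : (0 < / ((INR n + 1) * (INR n + 1)))%R) by (apply Rinv_0_lt_compat; nra).
      apply Rabs_le. lra. }
    unfold B. nra.
  - apply summable_scal; auto. apply summable_pw. lra.
  - exists (l + lgamma_seq 1 z). apply Clim_incr_1.
    apply Clim_ext with (fun n => csum (fun n => lgamma_seq (S (S n)) z - lgamma_seq (S n) z) n + lgamma_seq 1 z).
    + intros n. rewrite (csum_telescope (fun n => lgamma_seq (S n) z)). ring.
    + apply Clim_plus; auto. apply Clim_const.
Qed.

(** [B] and [d] do not depend on [n], so the estimate survives the limit and gives the derivative of
    the limit without a theorem on uniform convergence. Real increments [h] suffice for the way
    [C_derive] is computed. *)
Lemma lgamma_seq_taylor (z : C) : Im z <> 0%R -> exists B d, (0 <= B)%R /\ (0 < d)%R /\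
  forall n (h : R), (Rabs h <= d)%R ->
    (Cmod (lgamma_seq n (z + h) - lgamma_seq n z - h * psi_seq n z) <= B * (h * h))%R.
Proof.
  intros Hz. destruct (cone_bound z Hz) as [k [Hk Hc]].
  destruct (summable_pw 2) as [Hp [S0 HS]]. lra.
  (* A shift of at most [k / 2] leaves the points at distance at least [(k / 2) (j + 1)] from 0, so
     the quadratic errors sum to [(4 / k ^ 2)] times the series of [1 / (j + 1) ^ 2]. *)
  exists (4 / (k * k) * S0)%R, (k / 2)%R. assert (Hkk : (0 < 4 / (k * k))%R) by (apply Rdiv_lt_0_compat; nra).
  split. { apply Rmult_le_pos. lra. exact (HS O). } split. lra.
  intros n h Hh.
  replace (lgamma_seq n (z + h) - lgamma_seq n z - h * psi_seq n z) with
    ((-1) * csum (fun j => Clog (z + INR j + h) - Clog (z + INR j) - h / (z + INR j)) (S n)).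
  2: { rewrite csum_minus, csum_minus. 
       rewrite (csum_ext (fun j => h / (z + INR j)) (fun j => h * / (z + INR j))) by reflexivity.
       rewrite csum_scal. unfold lgamma_seq, psi_seq.
       rewrite (csum_ext (fun j => Clog (z + INR j + h)) (fun j => Clog (z + h + INR j))).
       2: { intros; f_equal; ring. } ring. }
  rewrite Cmod_mult. replace (Cmod (-1)) with 1%R by (rewrite Cmod_R, Rabs_left; lra).
  rewrite Rmult_1_l. eapply Rle_trans.
  - apply csum_Cmod_le with (b := fun j => (h * h * (4 / (k * k)) * pw 2 j)%R). intros j _.
    assert (K := INR_ge_0 j).
    eapply Rle_trans. apply Clog_taylor with (m := (k / 2 * (INR j + 1))%R). nra.
    + intros t Ht. split.
      * replace (z + INR j + t * h) with (z + RtoC (INR j + t * h)) by (rewrite RtoC_plus, RtoC_mult; ring).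
        now apply slit_shift.
      * assert (L := Hc (INR j) 1%R). assert (L1 : (k * (INR j + 1) <= Cmod (INR j + 1 * z))%R) by (apply L; lra).
        replace (INR j + 1 * z) with (z + INR j) in L1 by ring.
        assert (T := Cmod_triangle_rev (z + INR j) (- (t * h))).
        replace (z + INR j - - (t * h)) with (z + INR j + t * h) in T by ring.
        rewrite Cmod_opp, Cmod_mult, !Cmod_R, (Rabs_pos_eq t) in T by lra.
        assert (Ph := Rabs_pos h). nra.
    + rewrite Cmod_R, pw_2. replace (Rabs h * Rabs h)%R with (h * h)%R.
      2: { rewrite <- Rabs_mult, Rabs_pos_eq; nra. } right. field. lra.
  - rewrite rsum_scal. specialize (HS (S n)).
    replace (4 / (k * k) * S0 * (h * h))%R with (h * h * (4 / (k * k)) * S0)%R by ring.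
    apply Rmult_le_compat_l; auto. apply Rmult_le_pos; nra.
Qed.

Lemma is_derive_of_taylor (f : R -> R) (x l B d : R) : (0 < d)%R -> (0 <= B)%R ->
  (forall h, (Rabs h <= d)%R -> (Rabs (f (x + h)%R - f x - h * l) <= B * (h * h))%R) -> is_derive f x l.
Proof.
  intros Hd HB H. apply is_derive_Reals. intros eps He.
  assert (Hdd : (0 < Rmin d (eps / (B + 1)))%R). { apply Rmin_glb_lt; auto. apply Rdiv_lt_0_compat; lra. }
  exists (mkposreal _ Hdd). intros h Hh0 Hh. simpl in Hh.
  assert (M1 := Rmin_l d (eps / (B + 1))). assert (M2 := Rmin_r d (eps / (B + 1))).
  assert (Hx := H h). assert (Hx' : (Rabs (f (x + h)%R - f x - h * l) <= B * (h * h))%R) by (apply Hx; lra).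
  replace ((f (x + h) - f x) / h - l)%R with ((f (x + h) - f x - h * l) / h)%R by (field; auto).
  rewrite Rabs_div by auto. assert (Hp : (0 < Rabs h)%R) by now apply Rabs_pos_lt.
  apply Rmult_lt_reg_r with (Rabs h); auto. unfold Rdiv. rewrite Rmult_assoc, Rinv_l, Rmult_1_r by lra.
  eapply Rle_lt_trans. exact Hx'. replace (h * h)%R with (Rabs h * Rabs h)%R.
  2: { rewrite <- Rabs_mult, Rabs_pos_eq; nra. }
  rewrite <- Rmult_assoc. apply Rmult_lt_compat_r; auto.
  assert (Hh2 : (Rabs h < eps / (B + 1))%R) by lra.
  apply Rle_lt_trans with (B * (eps / (B + 1)))%R. apply Rmult_le_compat_l; lra.
  apply Rmult_lt_reg_r with (B + 1)%R. lra. unfold Rdiv.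
  replace (B * (eps * / (B + 1)) * (B + 1))%R with (B * eps)%R by (field; lra). nra.
Qed.

Lemma is_lim_of_is_derive (f : R -> R) (x l : R) : is_derive f x l ->
  is_lim (fun u => (f u - f x) / (u - x))%R x l.
Proof.
  intros H. apply is_derive_Reals in H. apply is_lim_spec. intros eps.
  destruct (H eps (cond_pos eps)) as [d Hd]. exists d. intros u Hu Hux.
  assert (K : (u - x <> 0)%R) by lra. specialize (Hd (u - x)%R K). 
  rewrite Rplus_minus in Hd. apply Hd. exact Hu.
Qed.

(** On the horizontal line through [z], Gamma is [Cexp] of the limit [G] of [lgamma_seq], and the
    Taylor bound passed to the limit makes [psi] the derivative of [G]; the factor [CGamma z] then
    cancels. *)
Lemma digamma_Wt (z : C) : Im z <> 0%R -> digamma z = Wt 1 0 z + Clog z - 1 / 2 * (1 / z).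
Proof.
  intros Hz. set (psi := Wt 1 0 z + Clog z - 1 / 2 * (1 / z)).
  set (G := fun w => CLim_seq (fun n => lgamma_seq n w)).
  assert (HG : forall w, Im w <> 0%R -> Clim (fun n => lgamma_seq n w) (G w)).
  { intros w Hw. destruct (lgamma_seq_cv w Hw) as [l Hl]. unfold G. now rewrite (CLim_seq_correct _ _ Hl). }
  assert (HGam : forall w, Im w <> 0%R -> CGamma w = Cexp (G w)).
  { intros w Hw. unfold CGamma. apply CLim_seq_correct.
    eapply Clim_ext. intros n. now apply Cexp_lgamma_seq. apply Clim_Cexp. auto. }
  destruct (lgamma_seq_taylor z Hz) as [B [d [HB [Hd HT]]]].
  assert (HTG : forall h : R, (Rabs h <= d)%R -> (Cmod (G (z + h)%C - G z - h * psi) <= B * (h * h))%R).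
  { intros h Hh. apply (Clim_le (fun n => lgamma_seq n (z + h) - lgamma_seq n z - h * psi_seq n z)) with (N := O).
    intros n _. now apply HT. apply Clim_minus. apply Clim_minus; apply HG; auto.
    rewrite Im_plus, Im_R, Rplus_0_r; auto. apply Clim_scal. now apply psi_seq_lim. }
  assert (Hpair : forall x, (x, Im z) = z + RtoC (x - Re z)).
  { intros x. apply C_eq; creim; ring. }
  assert (HD : Dc (fun x => G (x, Im z)) (Re z) psi).
  { split; apply (is_derive_of_taylor _ _ _ B d Hd HB); intros h Hh; specialize (HTG h Hh);
    rewrite !Hpair; replace (Re z + h - Re z)%R with h by ring; 
    replace (z + RtoC (Re z - Re z)) with z by (rewrite Rminus_diag; ring).
    - eapply Rle_trans. 2: exact HTG. 
      replace (Re (G (z + h)%C) - Re (G z) - h * Re psi)%R with (Re (G (z + h)%C - G z - h * psi)).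
      apply re_le_Cmod. creim. ring.
    - eapply Rle_trans. 2: exact HTG. 
      replace (Im (G (z + h)%C) - Im (G z) - h * Im psi)%R with (Im (G (z + h)%C - G z - h * psi)).
      apply im_le_Cmod. creim. ring. }
  assert (Hzp : (Re z, Im z) = z) by (destruct z; reflexivity).
  assert (HD2 : Dc (fun x => CGamma (x, Im z)) (Re z) (psi * CGamma z)).
  { rewrite HGam by auto. apply Dc_ext with (fun x => Cexp (G (x, Im z))).
    intros u. symmetry. now apply HGam. apply Dc_Cexp in HD. cbv beta in HD. rewrite Hzp in HD. exact HD. }
  destruct HD2 as [D1 D2]. apply is_lim_of_is_derive in D1. apply is_lim_of_is_derive in D2.
  rewrite Hzp in D1, D2.
  assert (HC : C_derive CGamma z = psi * CGamma z).
  (* [C_derive] unfolds to componentwise limits along the horizontal line through [z], so the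
     derivative in the real direction determines it. *)
  { unfold C_derive, C_lim.
    assert (Eq : forall x, (x, snd z) - z = RtoC (x - Re z)). { intros x. apply C_eq; creim; [reflexivity|]. simpl. unfold Im. ring. }
    assert (Eu : forall x, x <> Re z -> (CGamma (x, snd z) - CGamma z) / ((x, snd z) - z) =
       (((Re (CGamma (x, Im z)) - Re (CGamma z)) / (x - Re z))%R, ((Im (CGamma (x, Im z)) - Im (CGamma z)) / (x - Re z))%R)).
    { intros x Hx. rewrite Eq. change (snd z) with (Im z).
      apply C_eq; [rewrite Re_div_R by lra|rewrite Im_div_R by lra]; reflexivity. }
    assert (L1 : is_lim (fun x => fst ((CGamma (x, snd z) - CGamma z) / ((x, snd z) - z))) (fst z) (Re (psi * CGamma z))).
    { eapply is_lim_ext_loc. 2: exact D1. exists (mkposreal 1 Rlt_0_1). intros x _ Hx. cbv beta. rewrite Eu by exact Hx. reflexivity. }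
    assert (L2 : is_lim (fun x => snd ((CGamma (x, snd z) - CGamma z) / ((x, snd z) - z))) (fst z) (Im (psi * CGamma z))).
    { eapply is_lim_ext_loc. 2: exact D2. exists (mkposreal 1 Rlt_0_1). intros x _ Hx. cbv beta. rewrite Eu by exact Hx. reflexivity. }
    apply is_lim_unique in L1. apply is_lim_unique in L2. rewrite L1, L2. 
    destruct (psi * CGamma z). reflexivity. }
  unfold digamma. rewrite HC, HGam by auto. field. apply Cexp_neq_0.
Qed.

(** The parts [- 1 / (2 z)] are odd and cancel between [z] and [- z]; the logarithms combine by
    [Clog_sum_conj]. *)
Lemma digamma_term_Wt (y : C) (k : nat) : (0 < Re y)%R ->
  digamma_term y (S k) = - (1 / 2) * (Wt 1 0 (INR (S k) * per y) + Wt 1 0 (- (INR (S k) * per y))).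
Proof.
  intros Hy. assert (Hy0 := right_neq_0 y Hy). unfold digamma_term.
  assert (E := Clog_sum_conj y k Hy). rewrite per_k by auto.
  assert (Ha := per_Im y Hy). set (z := INR (S k) * per y) in *.
  assert (P := INR_S_pos k). assert (Hz : (0 < Im z)%R) by (unfold z; creim; nra).
  assert (Hz0 : z <> 0). { apply slit_neq_0. right; lra. }
  rewrite !digamma_Wt by (rewrite ?Im_opp; lra).
  replace (Clog (2 * PI * INR (S k) / y)) with (1 / 2 * (Clog z + Clog (- z))) by (rewrite E; field).
  field. auto.
Qed.

(** * Wallis and Stirling *)

Definition wallis (n : nat) : R := RInt (fun x => sin x ^ n)%R 0 (PI / 2).

Lemma ex_RInt_sin_pow (n : nat) : ex_RInt (fun x => sin x ^ n)%R 0 (PI / 2).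
Proof.
  apply (ex_RInt_continuous (V := R_CompleteNormedModule)). intros x _.
  apply (ex_derive_continuous (fun x => sin x ^ n)%R). auto_derive. auto.
Qed.

(** Integration by parts through an explicit primitive: [cos x * sin x ^ (n + 1)] vanishes at both
    ends of the interval. *)
Lemma wallis_rec (n : nat) : (INR (n + 2) * wallis (n + 2) = INR (n + 1) * wallis n)%R.
Proof.
  assert (H : is_RInt (fun x => INR (n + 1) * sin x ^ n - INR (n + 2) * sin x ^ (n + 2))%R 0 (PI / 2)
     (cos (PI / 2) * sin (PI / 2) ^ (n + 1) - cos 0 * sin 0 ^ (n + 1))%R).
  { apply (is_RInt_derive (fun x => cos x * sin x ^ (n + 1))%R).
    - intros x _. auto_derive. auto. replace (Init.Nat.pred (n + 1)) with n by lia.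
      replace (n + 2)%nat with (S (n + 1)) by lia. rewrite S_INR.
      replace (n + 1)%nat with (S n) by lia. simpl pow.
      assert (E := sin2_cos2 x). unfold Rsqr in E.
      replace (sin x * (sin x * sin x ^ n))%R with ((1 - cos x * cos x) * sin x ^ n)%R.
      2: { rewrite <- Rmult_assoc. f_equal. lra. } 
      replace (sin x * sin x ^ n)%R with (sin x ^ n * sin x)%R by ring.
      replace (1 * - sin x * (sin x ^ n * sin x))%R with (- (sin x * sin x) * sin x ^ n)%R by ring.
      replace (sin x * sin x)%R with (1 - cos x * cos x)%R by lra. ring.
    - intros x _. apply (ex_derive_continuous (fun x => INR (n + 1) * sin x ^ n - INR (n + 2) * sin x ^ (n + 2))%R).
      auto_derive. auto. }
  rewrite cos_PI2, sin_0, (pow_i (n + 1)) in H by lia.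
  assert (H2 : is_RInt (fun x => INR (n + 1) * sin x ^ n - INR (n + 2) * sin x ^ (n + 2))%R 0 (PI / 2)
     (INR (n + 1) * wallis n - INR (n + 2) * wallis (n + 2))%R).
  { apply (is_RInt_minus (V := R_NormedModule)); apply (is_RInt_scal (V := R_NormedModule));
    apply (RInt_correct (V := R_CompleteNormedModule)); apply ex_RInt_sin_pow. }
  assert (U1 := is_RInt_unique (V := R_CompleteNormedModule) _ _ _ _ H).
  assert (U2 := is_RInt_unique (V := R_CompleteNormedModule) _ _ _ _ H2). rewrite U1 in U2. lra.
Qed.

Lemma wallis_anti (n : nat) : (wallis (S n) <= wallis n)%R.
Proof.
  apply RInt_le. assert (P := PI_RGT_0); lra. apply ex_RInt_sin_pow. apply ex_RInt_sin_pow.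
  intros x Hx. simpl. assert (S1 := SIN_bound x).
  assert (S2 : (0 <= sin x)%R) by (apply sin_ge_0; assert (P := PI_RGT_0); lra).
  assert (0 <= sin x ^ n)%R by now apply pow_le. nra.
Qed.

Lemma wallis_0 : wallis 0 = (PI / 2)%R.
Proof.
  unfold wallis. simpl. rewrite RInt_const. unfold scal; simpl; unfold mult; simpl. ring.
Qed.

Lemma wallis_1 : wallis 1 = 1%R.
Proof.
  assert (H : is_RInt (fun x => sin x ^ 1)%R 0 (PI / 2) (- cos (PI / 2) - - cos 0)%R).
  { apply (is_RInt_derive (fun x => - cos x)%R).
    - intros x _. auto_derive. auto. ring.
    - intros x _. apply (ex_derive_continuous (fun x => sin x ^ 1)%R). auto_derive. auto. }
  unfold wallis. rewrite (is_RInt_unique (V := R_CompleteNormedModule) _ _ _ _ H), cos_PI2, cos_0. ring.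
Qed.

Definition lnfact (n : nat) : R := ln (INR (fact n)).

Lemma lnfact_S (n : nat) : lnfact (S n) = (ln (INR (S n)) + lnfact n)%R.
Proof.
  unfold lnfact. rewrite <- ln_mult. rewrite <- mult_INR. reflexivity. apply INR_S_pos. apply INR_fact_lt_0.
Qed.

Lemma wallis_pos_eq (n : nat) : 
  ((0 < wallis (2 * n) /\ 0 < wallis (2 * n + 1)) /\
   (ln (wallis (2 * n)) = ln (PI / 2) + lnfact (2 * n) - INR (2 * n) * ln 2 - 2 * lnfact n /\
   ln (wallis (2 * n + 1)) = INR (2 * n) * ln 2 + 2 * lnfact n - lnfact (2 * n + 1)))%R.
Proof.
  induction n.
  - simpl. rewrite wallis_0, wallis_1. unfold lnfact. simpl. rewrite ln_1. assert (P := PI_RGT_0).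
    repeat split; lra.
  - destruct IHn as [[P1 P2] [E1 E2]].
    assert (R1 := wallis_rec (2 * n)). assert (R2 := wallis_rec (2 * n + 1)).
    replace (2 * S n)%nat with (2 * n + 2)%nat by lia.
    replace (2 * n + 2 + 1)%nat with (2 * n + 1 + 2)%nat by lia.
    replace (2 * n + 1 + 1)%nat with (2 * n + 2)%nat in R2 by lia.
    assert (Q1 : (0 < INR (2 * n + 1))%R) by (apply lt_0_INR; lia).
    assert (Q2 : (0 < INR (2 * n + 2))%R) by (apply lt_0_INR; lia).
    assert (Q3 : (0 < INR (2 * n + 1 + 2))%R) by (apply lt_0_INR; lia).
    assert (W1 : wallis (2 * n + 2) = (INR (2 * n + 1) * wallis (2 * n) / INR (2 * n + 2))%R).
    { rewrite <- R1. field. lra. }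
    assert (W2 : wallis (2 * n + 1 + 2) = (INR (2 * n + 2) * wallis (2 * n + 1) / INR (2 * n + 1 + 2))%R).
    { rewrite <- R2. field. lra. }
    assert (E3 : ln (INR (2 * n + 2)) = (ln 2 + ln (INR (S n)))%R).
    { rewrite <- ln_mult. 2: lra. 2: apply INR_S_pos. f_equal. replace (2 * n + 2)%nat with (2 * S n)%nat by lia.
      rewrite mult_INR. reflexivity. }
    assert (F1 : lnfact (2 * n + 2) = (ln (INR (2 * n + 2)) + (ln (INR (2 * n + 1)) + lnfact (2 * n)))%R).
    { replace (2 * n + 2)%nat with (S (S (2 * n))) by lia. rewrite !lnfact_S.
      replace (S (2 * n)) with (2 * n + 1)%nat by lia. reflexivity. }
    assert (F2 : lnfact (2 * n + 1 + 2) = (ln (INR (2 * n + 1 + 2)) + (ln (INR (2 * n + 2)) + lnfact (2 * n + 1)))%R).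
    { replace (2 * n + 1 + 2)%nat with (S (S (2 * n + 1))) by lia. rewrite !lnfact_S.
      replace (S (2 * n + 1)) with (2 * n + 2)%nat by lia. reflexivity. }
    assert (I2 : INR (2 * n + 2) = (INR (2 * n) + 2)%R) by (rewrite plus_INR; simpl; ring).
    rewrite W1, W2, F1, F2, !lnfact_S.
    split. split; apply Rdiv_lt_0_compat; auto; now apply Rmult_lt_0_compat.
    set (lp := ln (PI / 2)) in *. rewrite !ln_div, !ln_mult; auto; try (now apply Rmult_lt_0_compat).
    rewrite E1, E2, E3, I2. split; ring.
Qed.

Lemma pw_shift (s : R) (n : nat) : (0 <= s)%R -> (pw s n <= Rpower 2 s * pw s (S n))%R.
Proof.
  intros Hs. assert (K := INR_ge_0 n). unfold pw. rewrite S_INR.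
  replace (Rpower 2 s) with (Rpower (1 / 2) (- s)).
  2: { unfold Rpower. f_equal. replace (1 / 2)%R with (/ 2)%R by field. rewrite ln_Rinv by lra. ring. }
  rewrite Rpower_mult_distr by lra. apply Rpower_le_neg; lra.
Qed.

(** The Euler-Maclaurin remainder of [H_(m + 1)] beyond the term [1 / (2 (m + 1))]. Subtracting this
    term is what makes the sequence summable. *)
Definition hrem (m : nat) : R := (harm (S m) - ln (INR (S m)) - euler_gamma - 1 / 2 * / INR (S m))%R.

Lemma hrem_lim : is_lim_seq hrem 0%R.
Proof.
  apply is_lim_seq_abs_0.
  apply is_lim_seq_le_le with (fun _ => 0%R) inv_S; auto using is_lim_seq_const, inv_S_lim.
  intros n. split. apply Rabs_pos. assert (H := harm_ln_gamma n). unfold hrem, inv_S.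
  apply Rabs_le. lra.
Qed.

(** Consecutive remainders differ by a trapezoidal defect of [1 / w], of order [n ^ (- 5 / 2)]; as
    [hrem] tends to 0, summing these differences to infinity gains one power. *)
Lemma hrem_bound : exists B, (0 <= B)%R /\ forall m, (Rabs (hrem m) <= B * pw (3 / 2) m)%R.
Proof.
  destruct (tau_nat_bound 1 0) as [B [HB Ht]].
  (* [2 ^ (5 / 2)] pays for the index shift in [pw_shift], and [3 / 2] is the factor in
     [pw_telescope]. *)
  set (D := (B * Rpower 2 (5 / 2) / (3 / 2))%R).
  assert (HR2 := Rpower_pos 2 (5 / 2)).
  assert (HD : (0 <= D)%R). { unfold D. apply Rdiv_le_0_compat. nra. lra. }
  assert (Hd : forall n, (Rabs (hrem (S n) - hrem n) <= D * (pw (3 / 2) n - pw (3 / 2) (S n)))%R).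
  { intros n. assert (P := INR_S_pos n). assert (P2 := INR_S_pos (S n)).
    assert (E : RtoC (hrem n - hrem (S n)) = tau 1 0 (INR (S n))).
    { unfold tau. replace (INR (S n) + 1) with (RtoC (INR (S (S n)))) by (rewrite (S_INR (S n)), RtoC_plus; reflexivity).
      rewrite !eA_10, !Clog_R, !el_10 by auto. unfold hrem. rewrite (harm_S (S n)).
      replace (1 / 2) with (RtoC (1 / 2)) by (rewrite RtoC_div by lra; reflexivity).
      rewrite <- RtoC_plus, <- RtoC_mult, <- !RtoC_minus. f_equal. field. split; lra. }
    rewrite Rabs_minus_sym, <- Cmod_R, E. eapply Rle_trans. apply Ht.
    assert (T1 := pw_telescope (3 / 2) n). replace (1 + 3 / 2)%R with (5 / 2)%R in T1 by field.
    assert (T1' : (3 / 2 * pw (5 / 2) (S n) <= pw (3 / 2) n - pw (3 / 2) (S n))%R) by (apply T1; lra).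
    assert (T2 := pw_shift (5 / 2) n). assert (T2' : (pw (5 / 2) n <= Rpower 2 (5 / 2) * pw (5 / 2) (S n))%R) by (apply T2; lra).
    apply Rle_trans with (B * (Rpower 2 (5 / 2) * pw (5 / 2) (S n)))%R. now apply Rmult_le_compat_l.
    apply Rle_trans with (D * (3 / 2 * pw (5 / 2) (S n)))%R. unfold D. right. field.
    apply Rmult_le_compat_l; auto. }
  exists D. split; auto. intros m.
  assert (Hsum : forall j, (Rabs (hrem m - hrem (j + m)) <= D * (pw (3 / 2) m - pw (3 / 2) (j + m)))%R).
  { induction j. simpl. rewrite Rminus_diag, Rabs_R0. lra.
    replace (hrem m - hrem (S j + m))%R with ((hrem m - hrem (j + m)) - (hrem (S (j + m)) - hrem (j + m)))%R by (simpl; ring).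
    eapply Rle_trans. apply Rabs_triang. rewrite Rabs_Ropp. specialize (Hd (j + m)%nat). simpl Nat.add. lra. }
  assert (L : is_lim_seq (fun j => Rabs (hrem m - hrem (j + m))) (Rabs (hrem m))).
  { apply (is_lim_seq_abs _ (hrem m)). replace (Finite (hrem m)) with (Finite (hrem m - 0)%R) by (f_equal; ring).
    apply is_lim_seq_minus'. apply is_lim_seq_const. apply (is_lim_seq_incr_n hrem m). apply hrem_lim. }
  assert (K : Rbar_le (Rabs (hrem m)) (D * pw (3 / 2) m)%R).
  { eapply is_lim_seq_le. 2: exact L. 2: apply is_lim_seq_const. intros j. cbv beta.
    specialize (Hsum j). assert (P := pw_pos (3 / 2) (j + m)). nra. }
  exact K.
Qed.

Lemma rsum_harm (n : nat) : rsum (fun m => harm (S m)) n = ((INR n + 1) * harm n - INR n)%R.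
Proof.
  induction n. simpl. unfold harm; simpl. ring.
  change (rsum (fun m => harm (S m)) (S n)) with (rsum (fun m => harm (S m)) n + harm (S n))%R.
  rewrite IHn, harm_S, !S_INR. assert (K := INR_ge_0 n). field. lra.
Qed.

Lemma rsum_lnfact (n : nat) : rsum (fun m => ln (INR (S m))) n = lnfact n.
Proof.
  induction n. unfold lnfact. simpl. now rewrite ln_1.
  change (rsum (fun m => ln (INR (S m))) (S n)) with (rsum (fun m => ln (INR (S m))) n + ln (INR (S n)))%R.
  rewrite IHn, lnfact_S. ring.
Qed.

(** The sums of [H_m] and of [log m] are explicit, so up to elementary terms this is [- log n!]: the
    sum of the series [hrem] is equivalent to Stirling's constant. *)
Lemma rsum_hrem (n : nat) :
  rsum hrem n = ((INR n + 1 / 2) * harm n - INR n - euler_gamma * INR n - lnfact n)%R.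
Proof.
  assert (E : rsum hrem n = (rsum (fun m => harm (S m)) n - rsum (fun m => ln (INR (S m))) n -
     euler_gamma * INR n - 1 / 2 * harm n)%R).
  { induction n. simpl. unfold harm; simpl. ring.
    change (rsum hrem (S n)) with (rsum hrem n + hrem n)%R.
    change (rsum (fun m => harm (S m)) (S n)) with (rsum (fun m => harm (S m)) n + harm (S n))%R.
    change (rsum (fun m => ln (INR (S m))) (S n)) with (rsum (fun m => ln (INR (S m))) n + ln (INR (S n)))%R.
    rewrite IHn. unfold hrem. rewrite (harm_S n), (S_INR n). assert (K := INR_ge_0 n). field. lra. }
  rewrite E, rsum_harm, rsum_lnfact. field.
Qed.

Definition stir (n : nat) : R := (lnfact n - (INR n + 1 / 2) * ln (INR n) + INR n)%R.

Lemma stir_hrem (n : nat) : (stir (S n) = 1 / 2 * euler_gamma + 1 / 2 + 1 / 4 * / INR (S n) +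
   (INR (S n) + 1 / 2) * hrem n - rsum hrem (S n))%R.
Proof.
  rewrite rsum_hrem. unfold stir, hrem. assert (P := INR_S_pos n). field. lra.
Qed.

Lemma stir_lim (r : R) : is_lim_seq (rsum hrem) r -> is_lim_seq stir (1 / 2 * euler_gamma + 1 / 2 - r)%R.
Proof.
  intros Hr. apply is_lim_seq_incr_1. eapply is_lim_seq_ext. intros n. symmetry. apply stir_hrem.
  apply is_lim_seq_minus'. 2: now apply (is_lim_seq_incr_1 (rsum hrem)).
  replace (Finite (1 / 2 * euler_gamma + 1 / 2)%R) with (Finite (1 / 2 * euler_gamma + 1 / 2 + 0 + 0)%R) by (f_equal; ring).
  apply is_lim_seq_plus'. apply is_lim_seq_plus'. apply is_lim_seq_const.
  apply is_lim_seq_0_scal, inv_S_lim.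
  destruct hrem_bound as [B [HB H]]. apply is_lim_seq_abs_0.
  apply is_lim_seq_le_le with (fun _ => 0%R) (fun n => 2 * B * pw (1 / 2) n)%R.
  2: apply is_lim_seq_const. 2: apply is_lim_seq_0_scal, pw_lim; lra.
  intros n. split. apply Rabs_pos. rewrite Rabs_mult. specialize (H n). assert (K := INR_ge_0 n).
  rewrite (Rabs_pos_eq (INR (S n) + 1 / 2)) by (rewrite S_INR; lra).
  assert (E : pw (1 / 2) n = ((INR n + 1) * pw (3 / 2) n)%R).
  { unfold pw. replace (- (1 / 2))%R with (1 + - (3 / 2))%R by field. rewrite Rpower_plus, Rpower_1; lra. }
  rewrite E, S_INR. assert (P := pw_pos (3 / 2) n). assert (A := Rabs_pos (hrem n)). nra.
Qed.

(** The logarithm of the ratio of consecutive Wallis integrals tends to 0. Written with factorials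
    it tends to [2 ln 2 + ln (pi / 2) - 2 s], which determines [s]. *)
Lemma stirling_constant (s : R) : is_lim_seq stir s -> s = (1 / 2 * ln (2 * PI))%R.
Proof.
  intros Hs.
  set (u := fun n => (ln (wallis (2 * n + 2)) - ln (wallis (2 * n + 2 + 1)))%R).
  assert (Hu0 : is_lim_seq u 0%R).
  { apply is_lim_seq_le_le with (fun _ => 0%R) inv_S; auto using is_lim_seq_const, inv_S_lim.
    intros n. unfold u.
    destruct (wallis_pos_eq (S n)) as [[P1 P2] _]. destruct (wallis_pos_eq n) as [[P3 P4] _].
    replace (2 * S n)%nat with (2 * n + 2)%nat in * by lia.
    assert (A1 := wallis_anti (2 * n + 2)). replace (S (2 * n + 2)) with (2 * n + 2 + 1)%nat in A1 by lia.
    assert (A2 := wallis_anti (2 * n + 1)). replace (S (2 * n + 1)) with (2 * n + 2)%nat in A2 by lia.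
    assert (R2 := wallis_rec (2 * n + 1)). replace (2 * n + 1 + 2)%nat with (2 * n + 2 + 1)%nat in R2 by lia.
    replace (2 * n + 1 + 1)%nat with (2 * n + 2)%nat in R2 by lia.
    assert (L1 := ln_le _ _ P2 A1). assert (L2 := ln_le _ _ P1 A2).
    assert (E1 : INR (2 * n + 2 + 1) = (INR (2 * n + 2) + 1)%R) by (rewrite plus_INR; reflexivity).
    assert (Q2 : (0 < INR (2 * n + 2))%R) by (apply lt_0_INR; lia).
    (* By monotonicity [u n] is between 0 and the logarithm of [W_(2n+1) / W_(2n+3)], which the
       recurrence evaluates as [(2 n + 3) / (2 n + 2)]. *)
    assert (L3 : (ln (INR (2 * n + 2)) + ln (wallis (2 * n + 1)) = ln (INR (2 * n + 2) + 1) + ln (wallis (2 * n + 2 + 1)))%R).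
    { rewrite <- !ln_mult by lra. rewrite <- E1. now rewrite R2. }
    assert (B := ln_S_bounds _ Q2).
    assert (I : (/ INR (2 * n + 2) <= inv_S n)%R).
    { unfold inv_S. apply Rinv_le_contravar. apply INR_S_pos. apply le_INR. lia. }
    lra. }
  assert (Hu : is_lim_seq u (2 * ln 2 + ln (PI / 2) + 2 * s - 4 * s)%R).
  { apply is_lim_seq_ext with (fun n => (ln 2 + (ln (INR (2 * S n) + 1) - ln (INR (S n)))) + ln (PI / 2) +
        2 * stir (2 * S n) - 4 * stir (S n))%R.
    - intros n. unfold u. destruct (wallis_pos_eq (S n)) as [_ [E1 E2]].
      replace (2 * n + 2)%nat with (2 * S n)%nat by lia. rewrite E1, E2.
      replace (2 * S n + 1)%nat with (S (2 * S n)) by lia. rewrite (lnfact_S (2 * S n)), (S_INR (2 * S n)).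
      unfold stir. rewrite !(mult_INR 2 (S n)). simpl (INR 2).
      rewrite (ln_mult (1 + 1) (INR (S n))). 2: lra. 2: apply INR_S_pos. replace (1 + 1)%R with 2%R by ring. field.
    - apply is_lim_seq_minus'. apply is_lim_seq_plus'. apply is_lim_seq_plus'.
      + replace (2 * ln 2)%R with (ln 2 + (ln 2 + 0))%R by ring. apply is_lim_seq_plus'. apply is_lim_seq_const.
        apply is_lim_seq_ext with (fun n => ln 2 + (ln (INR (2 * S n) + 1) - ln (INR (2 * S n))))%R.
        { intros n. rewrite (mult_INR 2 (S n)). simpl (INR 2).
          rewrite (ln_mult (1 + 1) (INR (S n))). 2: lra. 2: apply INR_S_pos. replace (1 + 1)%R with 2%R by ring. ring. }
        apply is_lim_seq_plus'. apply is_lim_seq_const.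
        apply is_lim_seq_le_le with (fun _ => 0%R) inv_S; auto using is_lim_seq_const, inv_S_lim.
        intros n. assert (Q2 : (0 < INR (2 * S n))%R) by (apply lt_0_INR; lia).
        assert (B := ln_S_bounds _ Q2). 
        assert (I : (/ INR (2 * S n) <= inv_S n)%R).
        { unfold inv_S. apply Rinv_le_contravar. apply INR_S_pos. apply le_INR. lia. }
        assert (I2 : (0 < / (INR (2 * S n) + 1))%R) by (apply Rinv_0_lt_compat; lra). lra.
      + apply is_lim_seq_const.
      + apply is_lim_seq_mult'. apply is_lim_seq_const.
        apply (is_lim_seq_subseq stir s (fun n => 2 * S n)%nat); auto. apply eventually_subseq. intros; lia.
      + apply is_lim_seq_mult'. apply is_lim_seq_const. now apply (is_lim_seq_incr_1 stir). }
  apply is_lim_seq_unique in Hu0. apply is_lim_seq_unique in Hu. rewrite Hu0 in Hu. injection Hu as Hu.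
  assert (P := PI_RGT_0). rewrite ln_div in Hu by lra. rewrite ln_mult by lra. lra.
Qed.

Lemma hrem_cser : cser (fun m => RtoC (hrem m)) (1 / 2 * euler_gamma + 1 / 2 - 1 / 2 * ln (2 * PI)).
Proof.
  destruct hrem_bound as [B [HB H]].
  destruct (cser_abs (fun m => RtoC (hrem m)) (fun m => B * pw (3 / 2) m)%R) as [l Hl].
  { intros k. rewrite Cmod_R. apply H. }
  { apply summable_scal; auto. apply summable_pw. lra. }
  assert (E : is_lim_seq (rsum hrem) (Re l)).
  { assert (K := Clim_Re _ _ Hl). eapply is_lim_seq_ext. 2: exact K. intros n. cbv beta.
    now rewrite csum_RtoC. }
  assert (S1 := stirling_constant _ (stir_lim _ E)).
  replace (1 / 2 * euler_gamma + 1 / 2 - 1 / 2 * ln (2 * PI)) with (RtoC (Re l)).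
  - eapply Clim_ext. intros n. symmetry. apply csum_RtoC. now apply Clim_RtoC.
  - replace (1 / 2) with (RtoC (1 / 2)) by (rewrite RtoC_div by lra; reflexivity).
    rewrite <- !RtoC_mult, <- RtoC_plus, <- RtoC_minus. f_equal. lra.
Qed.

(** * Third-order expansion of the exponential *)

Lemma Dc_exp_line (u : C) (t : R) : Dc (fun t => Cexp (- (t * u))) t (- u * Cexp (- (t * u))).
Proof.
  apply Dc_Cexp. apply Dc_ext with (fun t => RtoC t * - u). intros; ring.
  eapply Dc_eq. apply Dc_mult. apply Dc_id. apply Dc_const. cbv beta. ring.
Qed.

Lemma Cexp_opp_taylor3 (u : C) : (0 <= Re u)%R ->
  (Cmod (1 - Cexp (- u) - u + u * u / 2) <= Cmod u ^ 3)%R.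
Proof.
  intros Hu.
  assert (K := mean_value (fun t => Cexp (- (t * u)) + t * u - (t ^ 2)%C * (u * u / 2))
     (fun t => u * (1 - Cexp (- (t * u)) - t * u)) 0 1 (Cmod u ^ 3)).
  cbv beta in K. rewrite Rminus_0_r, Rmult_1_r in K.
  replace (Cmod (1 - Cexp (- u) - u + u * u / 2)) with
    (Cmod (Cexp (- (1 * u)) + 1 * u - (1 ^ 2)%C * (u * u / 2) - (Cexp (- (0 * u)) + 0 * u - (0 ^ 2)%C * (u * u / 2)))).
  2: { replace (- (0 * u)) with (RtoC 0) by ring. rewrite Cexp_0. rewrite <- Cmod_opp. f_equal.
       replace (- (1 * u)) with (- u) by ring. simpl Cpow. field. }
  apply K. lra.
  - intros t Ht. eapply Dc_eq. apply Dc_minus. apply Dc_plus. apply Dc_exp_line.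
    apply Dc_mult. apply Dc_id. apply Dc_const. apply Dc_mult. apply Dc_pow. apply Dc_const.
    cbv beta. simpl Cpow. simpl INR. rewrite RtoC_plus. field.
  - intros t Ht. rewrite Cmod_mult. simpl. rewrite Rmult_1_r. apply Rmult_le_compat_l. apply Cmod_ge_0.
    eapply Rle_trans. apply Cexp_opp_taylor. creim. nra.
    rewrite Cmod_mult, Cmod_R, Rabs_pos_eq by lra. assert (A := Cmod_ge_0 u). 
    assert (0 <= t * Cmod u <= Cmod u)%R by nra. nra.
Qed.

Lemma Cexp_opp_taylor4 (u : C) : (0 <= Re u)%R ->
  (Cmod (1 - Cexp (- u) - u + u * u / 2 - u * u * u / 6) <= Cmod u ^ 4)%R.
Proof.
  intros Hu.
  assert (K := mean_value (fun t => Cexp (- (t * u)) + t * u - (t ^ 2)%C * (u * u / 2) + (t ^ 3)%C * (u * u * u / 6))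
     (fun t => u * (1 - Cexp (- (t * u)) - t * u + (t * u) * (t * u) / 2)) 0 1 (Cmod u ^ 4)).
  cbv beta in K. rewrite Rminus_0_r, Rmult_1_r in K.
  replace (Cmod (1 - Cexp (- u) - u + u * u / 2 - u * u * u / 6)) with
    (Cmod (Cexp (- (1 * u)) + 1 * u - (1 ^ 2)%C * (u * u / 2) + (1 ^ 3)%C * (u * u * u / 6) -
      (Cexp (- (0 * u)) + 0 * u - (0 ^ 2)%C * (u * u / 2) + (0 ^ 3)%C * (u * u * u / 6)))).
  2: { replace (- (0 * u)) with (RtoC 0) by ring. rewrite Cexp_0. rewrite <- Cmod_opp. f_equal.
       replace (- (1 * u)) with (- u) by ring. simpl Cpow. field. }
  apply K. lra.
  - intros t Ht. eapply Dc_eq. apply Dc_plus. apply Dc_minus. apply Dc_plus. apply Dc_exp_line.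
    apply Dc_mult. apply Dc_id. apply Dc_const. apply Dc_mult. apply Dc_pow. apply Dc_const.
    apply Dc_mult. apply Dc_pow. apply Dc_const.
    cbv beta. simpl Cpow. simpl INR. rewrite !RtoC_plus. field.
  - intros t Ht. rewrite Cmod_mult. change (Cmod u ^ 4)%R with (Cmod u * Cmod u ^ 3)%R.
    apply Rmult_le_compat_l. apply Cmod_ge_0.
    eapply Rle_trans. apply Cexp_opp_taylor3. creim. nra.
    rewrite Cmod_mult, Cmod_R, Rabs_pos_eq by lra. assert (A := Cmod_ge_0 u). 
    apply pow_incr. nra.
Qed.

(** The normalised cubic remainder. It turns the expansion of [exp (- u)] into an exact identity, so
    cancellations between singular terms become field computations and only the limit [1 / 6] is
    analytic. *)
Definition R3 (u : C) : C := (1 - Cexp (- u) - u + u * u / 2) / (u * u * u).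

Lemma Cexp_R3 (u : C) : u <> 0 -> Cexp (- u) = 1 - u + u * u / 2 - u * u * u * R3 u.
Proof. intros H. unfold R3. field. auto. Qed.

Lemma Clim_inv_S : Clim (fun j => RtoC (inv_S j)) 0.
Proof. apply Clim_RtoC, inv_S_lim. Qed.

Lemma R3_lim (w : C) : (0 < Re w)%R -> Clim (fun j => R3 (inv_S j * w)) (1 / 6).
Proof.
  intros Hw. apply Clim_squeeze with (fun j => Cmod w * inv_S j)%R O.
  2: apply is_lim_seq_0_scal, inv_S_lim.
  intros j _. set (u := inv_S j * w). assert (P := inv_S_pos j).
  assert (Hu : (0 < Re u)%R) by (unfold u; creim; nra).
  assert (Hu0 := right_neq_0 u Hu). assert (Hup := Cmod_pos u Hu0).
  assert (T := Cexp_opp_taylor4 u). assert (T' : (Cmod (1 - Cexp (- u) - u + u * u / 2 - u * u * u / 6) <= Cmod u ^ 4)%R) by (apply T; lra).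
  replace (R3 u - 1 / 6) with ((1 - Cexp (- u) - u + u * u / 2 - u * u * u / 6) / (u * u * u)) by (unfold R3; field; auto).
  rewrite Cmod_div by (apply Cmult_neq_0; [apply Cmult_neq_0|]; exact Hu0). rewrite (Cmod_mult (u * u) u), (Cmod_mult u u).
  replace (Cmod w * inv_S j)%R with (Cmod u).
  2: { unfold u. rewrite Cmod_mult, Cmod_R, Rabs_pos_eq; lra. }
  assert (P3 : (0 < Cmod u * Cmod u * Cmod u)%R) by (repeat apply Rmult_lt_0_compat; auto).
  apply Rmult_le_reg_r with (Cmod u * Cmod u * Cmod u)%R; auto.
  unfold Rdiv. rewrite Rmult_assoc, Rinv_l, Rmult_1_r by lra. simpl in T'. lra.
Qed.

(** * The Basel series *)

Lemma tpi_sqr : tpi * tpi = RtoC (- (4 * (PI * PI))).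
Proof. unfold tpi. apply C_eq; creim; ring. Qed.

Lemma el_10_inv (w : C) : slit w -> el 1 0 w = / w.
Proof. intros H. unfold el. field. now apply slit_neq_0. Qed.

Lemma cser_q (q : C) : (Cmod q < 1)%R -> cser (fun m => (q ^ S m)%C) (q / (1 - q)).
Proof.
  intros H. eapply cser_ext. 2: apply (cser_scal q); now apply cser_geom. reflexivity.
Qed.

(** The Lipschitz formula for [1 / w] at [2 c] and [c], divided by [c = 1 / (j + 1)]. The offsets
    [n tpi] and [- n tpi] pair to real fractions; the offset 0 contributes [- 1 / (2 c)] and moves
    to the other side. *)
Lemma basel_step (j : nat) : 
  cser (fun k => RtoC (4 / (4 * (inv_S j * inv_S j) + 4 * (PI * PI) * (INR (S k) * INR (S k))) -
     2 / (inv_S j * inv_S j + 4 * (PI * PI) * (INR (S k) * INR (S k)))))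
   ((4 * R3 (inv_S j * 2) - 1 / 2 + inv_S j * R3 (inv_S j * 1)) /
    (2 - 2 * inv_S j + 8 * (inv_S j * inv_S j) * R3 (inv_S j * 2))).
Proof.
  set (c := inv_S j). assert (P := inv_S_pos j). fold c in P.
  assert (HPI := PI_RGT_0).
  assert (Hc0 : RtoC c <> 0) by (intros K; apply RtoC_inj in K; lra).
  destruct (lipschitz_formula 1 0 (c * 2) (c * 1)) as [L [H1 H2]]. { creim; lra. } { creim; lra. }
  set (q := Cexp (- (c * 1))) in *.
  assert (Hq : (Cmod q < 1)%R). { apply Cexp_lt_1. creim. lra. }
  assert (Hq2 : Cexp (- (c * 2)) = q * q). { unfold q. rewrite <- Cexp_plus. f_equal. ring. }
  assert (Hqq : (Cmod (q * q) < 1)%R). { rewrite Cmod_mult. assert (A := Cmod_ge_0 q). nra. }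
  assert (S1 := slit_neq_0 _ (one_minus_slit _ Hq)). assert (S2 := slit_neq_0 _ (one_minus_slit _ Hqq)).
  assert (EL : L = q * q / (1 - q * q) - q / (1 - q)).
  { eapply cser_unique. exact H2. eapply cser_ext. 2: apply cser_minus; apply cser_q; [exact Hqq|exact Hq].
    intros m. cbv beta. rewrite <- Hq2. ring. }
  apply cser_first in H1. rewrite EL in H1.
  assert (EE : el 1 0 (c * 2 + 0) - el 1 0 (c * 1 + 0) = - (1 / (2 * c))).
  { rewrite !Cplus_0_r, !el_10_inv. field; auto. left; creim; lra. left; creim; lra. }
  assert (K1 := Cexp_R3 (c * 1)). assert (K2 := Cexp_R3 (c * 2)). fold q in K1. rewrite Hq2 in K2.
  assert (Hc1 : c * 1 <> 0) by (now rewrite Cmult_1_r).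
  assert (Hc2 : c * 2 <> 0). { apply Cmult_neq_0; auto. intros K; apply RtoC_inj in K; lra. }
  specialize (K1 Hc1). specialize (K2 Hc2).
  (* Numerator and denominator with their powers of [c] already divided out, so that the limit as
     [c] tends to 0 is no longer of the form [0 / 0]. *)
  assert (Hden : 2 - 2 * c + 8 * (c * c) * R3 (c * 2) = (1 - q * q) / c).
  { rewrite K2. field. auto. }
  assert (Hnum : 4 * R3 (c * 2) - 1 / 2 + c * R3 (c * 1) = ((1 - q * q) / 2 - c * q) / (c * c * c)).
  { rewrite K2, K1. field. auto. }
  rewrite Hden, Hnum.
  replace (((1 - q * q) / 2 - c * q) / (c * c * c) / ((1 - q * q) / c)) with
    (/ c * (q * q / (1 - q * q) - q / (1 - q) - - (1 / (2 * c)))).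
  2: { field. auto. }
  eapply cser_ext. 2: apply (cser_scal (/ c)); unfold pairz at 2 in H1; rewrite EE in H1; exact H1.
  intros k. cbv beta. unfold pairz. set (n := INR (S k)). assert (Pn := INR_S_pos k). fold n in Pn.
  assert (Sl : forall (a : R) o, (0 < a)%R -> Re o = 0%R -> slit (c * a + o)).
  { intros a o Ha Ho. left. creim. rewrite Ho. nra. }
  assert (Ho : Re (n * tpi) = 0%R /\ Re (- (n * tpi)) = 0%R) by (creim; rewrite tpi_Re; split; ring).
  destruct Ho as [Ho1 Ho2].
  rewrite !el_10_inv by (apply Sl; auto; lra).
  assert (G : forall a : R, (0 < a)%R -> / (c * a + n * tpi) + / (c * a + - (n * tpi)) =
     RtoC (2 * (c * a) / (c * a * (c * a) + 4 * (PI * PI) * (n * n)))).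
  { intros a Ha. assert (N1 := slit_neq_0 _ (Sl a _ Ha Ho1)). assert (N2 := slit_neq_0 _ (Sl a _ Ha Ho2)).
    assert (D : (0 < c * a * (c * a) + 4 * (PI * PI) * (n * n))%R).
    { assert (0 < c * a)%R by nra. assert (0 < PI * PI)%R by nra. assert (0 < n * n)%R by nra. nra. }
    assert (D2 : (c * a + n * tpi) * (c * a + - (n * tpi)) = RtoC (c * a * (c * a) + 4 * (PI * PI) * (n * n))).
    { replace ((c * a + n * tpi) * (c * a + - (n * tpi))) with (c * a * (c * a) - n * n * (tpi * tpi)) by ring.
      rewrite tpi_sqr, <- !RtoC_mult, <- RtoC_minus. f_equal. ring. }
    rewrite RtoC_div by lra. rewrite <- D2, !RtoC_mult. field. split; auto. }
  assert (G1 := G 1%R Rlt_0_1). assert (G2 := G 2%R Rlt_0_2).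
  replace (/ (c * 2 + n * tpi) - / (c * 1 + n * tpi) + (/ (c * 2 + - (n * tpi)) - / (c * 1 + - (n * tpi)))) with
    ((/ (c * 2 + n * tpi) + / (c * 2 + - (n * tpi))) - (/ (c * 1 + n * tpi) + / (c * 1 + - (n * tpi)))) by ring.
  rewrite G1, G2, <- RtoC_minus, <- RtoC_inv, <- RtoC_mult by lra. f_equal.
  assert (0 < PI * PI)%R by nra. assert (0 < n * n)%R by nra. assert (0 < c * c)%R by nra.
  assert (0 < PI * PI * (n * n))%R by nra.
  field. repeat split; nra.
Qed.

Lemma basel : cser (fun k => RtoC (/ (INR (S k) * INR (S k)))) (PI ^ 2 / 6).
Proof.
  assert (HPI := PI_RGT_0). assert (HP2 : (0 < PI * PI)%R) by nra.
  assert (HPc := RtoC_PI_neq_0).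
  assert (Hn : forall k, (0 < INR (S k) * INR (S k))%R). { intros k. assert (P := INR_S_pos k). nra. }
  assert (Hs : summable (fun k => / (INR (S k) * INR (S k)))%R).
  { apply summable_le with (pw 2). 2: apply summable_pw; lra.
    intros k. rewrite pw_2, S_INR in *. specialize (Hn k). rewrite S_INR in Hn. split. 2: lra.
    left. now apply Rinv_0_lt_compat. }
  destruct (tannery_series
    (fun j k => RtoC (4 / (4 * (inv_S j * inv_S j) + 4 * (PI * PI) * (INR (S k) * INR (S k))) -
     2 / (inv_S j * inv_S j + 4 * (PI * PI) * (INR (S k) * INR (S k)))))
    (fun j => ((4 * R3 (inv_S j * 2) - 1 / 2 + inv_S j * R3 (inv_S j * 1)) /
    (2 - 2 * inv_S j + 8 * (inv_S j * inv_S j) * R3 (inv_S j * 2))))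
    (fun k => RtoC (2 / (4 * (PI * PI) * (INR (S k) * INR (S k)))))
    (fun k => 6 / (4 * (PI * PI)) * / (INR (S k) * INR (S k)))%R) as [G [HG1 HG2]].
  - apply summable_scal; auto. left. apply Rdiv_lt_0_compat; lra.
  - intros j. apply basel_step.
  - intros j k. specialize (Hn k). rewrite Cmod_R.
    set (N := (INR (S k) * INR (S k))%R) in *. assert (Hi := inv_S_pos j). set (c := inv_S j) in *.
    assert (HN : (0 < PI * PI * N)%R) by nra. assert (Hcc : (0 < c * c)%R) by nra.
    assert (A1 : (0 < 4 / (4 * (c * c) + 4 * (PI * PI) * N) <= 4 / (4 * (PI * PI) * N))%R).
    { split. apply Rdiv_lt_0_compat; lra. unfold Rdiv. apply Rmult_le_compat_l. lra. apply Rinv_le_contravar; lra. }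
    assert (A2 : (0 < 2 / (c * c + 4 * (PI * PI) * N) <= 2 / (4 * (PI * PI) * N))%R).
    { split. apply Rdiv_lt_0_compat; lra. unfold Rdiv. apply Rmult_le_compat_l. lra. apply Rinv_le_contravar; lra. }
    replace (6 / (4 * (PI * PI)) * / N)%R with (4 / (4 * (PI * PI) * N) + 2 / (4 * (PI * PI) * N))%R by (field; lra).
    apply Rabs_le. lra.
  - intros k. specialize (Hn k). set (N := (INR (S k) * INR (S k))%R) in *. assert (HN : (0 < PI * PI * N)%R) by nra.
    apply Clim_RtoC.
    assert (Hcc : is_lim_seq (fun j => inv_S j * inv_S j)%R 0%R).
    { replace (Finite 0%R) with (Finite (0 * 0)%R) by (f_equal; ring). apply is_lim_seq_mult'; apply inv_S_lim. }
    replace (2 / (4 * (PI * PI) * N))%R with (4 / (4 * 0 + 4 * (PI * PI) * N) - 2 / (0 + 4 * (PI * PI) * N))%R by (field; lra).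
    apply is_lim_seq_minus'; apply is_lim_seq_div'; try apply is_lim_seq_const; try lra;
    apply is_lim_seq_plus'; try apply is_lim_seq_const; auto. apply is_lim_seq_mult'; auto. apply is_lim_seq_const.
  (* [(4 / 6 - 1 / 2) / 2]. The terms on the left tend to [1 / (2 pi ^ 2 n ^ 2)], which explains the
     factor [2 pi ^ 2] below. *)
  - assert (HG : G = 1 / 12).
    { eapply Clim_unique. exact HG2.
      assert (L1 : Clim (fun j => R3 (inv_S j * 1)) (1 / 6)) by (apply R3_lim; simpl; lra).
      assert (L2 : Clim (fun j => R3 (inv_S j * 2)) (1 / 6)) by (apply R3_lim; simpl; lra).
      replace (1 / 12) with ((4 * (1 / 6) - 1 / 2 + 0 * (1 / 6)) * / (2 - 2 * 0 + 8 * (0 * 0) * (1 / 6))).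
      2: { field. }
      unfold Cdiv at 1. apply Clim_mult.
      - apply Clim_plus. apply Clim_minus. now apply Clim_scal. apply Clim_const. apply Clim_mult; auto. apply Clim_inv_S.
      - apply Clim_inv. { intros K. replace (2 - 2 * 0 + 8 * (0 * 0) * (1 / 6)) with (RtoC 2) in K by field. apply RtoC_inj in K. lra. }
        apply Clim_plus. apply Clim_minus. apply Clim_const. apply Clim_scal, Clim_inv_S.
        apply Clim_mult; auto. apply Clim_scal. apply Clim_mult; apply Clim_inv_S. }
    rewrite HG in HG1. replace (PI ^ 2 / 6)%C with (2 * (PI * PI) * (1 / 12)).
    2: { simpl Cpow. field. }
    eapply cser_ext. 2: apply (cser_scal (2 * (PI * PI))); exact HG1.
    intros k. cbv beta. specialize (Hn k).
    replace (2 * (PI * PI)) with (RtoC (2 * (PI * PI))) by (rewrite !RtoC_mult; reflexivity).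
    rewrite <- RtoC_mult. f_equal. field. split. nra. assert (P := INR_S_pos k). lra.
Qed.

(** * Deviation of the harmonic numbers from the logarithm *)

Definition egap (m : nat) : R := (harm (S m) - ln (INR (S m)) - euler_gamma)%R.

(** It contains the classical identity that the sum of [H_m / m] up to [n] is half of [H_n ^ 2] plus
    the sum of [1 / m ^ 2]. *)
Lemma rsum_egap (n : nat) : rsum (fun m => egap m / INR (S m))%R n =
  (1 / 2 * (harm n * harm n) + 1 / 2 * rsum (fun m => / (INR (S m) * INR (S m)))%R n - euler_gamma * harm n
   - rsum (fun m => ln (INR (S m)) / INR (S m))%R n)%R.
Proof.
  induction n. simpl. unfold harm; simpl. ring.
  change (rsum (fun m => egap m / INR (S m))%R (S n)) with (rsum (fun m => egap m / INR (S m))%R n + egap n / INR (S n))%R.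
  change (rsum (fun m => / (INR (S m) * INR (S m)))%R (S n)) with
    (rsum (fun m => / (INR (S m) * INR (S m)))%R n + / (INR (S n) * INR (S n)))%R.
  change (rsum (fun m => ln (INR (S m)) / INR (S m))%R (S n)) with
    (rsum (fun m => ln (INR (S m)) / INR (S m))%R n + ln (INR (S n)) / INR (S n))%R.
  rewrite IHn. unfold egap. rewrite (harm_S n). assert (P := INR_S_pos n). field. lra.
Qed.

(** With [h = H_n - log n], the divergent parts reduce to [(h - gamma) * log n]. The Basel sum gives
    [pi ^ 2 / 12], the sum of [log m / m] gives [stieltjes1], and [h ^ 2 / 2 - gamma * h] gives
    [- gamma ^ 2 / 2]. *)
Lemma egap_cser : cser (fun m => RtoC (egap m / INR (S m)))
  (RtoC (PI ^ 2 / 12 - stieltjes1 - euler_gamma ^ 2 / 2)).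
Proof.
  assert (HE : is_lim_seq (fun n => harm (S n) - ln (INR (S n)))%R euler_gamma).
  { apply (is_lim_seq_incr_1 (fun n => harm n - ln (INR n))%R), harm_ln_lim. }
  assert (HB : is_lim_seq (rsum (fun m => / (INR (S m) * INR (S m)))%R) (PI ^ 2 / 6)%R).
  { assert (K := Clim_Re _ _ basel).
    replace (PI ^ 2 / 6)%R with (Re (PI ^ 2 / 6)%C).
    eapply is_lim_seq_ext. 2: exact K. intros n. cbv beta. now rewrite csum_RtoC.
    rewrite Re_div_R by lra. simpl. unfold Rdiv. ring. }
  assert (HS : is_lim_seq (fun n => rsum (fun m => ln (INR (S m)) / INR (S m))%R (S n) - 1 / 2 * (ln (INR (S n)) * ln (INR (S n))))%R stieltjes1).
  { assert (K := Clim_Re _ _ ci_01). rewrite Re_R in K.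
    assert (L := ln_S_div_lim).
    replace (Finite stieltjes1) with (Finite (stieltjes1 + 0)%R) by (f_equal; ring).
    eapply is_lim_seq_ext. 2: apply is_lim_seq_plus'; [exact K|exact L].
    intros n. cbv beta. rewrite eA_01, Clog_R by apply INR_S_pos.
    rewrite (csum_ext _ (fun j => RtoC (ln (INR (S j)) / INR (S j)))) by (intros; apply el_01, INR_S_pos).
    rewrite csum_RtoC.
    change (rsum (fun m => ln (INR (S m)) / INR (S m))%R (S n)) with
    (rsum (fun m => ln (INR (S m)) / INR (S m))%R n + ln (INR (S n)) / INR (S n))%R.
    replace (1 / 2) with (RtoC (1 / 2)) by (rewrite RtoC_div by lra; reflexivity).
    rewrite <- !RtoC_mult. creim. unfold inv_S. unfold Rdiv. ring. }
  apply Clim_incr_1. eapply Clim_ext. intros n. symmetry. apply csum_RtoC. apply Clim_RtoC.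
  eapply is_lim_seq_ext. intros n. symmetry. apply rsum_egap.
  (* [h - gamma] is at most [1 / n], which beats the logarithm. *)
  assert (HEl : is_lim_seq (fun n => (harm (S n) - ln (INR (S n)) - euler_gamma) * ln (INR (S n)))%R 0%R).
  { apply is_lim_seq_le_le with (fun _ => 0%R) (fun n => ln (INR (S n)) * inv_S n)%R.
    2: apply is_lim_seq_const. 2: apply ln_S_div_lim.
    intros n. assert (H := harm_ln_gamma n). assert (K := INR_ge_0 n).
    assert (L : (0 <= ln (INR (S n)))%R) by (apply ln_ge_0; rewrite S_INR; lra). unfold inv_S. nra. }
  replace (PI ^ 2 / 12 - stieltjes1 - euler_gamma ^ 2 / 2)%R with
    (1 / 2 * (euler_gamma * euler_gamma) + 0 - euler_gamma * euler_gamma + 1 / 2 * (PI ^ 2 / 6) - stieltjes1)%R by field.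
  apply is_lim_seq_ext with (fun n =>
    1 / 2 * ((harm (S n) - ln (INR (S n))) * (harm (S n) - ln (INR (S n)))) +
    (harm (S n) - ln (INR (S n)) - euler_gamma) * ln (INR (S n)) -
    euler_gamma * (harm (S n) - ln (INR (S n))) + 1 / 2 * rsum (fun m => / (INR (S m) * INR (S m)))%R (S n) -
    (rsum (fun m => ln (INR (S m)) / INR (S m))%R (S n) - 1 / 2 * (ln (INR (S n)) * ln (INR (S n)))))%R.
  { intros n. field. }
  apply is_lim_seq_minus'; auto. apply is_lim_seq_plus'. apply is_lim_seq_minus'. apply is_lim_seq_plus'; auto.
  - apply is_lim_seq_mult'. apply is_lim_seq_const. now apply is_lim_seq_mult'.
  - apply is_lim_seq_mult'; auto. apply is_lim_seq_const.
  - apply is_lim_seq_mult'. apply is_lim_seq_const. now apply (is_lim_seq_incr_1 (rsum (fun m => / (INR (S m) * INR (S m)))%R)).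
Qed.

(** * Behaviour of the exponential series as x tends to 0 *)

(** Abel's theorem in the absolutely convergent case: [qx] has modulus at most 1 because [Re y > 0],
    so [B] dominates. *)
Lemma abel_limit (y : C) (b B : nat -> R) (l : C) : (0 < Re y)%R -> summable B ->
  (forall m, (Rabs (b m) <= B m)%R) -> cser (fun m => RtoC (b m)) l ->
  exists u, (forall j, cser (fun m => b m * qx y (inv_S j) m) (u j)) /\ Clim u l.
Proof.
  intros Hy HB Hb Hl.
  assert (Hbd : forall j m, (Cmod (b m * qx y (inv_S j) m) <= B m)%R).
  { intros j m. rewrite Cmod_mult, Cmod_R. assert (P := inv_S_pos j).
    assert (Q := qx_bound y (inv_S j) (inv_S j) m Hy). assert (Q2 : (Cmod (qx y (inv_S j) m) <= 1)%R).
    { eapply Rle_trans. apply Q; lra. rewrite <- (pow1 (S m)). apply pow_incr.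
      assert (E := exp_neg_lt_1 (inv_S j * Re y)). split. left; apply exp_pos. left; apply E. nra. }
    specialize (Hb m). assert (A := Rabs_pos (b m)). assert (A2 := Cmod_ge_0 (qx y (inv_S j) m)). nra. }
  set (u := fun j => CSeries (fun m => b m * qx y (inv_S j) m)).
  assert (Hu : forall j, cser (fun m => b m * qx y (inv_S j) m) (u j)).
  { intros j. destruct (cser_abs _ B (Hbd j) HB) as [s Hs]. unfold u. now rewrite (CSeries_cser _ _ Hs). }
  exists u. split; auto.
  destruct (tannery_series (fun j m => b m * qx y (inv_S j) m) u (fun m => RtoC (b m)) B) as [G [H1 H2]]; auto.
  - intros m. assert (E : qx y 0 m = 1).
    { unfold qx. replace (- (0 * y)) with (RtoC 0) by ring. now rewrite Cexp_0, Cpow_1_l. }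
    assert (K := Clim_scal (b m) _ _ (Clim_qx y inv_S 0 m inv_S_lim)). rewrite E, Cmult_1_r in K. exact K.
  - now rewrite (cser_unique _ _ _ Hl H1).
Qed.

(** With [x = inv_S j] and [q = exp (- x y)], [1 - q = x * vj]. The singularity of [log (1 - q)] is
    thereby isolated as [ln x], since [vj] tends to [y]. *)
Definition vj (y : C) (j : nat) : C := (1 - Cexp (- (inv_S j * y))) / inv_S j.

Lemma inv_S_neq_0 (j : nat) : RtoC (inv_S j) <> 0.
Proof. intros K. apply RtoC_inj in K. assert (P := inv_S_pos j). lra. Qed.

Lemma vj_expand (y : C) (j : nat) : (0 < Re y)%R ->
  vj y j = y - inv_S j * (y * y / 2) + inv_S j * inv_S j * (y * y * y * R3 (inv_S j * y)).
Proof.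
  intros Hy. assert (H0 := inv_S_neq_0 j). assert (Hy0 := right_neq_0 y Hy).
  unfold vj. rewrite Cexp_R3 by now apply Cmult_neq_0. field. auto.
Qed.

Lemma vj_q (y : C) (j : nat) : 1 - Cexp (- (inv_S j * y)) = inv_S j * vj y j.
Proof. assert (H0 := inv_S_neq_0 j). unfold vj. field. auto. Qed.

Lemma qj_lt_1 (y : C) (j : nat) : (0 < Re y)%R -> (Cmod (Cexp (- (inv_S j * y))) < 1)%R.
Proof. intros Hy. apply Cexp_lt_1. creim. assert (P := inv_S_pos j). nra. Qed.

Lemma vj_right (y : C) (j : nat) : (0 < Re y)%R -> (0 < Re (vj y j))%R.
Proof.
  intros Hy. assert (Hq := qj_lt_1 y j Hy). assert (K := re_le_Cmod (Cexp (- (inv_S j * y)))).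
  apply Rabs_le_between in K. assert (P := inv_S_pos j).
  unfold vj. rewrite Re_div_R by lra. apply Rdiv_lt_0_compat; auto. creim. lra.
Qed.

Lemma vj_lim (y : C) : (0 < Re y)%R -> Clim (vj y) y.
Proof.
  intros Hy. assert (L := R3_lim y Hy). assert (I := Clim_inv_S).
  eapply Clim_ext. intros j. symmetry. now apply vj_expand.
  replace y with (y - 0 * (y * y / 2) + 0 * 0 * (y * y * y * (1 / 6))) at 1 by field.
  apply Clim_plus. apply Clim_minus. apply Clim_const. apply Clim_mult; auto using Clim_const.
  apply Clim_mult. now apply Clim_mult. now apply Clim_scal.
Qed.

Lemma wj_lim (y : C) : (0 < Re y)%R -> Clim (fun j => (vj y j - y) / inv_S j) (- (y * y / 2)).
Proof.
  intros Hy. assert (L := R3_lim y Hy). assert (I := Clim_inv_S).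
  apply Clim_ext with (fun j => - (y * y / 2) + inv_S j * (y * y * y * R3 (inv_S j * y))).
  { intros j. rewrite vj_expand by auto. field. apply inv_S_neq_0. }
  replace (- (y * y / 2)) with (- (y * y / 2) + 0 * (y * y * y * (1 / 6))) at 1 by field.
  apply Clim_plus. apply Clim_const. apply Clim_mult; auto. now apply Clim_scal.
Qed.

(** A rate is needed: the difference [log vj - log y] gets multiplied by [ln x] and by [1 / x]. *)
Lemma Clog_vj_lim (y : C) : (0 < Re y)%R ->
  Clim (fun j => (Clog (vj y j) - Clog y) / inv_S j) (- (y / 2)).
Proof.
  intros Hy. assert (Hy0 := right_neq_0 y Hy).
  assert (W := wj_lim y Hy). assert (V := vj_lim y Hy).
  destruct (Clim_eps_inv _ _ V (Re y / 2)) as [N HN]. lra.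
  assert (HM := Clim_Cmod _ _ W).
  set (w := fun j => (vj y j - y) / inv_S j) in *.
  assert (HT : Clim (fun j => (Clog (vj y j) - Clog y) / inv_S j - w j / y) 0).
  { apply Clim_squeeze with (fun j => inv_S j * (Cmod (w j) * Cmod (w j) / (Re y / 2 * (Re y / 2))))%R N.
    - intros j Hj. specialize (HN j Hj). assert (P := inv_S_pos j). assert (P0 := inv_S_neq_0 j).
      assert (Ev : vj y j = y + inv_S j * w j) by (unfold w; field; auto).
      assert (Hh : (Cmod (inv_S j * w j) < Re y / 2)%R).
      { replace (inv_S j * w j) with (vj y j - y) by (rewrite Ev; ring). exact HN. }
      assert (T := Clog_taylor y (inv_S j * w j) (Re y / 2)).
      assert (T' : (Cmod (Clog (y + inv_S j * w j) - Clog y - inv_S j * w j / y) <=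
         Cmod (inv_S j * w j) * Cmod (inv_S j * w j) / (Re y / 2 * (Re y / 2)))%R).
      { apply T. lra. intros t Ht.
        assert (K := re_le_Cmod (inv_S j * w j)). apply Rabs_le_between in K.
        assert (HR : (Re y / 2 <= Re (y + t * (inv_S j * w j)))%R).
        { rewrite Re_plus, (Re_mult (RtoC t)), Re_R, Im_R. nra. }
        split. left; lra. eapply Rle_trans. exact HR. eapply Rle_trans. apply Rle_abs. apply re_le_Cmod. }
      rewrite <- Ev in T'.
      replace ((Clog (vj y j) - Clog y) / inv_S j - w j / y - 0) with
        ((Clog (vj y j) - Clog y - inv_S j * w j / y) / inv_S j) by (field; auto).
      rewrite Cmod_div by auto. rewrite Cmod_mult in T'. rewrite Cmod_R, Rabs_pos_eq in * by lra.
      apply Rmult_le_reg_r with (inv_S j). lra. unfold Rdiv at 1. rewrite Rmult_assoc, Rinv_l, Rmult_1_r by lra.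
      eapply Rle_trans. exact T'. right. field. lra.
    - replace (Finite 0%R) with (Finite (0 * (Cmod (- (y * y / 2)) * Cmod (- (y * y / 2)) / (Re y / 2 * (Re y / 2))))%R).
      2: { f_equal. ring. }
      apply is_lim_seq_mult'. apply inv_S_lim. apply is_lim_seq_mult'. now apply is_lim_seq_mult'.
      apply is_lim_seq_const. }
  apply Clim_ext with (fun j => ((Clog (vj y j) - Clog y) / inv_S j - w j / y) + w j / y). intros; ring.
  replace (- (y / 2)) with (0 + - (y * y / 2) / y) by (field; auto).
  apply Clim_plus; auto. unfold Cdiv at 1. apply Clim_mult; auto. apply Clim_const.
Qed.

Lemma Clog_1q (y : C) (j : nat) : (0 < Re y)%R ->
  Clog (1 - Cexp (- (inv_S j * y))) = RtoC (ln (inv_S j)) + Clog (vj y j).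
Proof.
  intros Hy. rewrite vj_q. apply Clog_scal. apply inv_S_pos. left. now apply vj_right.
Qed.

Lemma ln_inv_S_lim : Clim (fun j => RtoC (ln (inv_S j)) * inv_S j) 0.
Proof.
  apply Clim_ext with (fun j => RtoC (- (ln (INR (S j)) * inv_S j))).
  { intros j. rewrite <- RtoC_mult. f_equal. unfold inv_S at 2. rewrite ln_Rinv by apply INR_S_pos. ring. }
  apply Clim_RtoC. replace (Finite 0%R) with (Finite (- 0)%R) by (f_equal; ring).
  apply (is_lim_seq_opp _ 0%R). apply ln_S_div_lim.
Qed.

Lemma rho_10 (y : C) (m : nat) : rho 1 0 y m = 1.
Proof. unfold rho. ring. Qed.

(** Here the series are [- log (1 - q)] and [y q / (1 - q)]. The logarithm [ln x] cancels against
    [eA] and [1 / x] against [el]; the second-order term of [vj] leaves [y / 4]. *)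
Lemma small_limit_10 (y : C) : (0 < Re y)%R ->
  Clim (fun j => Qs 1 0 y (inv_S j) + eA 1 0 (inv_S j) - 1 / 2 * (Fs 1 0 y (inv_S j) - el 1 0 (inv_S j)))
    (- Clog y + y / 4).
Proof.
  intros Hy. assert (Hy0 := right_neq_0 y Hy). assert (V := vj_lim y Hy). assert (W := wj_lim y Hy).
  assert (Hv0 : forall j, vj y j <> 0) by (intros j; apply right_neq_0; now apply vj_right).
  apply Clim_ext with (fun j => - Clog (vj y j) - 1 / 2 * ((- ((vj y j - y) / inv_S j) - y * vj y j) * / vj y j)).
  - intros j. assert (P := inv_S_pos j). assert (P0 := inv_S_neq_0 j). assert (Hq := qj_lt_1 y j Hy).
    assert (E1 : Qs 1 0 y (inv_S j) = - Clog (1 - Cexp (- (inv_S j * y)))).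
    { apply CSeries_cser. eapply cser_ext. 2: now apply cser_log. intros m. cbv beta. rewrite rho_10. unfold qx, Cdiv. ring. }
    assert (E2 : Fs 1 0 y (inv_S j) = y * (Cexp (- (inv_S j * y)) / (1 - Cexp (- (inv_S j * y))))).
    { apply CSeries_cser. apply cser_scal. eapply cser_ext. 2: now apply cser_q. intros m. cbv beta. rewrite rho_10. unfold qx. ring. }
    rewrite E1, E2, Clog_1q, eA_10, Clog_R, el_10, RtoC_inv by (auto; lra).
    replace (Cexp (- (inv_S j * y))) with (1 - inv_S j * vj y j) at 1 by (rewrite <- vj_q; ring).
    rewrite vj_q. field. split; auto.
  - replace (- Clog y + y / 4) with (- Clog y - 1 / 2 * ((- - (y * y / 2) - y * y) * / y)) by (field; auto).
    apply Clim_minus. apply Clim_opp, Clim_Clog; auto. now left.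
    apply Clim_scal. apply Clim_mult. apply Clim_minus. now apply Clim_opp. now apply Clim_scal.
    now apply Clim_inv.
Qed.

(** [gamma + log m] is replaced by a harmonic number, whose generating functions are closed, minus
    an error that becomes summable after division by [m]. *)
Lemma rho_01_egap (y : C) (m : nat) : rho 0 1 y m = - (Clog y) - harm (S m) + egap m.
Proof. unfold rho, egap. rewrite RtoC_plus, !RtoC_minus. ring. Qed.

(** [Qs] and [Fs] become polynomials in [log (1 - q)] with coefficients rational in [q], plus three
    Abel sums. All powers of [ln x] not damped by a factor [x] cancel against [eA] and [el]. Then
    [- pi ^ 2 / 12] is [- pi ^ 2 / 6] from the dilogarithm plus [pi ^ 2 / 12] from [egap], and
    [hrem] contributes [gamma] and [ln (2 pi)]. *)
Lemma small_limit_01 (y : C) : (0 < Re y)%R ->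
  Clim (fun j => Qs 0 1 y (inv_S j) + eA 0 1 (inv_S j) - 1 / 2 * (Fs 0 1 y (inv_S j) - el 0 1 (inv_S j)))
    (1 / 2 * (Clog y * Clog y) - PI ^ 2 / 12 - stieltjes1 - euler_gamma ^ 2 / 2 -
      1 / 4 * y * (Clog y + euler_gamma - ln (2 * PI))).
Proof.
  intros Hy. assert (Hy0 := right_neq_0 y Hy). assert (V := vj_lim y Hy). assert (W := wj_lim y Hy).
  assert (D := Clog_vj_lim y Hy). assert (R := R3_lim y Hy). assert (I := Clim_inv_S).
  assert (X := ln_inv_S_lim).
  assert (Hv0 : forall j, vj y j <> 0) by (intros j; apply right_neq_0; now apply vj_right).
  assert (LV : Clim (fun j => Clog (vj y j)) (Clog y)) by (apply Clim_Clog; auto; now left).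
  (* The dilogarithm of [q]: it arises from [H_m = H_(m-1) + 1 / m] when [H_m q ^ m / m] is reduced
     to [cser_half_log_sqr]. *)
  destruct (abel_limit y (fun m => / (INR (S m) * INR (S m)))%R (pw 2) (PI ^ 2 / 6) Hy) as [li [Hli1 Hli2]].
  { apply summable_pw; lra. }
  { intros m. assert (P := INR_S_pos m). rewrite pw_2, <- S_INR, Rabs_pos_eq. lra.
    left. apply Rinv_0_lt_compat. nra. }
  { apply basel. }
  destruct (abel_limit y (fun m => egap m / INR (S m))%R (pw 2)
    (RtoC (PI ^ 2 / 12 - stieltjes1 - euler_gamma ^ 2 / 2)) Hy) as [ke [Hke1 Hke2]].
  { apply summable_pw; lra. }
  { intros m. assert (P := INR_S_pos m). assert (H := harm_ln_gamma m). unfold egap. rewrite pw_2, <- S_INR.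
    assert (Pi : (0 < / INR (S m))%R) by now apply Rinv_0_lt_compat.
    rewrite Rinv_mult. unfold Rdiv. rewrite Rabs_pos_eq by (apply Rmult_le_pos; lra).
    apply Rmult_le_compat_r; lra. }
  { apply egap_cser. }
  destruct hrem_bound as [B [HB Hh]].
  destruct (abel_limit y hrem (fun m => B * pw (3 / 2) m)%R
    (1 / 2 * euler_gamma + 1 / 2 - 1 / 2 * ln (2 * PI)) Hy) as [rr [Hrr1 Hrr2]]; auto.
  { apply summable_scal; auto. apply summable_pw; lra. }
  { apply hrem_cser. }
  set (Dj := fun j => (Clog (vj y j) - Clog y) / inv_S j) in *.
  (* The expression after the cancellations: [ln x] occurs only as [x * ln x], multiplied by factors
     that converge. *)
  apply Clim_ext with (fun j =>
    Clog y * Clog (vj y j) - 1 / 2 * (Clog (vj y j) * Clog (vj y j)) - (RtoC (ln (inv_S j)) * inv_S j) * Dj j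
    - li j + ke j - 1 / 2 * (y * Dj j * / vj y j
      - (RtoC (ln (inv_S j)) * inv_S j) * ((y * y * y * R3 (inv_S j * y) - y * y * y / 4 +
           inv_S j * (y * y * y * y / 2 * R3 (inv_S j * y))) * / vj y j)
      + y * Clog y - 1 / 2 * y * Clog (vj y j) + y * rr j)).
  - intros j. assert (P := inv_S_pos j). assert (P0 := inv_S_neq_0 j). assert (Hq := qj_lt_1 y j Hy).
    set (q := Cexp (- (inv_S j * y))) in *. set (La := Clog (1 - q)).
    assert (H1q := slit_neq_0 _ (one_minus_slit q Hq)).
    assert (S1 := cser_log q Hq). assert (S2 := cser_half_log_sqr q Hq). assert (S3 := cser_harm q Hq).
    assert (S4 := cser_q q Hq).
    specialize (Hli1 j). specialize (Hke1 j). specialize (Hrr1 j).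
    assert (E1 : Qs 0 1 y (inv_S j) = Clog y * La - 1 / 2 * (La * La) - li j + ke j).
    { apply CSeries_cser.
      replace (Clog y * La - 1 / 2 * (La * La) - li j + ke j) with
        (- Clog y * - La - 1 / 2 * (La * La) - li j + ke j) by ring.
      eapply cser_ext. 2: apply cser_plus; [apply cser_minus; [apply cser_minus; [apply (cser_scal (- Clog y)); exact S1|exact S2]|exact Hli1]|exact Hke1].
      intros m. cbv beta. assert (Pm := INR_S_pos m). assert (Pm0 := INR_S_neq_0 m).
      rewrite rho_01_egap, harm_S, RtoC_plus, RtoC_inv, RtoC_inv, RtoC_mult, RtoC_div by (try apply Rmult_integral_contrapositive_currified; lra).
      change (qx y (inv_S j) m) with (q ^ S m)%C. field. auto. }
    assert (E2 : Fs 0 1 y (inv_S j) = y * (- Clog y * (q / (1 - q)) - - La / (1 - q) + (1 / 2 * - La + rr j))).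
    { apply CSeries_cser. apply cser_scal.
      apply cser_first in S3. replace (harm 0 * q ^ 0)%C with (RtoC 0) in S3 by (unfold harm; simpl; ring).
      replace (- La / (1 - q)) with (- Clog (1 - q) / (1 - q) - 0) by (unfold La; ring).
      eapply cser_ext. 2: apply cser_plus; [apply cser_minus; [apply (cser_scal (- Clog y)); exact S4|exact S3]|
        apply cser_plus; [apply (cser_scal (1 / 2)); exact S1|exact Hrr1]].
      intros m. cbv beta. assert (Pm := INR_S_pos m). assert (Pm0 := INR_S_neq_0 m).
      (* In [Fs] there is no division by [m], so [egap] is not summable as it stands; its leading
         part [1 / (2 m)] is summed exactly to [- log (1 - q) / 2] and the rest is [hrem]. *)
      rewrite rho_01_egap. replace (egap m) with (hrem m + 1 / 2 * / INR (S m))%R by (unfold egap, hrem; ring).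
      rewrite RtoC_plus, RtoC_mult, RtoC_inv, RtoC_div by lra.
      change (qx y (inv_S j) m) with (q ^ S m)%C. field. auto. }
    assert (ELa : La = RtoC (ln (inv_S j)) + Clog (vj y j)) by (unfold La, q; now apply Clog_1q).
    rewrite E1, E2, eA_01, Clog_R, el_01, RtoC_div by lra.
    assert (Eq : q = 1 - inv_S j * vj y j) by (unfold q; rewrite <- vj_q; ring).
    rewrite Eq, ELa.
    (* In [(v - y) / x + y v / 2] the limits [- y ^ 2 / 2] and [y ^ 2 / 2] cancel, so one further
       division by [x] stays bounded. This pairs [ln x] with a factor [x]. *)
    assert (Ekey : y * y * y * R3 (inv_S j * y) - y * y * y / 4 + inv_S j * (y * y * y * y / 2 * R3 (inv_S j * y)) =
       ((vj y j - y) / inv_S j + y * vj y j / 2) / inv_S j).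
    { rewrite (vj_expand y j Hy). field. auto. }
    rewrite Ekey. unfold Dj. set (v := vj y j) in *. specialize (Hv0 j). fold v in Hv0.
    set (l := Clog v). set (lx := RtoC (ln (inv_S j))). set (x := RtoC (inv_S j)) in *.
    field. repeat split; auto. replace (1 - (1 - x * v)) with (x * v) by ring. now apply Cmult_neq_0.
  - assert (E : RtoC (PI ^ 2 / 12 - stieltjes1 - euler_gamma ^ 2 / 2) = PI ^ 2 / 12 - stieltjes1 - euler_gamma ^ 2 / 2).
    { rewrite !RtoC_minus, !RtoC_div, !RtoC_pow by lra. reflexivity. }
    rewrite E in Hke2.
    assert (Efin :
     (Clog y * Clog y - 1 / 2 * (Clog y * Clog y) - 0 * (- (y / 2)) - PI ^ 2 / 6 +
       (PI ^ 2 / 12 - stieltjes1 - euler_gamma ^ 2 / 2) - 1 / 2 * (y * - (y / 2) * / y - 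
       0 * ((y * y * y * (1 / 6) - y * y * y / 4 + 0 * (y * y * y * y / 2 * (1 / 6))) * / y) +
       y * Clog y - 1 / 2 * y * Clog y + y * (1 / 2 * euler_gamma + 1 / 2 - 1 / 2 * ln (2 * PI)))) =
     1 / 2 * (Clog y * Clog y) - PI ^ 2 / 12 - stieltjes1 - euler_gamma ^ 2 / 2 -
      1 / 4 * y * (Clog y + euler_gamma - ln (2 * PI))).
    { field. auto. }
    rewrite <- Efin.
    assert (IV : Clim (fun j => / vj y j) (/ y)) by now apply Clim_inv.
    apply Clim_minus.
    + apply Clim_plus; auto. apply Clim_minus; auto. apply Clim_minus. apply Clim_minus.
      * now apply Clim_scal.
      * apply Clim_scal. now apply Clim_mult.
      * now apply Clim_mult.
    + apply Clim_scal. apply Clim_plus. 2: now apply Clim_scal.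
      apply Clim_minus. 2: now apply Clim_scal. apply Clim_plus. 2: apply Clim_const.
      apply Clim_minus.
      * apply Clim_mult; auto. now apply Clim_scal.
      * apply Clim_mult; auto. apply Clim_mult; auto. apply Clim_plus.
        -- apply Clim_minus. now apply Clim_scal. apply Clim_const.
        -- apply Clim_mult; auto. now apply Clim_scal.
Qed.

(** * The two identities for the Lambert series *)

Lemma cser_series1 (f : nat -> C) (l : C) : cser (fun k => f (S k)) l -> ex_series1 f /\ CSeries1 f = l.
Proof.
  intros H. split. exists l. now apply is_series_cser. now apply CSeries_cser.
Qed.

Lemma Cexp_n_minus_1 (y : C) (m : nat) : (0 < Re y)%R -> Cexp (INR (S m) * y) - 1 <> 0.
Proof.
  intros Hy K. assert (P := INR_S_pos m).
  assert (H : (Cmod (Cexp (- (INR (S m) * y))) < 1)%R). { apply Cexp_lt_1. creim. nra. }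
  rewrite Cexp_opp in H. replace (Cexp (INR (S m) * y)) with (Cexp (INR (S m) * y) - 1 + 1) in H by ring.
  rewrite K in H. replace (/ (0 + 1)) with (RtoC 1) in H by field. rewrite Cmod_1 in H. lra.
Qed.

Theorem theorem1p1 :
  forall y : C, (0 < Re y)%R ->
    (ex_series1 (lambert_log y) /\ ex_series1 (lambert_gamma_log y) /\
     ex_series1 (digamma_term y) /\ ex_series1 (psi1_term y)) /\
    CSeries1 (lambert_log y) =
      - (1 / 4) * Clog (2 * PI) + 1 / (2 * y) * Clog y ^ 2
      - euler_gamma ^ 2 / (2 * y) + PI ^ 2 / (12 * y)
      - 2 / y * (euler_gamma + Clog y) * CSeries1 (digamma_term y)
      + 1 / y * CSeries1 (psi1_term y) /\
    y * CSeries1 (lambert_gamma_log y) - 1 / 4 * y * Clog y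
      + y * (1 / 4 * Clog (2 * PI) - euler_gamma / 4)
      + 1 / 2 * Clog y ^ 2 - euler_gamma ^ 2 / 2 - PI ^ 2 / 12
      = CSeries1 (psi1_term y).
Proof.
  intros y Hy. assert (Hy0 := right_neq_0 y Hy). assert (Ha := per_Im y Hy).
  destruct (Fs_double_sum 1 0 y Hy) as [FF0 [A1 A2]].
  destruct (Fs_double_sum 0 1 y Hy) as [FF1 [B1 B2]].
  assert (V0 := lattice_sum 1 0 y _ _ _ _ Hy (small_limit_10 y Hy) A1 ci_10 (fun k => tz_cser 1 0 (per y) k Ha)).
  assert (V1 := lattice_sum 0 1 y _ _ _ _ Hy (small_limit_01 y Hy) B1 ci_01 (fun k => tz_cser 0 1 (per y) k Ha)).
  assert (Hd : cser (fun k => digamma_term y (S k)) (- (1 / 2) * (- Clog y + y / 4 - FF0 + euler_gamma))).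
  { eapply cser_ext. 2: apply cser_scal; exact V0. intros k. symmetry. now apply digamma_term_Wt. }
  assert (Hp := cser_ext _ _ _ (fun k => eq_sym (psi1_term_Wt y k Hy)) V1).
  assert (Hlog : forall m, Clog (INR (S m) * y) = ln (INR (S m)) + Clog y).
  { intros m. apply Clog_scal. apply INR_S_pos. now left. }
  (* For [(0, 1)] the coefficient [rho] is [- (gamma + log (m y))], whence the sign. *)
  assert (Hg : cser (fun m => lambert_gamma_log y (S m)) (- (FF1 / y))).
  { replace (- (FF1 / y)) with (- (1 / y) * FF1) by (field; auto).
    eapply cser_ext. 2: apply cser_scal; exact B2. intros m. cbv beta. unfold lambert_gamma_log, rho.
    rewrite Hlog, RtoC_plus. field. split; auto. now apply Cexp_n_minus_1. }
  (* [log m = (gamma + log (m y)) - (gamma + log y)]: the second part multiplies the Lambert series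
     of the case [(1, 0)], which the digamma sum evaluates. *)
  assert (Hl : cser (fun m => lambert_log y (S m)) (- (FF1 / y) - (euler_gamma + Clog y) * (FF0 / y))).
  { replace (- (FF1 / y) - (euler_gamma + Clog y) * (FF0 / y)) with
      (- (FF1 / y) - (euler_gamma + Clog y) / y * FF0) by (field; auto).
    eapply cser_ext. 2: apply cser_minus; [exact Hg|apply cser_scal; exact A2].
    intros m. cbv beta. unfold lambert_gamma_log, lambert_log. rewrite rho_10, Hlog, Clog_R by apply INR_S_pos.
    field. split; auto. now apply Cexp_n_minus_1. }
  apply cser_series1 in Hd. apply cser_series1 in Hp. apply cser_series1 in Hg. apply cser_series1 in Hl.
  destruct Hd as [Hd1 Hd2]. destruct Hp as [Hp1 Hp2]. destruct Hg as [Hg1 Hg2]. destruct Hl as [Hl1 Hl2].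
  split. { auto. }
  assert (E2 : Clog (2 * PI) = ln (2 * PI)).
  { rewrite <- RtoC_mult. apply Clog_R. assert (P := PI_RGT_0). lra. }
  (* All four sums are now affine in [FF0] and [FF1], and [stieltjes1] cancels inside the [psi1]
     sum; both identities are then field computations. *)
  rewrite Hd2, Hp2, Hg2, Hl2, E2. split; field; auto.
Qed.
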